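(* Let $a,b$ be real numbers with $a>0$, $1/2\le b<1$ and $a+b\neq 1$. Then the equality $$\frac{a}{\pi}\int_{-\infty}^{\infty}\frac{\ln\bigl|\zeta(b+it)\,(b-1+it)\bigr|}{a^2+t^2}\,dt=\ln\bigl|\zeta(a+b)\,(a+b-1)\bigr|$$ holds if and only if the Riemann zeta function $\zeta$ has no zeros $\sigma+it$ with $\sigma>b$. In particular, for $b=1/2$ this equality is equivalent to the Riemann hypothesis.
   Context: $\zeta$ denotes the Riemann zeta function. The Riemann hypothesis is the statement that all non-trivial zeros of $\zeta$ have real part $1/2$; equivalently, $\zeta$ has no zeros with real part $>1/2$. *)

(* Defs.v *)
From HB Require Import structures.
From mathcomp Require Import all_boot all_order all_algebra.
From mathcomp Require Import all_classical all_reals all_analysis.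
From mathcomp Require Import complex.

Set Implicit Arguments.
Unset Strict Implicit.
Unset Printing Implicit Defensive.

Import Order.TTheory GRing.Theory Num.Theory.
Import numFieldNormedType.Exports.
Local Open Scope classical_set_scope.
Local Open Scope ring_scope.
Local Open Scope complex_scope.

Definition fracpart (R : realType) (x : R) : R := x - (Num.floor x)%:~R.

(* For s = sigma + i t with x > 0:
     {x} x^{-s-1} = {x} x^{-sigma-1} (cos (t ln x) - i sin (t ln x)).
   zeta_tail s := \int_1^oo {x} x^{-s-1} dx, split into real and imaginary
   parts (real Lebesgue integrals). *)
Definition zeta_tail_re (R : realType) (s : R[i]) : R :=
  Rintegral (@lebesgue_measure R) `[1, +oo[
    (fun x => fracpart x * powR x (- complex.Re s - 1) * cos (complex.Im s * ln x)).

Definition zeta_tail_im (R : realType) (s : R[i]) : R :=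
  Rintegral (@lebesgue_measure R) `[1, +oo[
    (fun x => - (fracpart x * powR x (- complex.Re s - 1) * sin (complex.Im s * ln x))).

(* Riemann zeta function on the half plane Re s > 0, s <> 1, via its
   classical analytic continuation
     zeta(s) = s/(s-1) - s * \int_1^oo {x} x^{-s-1} dx.
   (For Re s > 1 this equals sum_n n^{-s}.)  Only values with Re s > 0,
   s <> 1 are meaningful; other values are junk and never used. *)
Definition zeta (R : realType) (s : R[i]) : R[i] :=
  s / (s - 1) - s * (zeta_tail_re s +i* zeta_tail_im s).

Definition cabs (R : realType) (z : R[i]) : R := Normc.normc z.

(* Main.v *)
(* Let xi(s) = (s - 1) zeta(s) and let pk a be the Poisson kernel of the
   half-plane, so that the integral of the theorem is the Poisson mean of
   ln |xi| on the line Re s = b, to be compared with ln |xi(b + a)|.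
   For a polynomial evaluated on the circle with diameter [b, b + 1/e], which is
   a Moebius image of the line, the mean of each linear factor is computed
   explicitly from the logarithmic series: it is the value at the image of b + a
   if the root is outside the disc, and strictly more if the root is inside.  By
   its Taylor expansions xi is a uniform limit of polynomials on each such disc,
   and the discs exhaust Re s > b as e -> 0.  Fatou's lemma applied to
   (majorant - ln |P_e|) gives ln |xi(b + a)| <= mean, with strict inequality if
   xi has a zero to the right of the line.
   If there is no such zero, the approximants can be chosen without roots in the
   discs, so equality holds for them.  Their negative parts lose no mass in the
   limit: on |t| <= T they are dominated because xi has finite order at its zeros
   on the line, and on |t| >= T because pk a <= (2 a / T) pk T, while the mean
   against pk T is ln |P_e| at a real point, where |xi| >= 1/2. *)
Require Import Defs.
From HB Require Import structures.
From mathcomp Require Import all_boot all_order all_algebra.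
From mathcomp Require Import all_classical all_reals all_analysis.
From mathcomp Require Import measurable_realfun complex.
From mathcomp Require Import ring lra.

Set Implicit Arguments.
Unset Strict Implicit.
Unset Printing Implicit Defensive.

Import Order.TTheory GRing.Theory Num.Theory.
Import numFieldNormedType.Exports.
Local Open Scope classical_set_scope.
Local Open Scope ring_scope.
Local Open Scope complex_scope.

(** * The Poisson kernel *)

(** Jensen's formula for a polynomial is a finite sum over its roots, so polynomial approximants
    reduce every mean to linear factors; xi is never factored and no contour integral occurs.
    Polynomials cannot approximate xi uniformly on a half-plane, hence the discs. Their circles are
    parametrized by the line itself, so the measure [pk x t dt] is the same for all [e] and only the
    integrand varies. The obstacle is the logarithm near zeros: Fatou's lemma works in one direction
    only, and the other one requires that no negative mass escapes in the limit. Zeros may lie on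
    the line, so no lower bound for xi holds there; but each closed disc touches the line only at
    the real point [b], so if xi has no zero to the right of the line it has a positive minimum on
    the disc, and approximants without roots exist. The behaviour of xi near its zeros on the line
    is not uniform in [t] either; for large [|t|] it is replaced by a bound on the total negative
    mass seen from [b + T], which is O(ln T) and loses against the factor O(1/T). *)

Section Line.
Variable R : realType.
Implicit Types f F : R -> R.
Notation mu := (@lebesgue_measure R).

(** Nonnegativity replaces integrability: only the limits of the primitive are required on each
    half-line. The cosine integrals below are made nonnegative by adding [pk]. *)
Lemma ge0_integral_line f F (l m : R) :
  (forall t, 0 <= f t) -> continuous f ->
  (forall t : R, is_derive t 1 F (f t)) ->
  F t @[t --> +oo] --> l -> F t @[t --> -oo] --> m ->
  (\int[mu]_t (f t)%:E = (l - m)%:E)%E.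
Proof.
move=> f0 cf dF Fl Fm.
have mf : measurable_fun [set: R] f by exact: continuous_measurable_fun.
have cF : continuous F.
  by move=> x; apply/differentiable_continuous/derivable1_diffP; case: (dF x).
have sT : [set: R] = `]-oo, 0] `|` `]0, +oo[.
  apply/seteqP; split => x //= _; rewrite !in_itv /= andbT.
  by have [x0|x0] := leP x 0; [left|right].
rewrite sT ge0_integral_setU //=; last 3 first.
- by apply/measurable_EFinP; rewrite -sT.
- by move=> x _; rewrite lee_fin.
- apply/disj_setPRL => x /=; rewrite !in_itv /= andbT => x0; apply/negP.
  by rewrite -ltNge.
have cfw A : {within A, continuous f} by exact: continuous_subspaceT.
have Fr (x : R) : F x @[x --> x^'+] --> F x by apply: cvg_at_right_filter; exact: cF.
rewrite integral_itv_obnd_cbnd; last exact/measurable_EFinP/measurable_funTS.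
have -> : (\int[mu]_(x in `[0%R, +oo[) (f x)%:E = l%:E - (F 0)%:E)%E.
  apply: ge0_continuous_FTC2y => //.
  by move=> x _; rewrite derive1E; apply: derive_val.
rewrite -{1}oppr0 ge0_integration_by_substitutionNy //.
have dN (x : R) : is_derive x 1 (fun t => - F (- t)) (f (- x)).
  have := is_deriveN (is_derive1_comp (f := F) (dF (- x)) (is_deriveNid x 1)).
  by rewrite mulrN1 opprK.
have -> : (\int[mu]_(x in `[0%R, +oo[) ((f \o -%R) x)%:E =
    (- m)%:E - (- F (- 0))%:E)%E.
  apply: (@ge0_continuous_FTC2y _ (f \o -%R) (fun t => - F (- t))) => //=.
  - by apply: continuous_subspaceT => x; apply: continuous_comp; [exact: opp_continuous|exact: cf].
  - by apply: cvgN; move/cvgNy_compNP : Fm.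
  - apply: (@cvg_at_right_filter _ _ (fun t => - F (- t))).
    apply: cvgN; apply: (@continuous_comp _ _ _ -%R F 0); last exact: cF.
    exact: opp_continuous.
  - by move=> x _; rewrite derive1E; case: (dN x).
by rewrite oppr0 -!EFinB -EFinD; congr EFin; ring.
Qed.

Definition pk (x t : R) : R := x / (pi * (x ^+ 2 + t ^+ 2)).

Lemma pk_den_gt0 (x t : R) : 0 < x -> 0 < x ^+ 2 + t ^+ 2.
Proof. by move=> x0; rewrite ltr_wpDr ?sqr_ge0 // exprn_gt0. Qed.

Lemma pk_gt0 (x t : R) : 0 < x -> 0 < pk x t.
Proof. by move=> x0; rewrite divr_gt0 // mulr_gt0 ?pi_gt0 // pk_den_gt0. Qed.

Lemma pk_ge0 (x t : R) : 0 < x -> 0 <= pk x t.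
Proof. by move=> x0; exact/ltW/pk_gt0. Qed.

Lemma continuous_pk (x : R) : 0 < x -> continuous (pk x).
Proof.
move=> x0 t; apply: cvgM; first exact: cvg_cst.
apply: cvgV; first by rewrite mulf_neq0 ?gt_eqF ?pi_gt0 // pk_den_gt0.
apply: cvgM; first exact: cvg_cst.
apply: cvgD; first exact: cvg_cst.
exact: exprn_continuous.
Qed.

(** Twice the argument of [x + i t]. Its derivative is [2 pi] times [pk x], so [pk x t dt] is
    normalized arc length on the unit circle in the variable [ang x t], which runs from [- pi] to
    [pi]. *)
Definition ang (x t : R) : R := atan (t / x) *+ 2.

Lemma is_derive_ang (x t : R) : 0 < x -> is_derive t 1 (ang x) (pi * pk x t *+ 2).
Proof.
move=> x0.
have H : is_derive t 1 (fun t : R => t / x) x^-1.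
  have -> : (fun t : R => t / x) = x^-1 \*: id.
    by apply/funext => y /=; rewrite mulrC.
  have := is_deriveZ (f := @id R) x^-1 (is_derive_id t 1).
  by rewrite /GRing.scale /= mulr1.
have /= := is_derive1_comp (f := @atan R) (g := fun t => t / x) (is_derive1_atan (t / x)) H.
move=> {}H; have -> : ang x = (fun t => atan (t / x)) + (fun t => atan (t / x)).
  by apply/funext => y; rewrite /ang mulr2n.
have := is_deriveD H H; congr is_derive.
rewrite mulr2n /pk; congr (_ + _);
have p0 : (pi : R) != 0 by rewrite gt_eqF // pi_gt0.
all: have h1 : x ^+ 2 + t ^+ 2 != 0 by rewrite gt_eqF // pk_den_gt0.
all: have x1 : x != 0 by rewrite gt_eqF.
all: move: (pi : R) p0 => q p0; by field; rewrite h1 p0 x1.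
Qed.

Lemma continuous_ang (x : R) : 0 < x -> continuous (ang x).
Proof.
move=> x0 t; apply/differentiable_continuous/derivable1_diffP.
by case: (is_derive_ang t x0).
Qed.

Lemma cvgy_ang (x : R) : 0 < x -> ang x t @[t --> +oo] --> pi.
Proof.
move=> x0; have -> : (pi : R) = (pi / 2) *+ 2 by rewrite mulr2n -splitr.
under eq_fun do rewrite /ang.
apply: (cvgMn (f := fun t => atan (t / x))).
apply: (cvg_comp (fun t => t / x) atan); last exact: cvgy_atan.
by apply: gt0_cvgMly; [rewrite invr_gt0|exact: cvg_id].
Qed.

Lemma angN (x t : R) : ang x (- t) = - ang x t.
Proof. by rewrite /ang mulNr atanN mulNrn. Qed.

Lemma cvgNy_ang (x : R) : 0 < x -> ang x t @[t --> -oo] --> - pi.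
Proof.
move=> x0; apply/cvgNy_compNP.
have -> : ang x \o -%R = (fun t => - ang x t) by apply/funext => t /=; rewrite angN.
by apply: cvgN; exact: cvgy_ang.
Qed.

Lemma integral_pk (x : R) : 0 < x -> (\int[mu]_t (pk x t)%:E = 1)%E.
Proof.
move=> x0; have p0 : (pi : R) != 0 by rewrite gt_eqF // pi_gt0.
have E : (pi *+ 2)^-1 * pi - (pi *+ 2)^-1 * - pi = 1 :> R.
  by move: (pi : R) p0 => q p0; field.
rewrite -E; apply: (@ge0_integral_line _ (fun t => (pi *+ 2)^-1 * ang x t)).
- by move=> t; exact: pk_ge0.
- exact: continuous_pk.
- move=> t; have := is_deriveZ (pi *+ 2)^-1 (is_derive_ang t x0).
  by rewrite /GRing.scale /=; congr is_derive; move: (pk x t) => z; move: (pi : R) p0 => q p0; field.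
- by apply: cvgM; [exact: cvg_cst|exact: cvgy_ang].
- by apply: cvgM; [exact: cvg_cst|exact: cvgNy_ang].
Qed.

Lemma integrable_pk (x : R) : 0 < x -> mu.-integrable setT (EFin \o pk x).
Proof.
move=> x0; apply/integrableP; split.
  by apply/measurable_EFinP; apply: continuous_measurable_fun; exact: continuous_pk.
under eq_integral => t _ do rewrite /= ger0_norm ?pk_ge0 //.
by rewrite integral_pk // ltry.
Qed.

Lemma integrable_bounded_pk (x C : R) (u : R -> R) : 0 < x ->
  measurable_fun setT u -> (forall t, `|u t| <= C) ->
  mu.-integrable setT (fun t => (u t * pk x t)%:E).
Proof.
move=> x0 mu_ uC.
have := integrable_pk x0 => /(integrableZl measurableT C).
apply: le_integrable => //.
  apply/measurable_EFinP/measurable_funM => //.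
  by apply: continuous_measurable_fun; exact: continuous_pk.
move=> t _; rewrite /= lee_fin !normrM ler_wpM2r ?normr_ge0 //.
exact: le_trans (uC t) (ler_norm _).
Qed.

Lemma is_derive_sin_ang (x b t : R) n : 0 < x ->
  is_derive t 1 (fun t => sin (n%:R * ang x t + b)) (cos (n%:R * ang x t + b) * (n%:R * (pi * pk x t *+ 2))).
Proof.
move=> x0; apply: (@is_derive1_comp _ sin (fun t => n%:R * ang x t + b)).
rewrite -[X in is_derive _ _ _ X]addr0.
apply: (is_deriveD (f := fun t => n%:R * ang x t) (g := fun=> b)).
exact: (is_deriveZ n%:R (is_derive_ang t x0)).
Qed.

Lemma continuous_cos_ang (x b : R) n : 0 < x -> continuous (fun t => cos (n%:R * ang x t + b)).
Proof.
move=> x0 t; apply: (@continuous_comp _ _ _ (fun t => n%:R * ang x t + b) cos); last exact: continuous_cos.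
apply: cvgD; last exact: cvg_cst.
by apply: cvgM; [exact: cvg_cst|exact: continuous_ang].
Qed.

Lemma integrable_cos_ang (x b : R) n : 0 < x ->
  mu.-integrable setT (fun t => (cos (n%:R * ang x t + b) * pk x t)%:E).
Proof.
move=> x0; apply: (@integrable_bounded_pk _ 1) => //; last by move=> t; exact: cos_max.
by apply: continuous_measurable_fun; exact: continuous_cos_ang.
Qed.

Lemma cvg_sin_comp (h : R -> R) (F : set_system R) {FF : Filter F} (l : R) :
  h t @[t --> F] --> l -> sin (h t) @[t --> F] --> sin l.
Proof. by move=> hl; apply: (cvg_comp h (@sin R) hl); exact: continuous_sin. Qed.

Lemma Rintegral_cos_ang (x b : R) n : 0 < x -> (0 < n)%N ->
  Rintegral mu setT (fun t => cos (n%:R * ang x t + b) * pk x t) = 0.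
Proof.
move=> x0 n0; have p0 : (pi : R) != 0 by rewrite gt_eqF // pi_gt0.
have n1 : n%:R != 0 :> R by rewrite pnatr_eq0 -lt0n.
(* The integrand [(1 + cos) * pk] is nonnegative, so [ge0_integral_line] applies. The sine term of
   its primitive has equal values at both ends, which are [n] full periods apart. *)
suff : Rintegral mu setT (fun t => pk x t + cos (n%:R * ang x t + b) * pk x t) = 1.
  rewrite RintegralD //; [|exact: integrable_pk|exact: integrable_cos_ang].
  rewrite {1}/Rintegral integral_pk //= => /eqP.
  by rewrite addrC eq_sym -subr_eq subrr => /eqP.
have E : (pi *+ 2)^-1 * pi + (n%:R * (pi *+ 2))^-1 * sin (n%:R * pi + b) -
    ((pi *+ 2)^-1 * - pi + (n%:R * (pi *+ 2))^-1 * sin (n%:R * - pi + b)) = 1.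
  have -> : sin (n%:R * pi + b) = sin (n%:R * - pi + b).
    have -> : n%:R * pi + b = (n%:R * - pi + b) + (pi *+ 2) *+ n.
      by rewrite -mulrnA -[(pi *+ _)]mulr_natr natrM; ring.
    by rewrite periodicn //; exact: sinD2pi.
  by move: (sin _) => z; move: (pi : R) p0 => q p0; field; rewrite n1 p0.
rewrite /Rintegral -[RHS]/(fine 1%:E); congr fine.
transitivity ((pi *+ 2)^-1 * pi + (n%:R * (pi *+ 2))^-1 * sin (n%:R * pi + b) -
    ((pi *+ 2)^-1 * - pi + (n%:R * (pi *+ 2))^-1 * sin (n%:R * - pi + b)))%:E; last by rewrite E.
apply: (@ge0_integral_line _ (fun t => (pi *+ 2)^-1 * ang x t + (n%:R * (pi *+ 2))^-1 * sin (n%:R * ang x t + b))).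
- move=> t; rewrite -{1}[pk x t]mul1r -mulrDl mulr_ge0 ?pk_ge0 //; have := cos_geN1 (n%:R * ang x t + b); lra.
- move=> t; apply: cvgD; first exact: continuous_pk.
  by apply: cvgM; [exact: continuous_cos_ang|exact: continuous_pk].
- move=> t; have := is_deriveD (is_deriveZ (pi *+ 2)^-1 (is_derive_ang t x0))
    (is_deriveZ (n%:R * (pi *+ 2))^-1 (is_derive_sin_ang b t n x0)).
  by rewrite /GRing.scale /=; congr is_derive; move: (cos _) (pk x t) => c z; move: (pi : R) p0 => q p0; field; rewrite n1 p0.
- apply: cvgD; first by apply: cvgM; [exact: cvg_cst|exact: cvgy_ang].
  apply: cvgM; first exact: cvg_cst.
  apply: cvg_sin_comp.
  apply: cvgD; last exact: cvg_cst.
  by apply: cvgM; [exact: cvg_cst|exact: cvgy_ang].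
- apply: cvgD; first by apply: cvgM; [exact: cvg_cst|exact: cvgNy_ang].
  apply: cvgM; first exact: cvg_cst.
  apply: cvg_sin_comp.
  apply: cvgD; last exact: cvg_cst.
  by apply: cvgM; [exact: cvg_cst|exact: cvgNy_ang].
Qed.

End Line.

(** * The logarithmic series *)

Section LogSeries.
Variable R : realType.
Implicit Types f F : R -> R.
Notation mu := (@lebesgue_measure R).

Lemma derive_bound_incr (g dg : R -> R) (r K : R) : 0 <= r ->
  (forall y, 0 <= y <= r -> is_derive y 1 g (dg y)) ->
  (forall y, 0 <= y <= r -> `|dg y| <= K) -> `|g r - g 0| <= K * r.
Proof.
move=> r0 dgE dgK.
have cg : {within `[0, r], continuous g}.
  apply: derivable_within_continuous => y.
  by rewrite in_itv /= => /dgE[].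
have [y|y yr ->] := @MVT_segment _ g dg 0 r r0 _ cg.
  by rewrite in_itv /= => /andP[y0 yr]; apply: dgE; rewrite !ltW.
move: yr; rewrite in_itv /= => yr.
by rewrite subr0 normrM (ger0_norm r0) ler_wpM2r // dgK.
Qed.

Lemma derive_ge0_incr (g dg : R -> R) (r : R) : 0 <= r ->
  (forall y, 0 <= y <= r -> is_derive y 1 g (dg y)) ->
  (forall y, 0 <= y <= r -> 0 <= dg y) -> g 0 <= g r.
Proof.
move=> r0 dgE dgK.
have cg : {within `[0, r], continuous g}.
  apply: derivable_within_continuous => y.
  by rewrite in_itv /= => /dgE[].
rewrite -subr_ge0.
have [y|y yr ->] := @MVT_segment _ g dg 0 r r0 _ cg.
  by rewrite in_itv /= => /andP[y0 yr]; apply: dgE; rewrite !ltW.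
move: yr; rewrite in_itv /= => yr.
by rewrite subr0 mulr_ge0 // dgK.
Qed.

(* |1 - r exp(i phi)|^2 *)
Definition sqd (r phi : R) : R := 1 - 2 * r * cos phi + r ^+ 2.

Lemma sqd_ge (r phi : R) : 0 <= r -> (1 - r) ^+ 2 <= sqd r phi.
Proof.
move=> r0; rewrite /sqd; have := cos_le1 phi; move: (cos phi) => c c1.
have : 0 <= r * (1 - c) by rewrite mulr_ge0 // subr_ge0.
by rewrite sqrrB; lra.
Qed.

Lemma sqd_le (r phi : R) : 0 <= r <= 1 -> sqd r phi <= 4.
Proof.
move=> /andP[r0 r1]; rewrite /sqd; have := cos_geN1 phi; move: (cos phi) => c c1.
have : 0 <= r * (1 + c) by rewrite mulr_ge0 //; lra.
have : r ^+ 2 <= 1 by rewrite expr_le1.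
lra.
Qed.

Lemma sqd_gt0 (r phi : R) : 0 <= r < 1 -> 0 < sqd r phi.
Proof.
move=> /andP[r0 r1]; apply: lt_le_trans (sqd_ge phi r0).
by rewrite exprn_gt0 // subr_gt0.
Qed.

(** Real part of the geometric sum of the powers of [w = y exp(i phi)], multiplied by [exp(i phi)]
    and cleared of the denominator [|1 - w|^2]. *)
Lemma geom_cos_sum (y phi : R) n :
  (\sum_(i < n) y ^+ i * cos (i.+1%:R * phi)) * sqd y phi =
  cos phi - y - y ^+ n * cos (n.+1%:R * phi) + y ^+ n.+1 * cos (n%:R * phi).
Proof.
elim: n => [|n IH].
  by rewrite big_ord0 !mul0r cos0 (mul1r phi); ring.
rewrite big_ord_recr /= mulrDl {}IH.
have H : cos (n%:R * phi) + cos (n.+2%:R * phi) = 2 * cos phi * cos (n.+1%:R * phi).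
  have -> : n%:R * phi = n.+1%:R * phi - phi by rewrite -natr1; ring.
  have -> : n.+2%:R * phi = n.+1%:R * phi + phi by rewrite -[n.+2%:R]natr1; ring.
  by rewrite cosB cosD; ring.
have -> : cos (n.+2%:R * phi) = 2 * cos phi * cos (n.+1%:R * phi) - cos (n%:R * phi).
  by rewrite -H; ring.
by rewrite /sqd !exprS; ring.
Qed.

(* Partial sums of the expansion of - ln |1 - r exp(i phi)|. *)
Definition lnser (r phi : R) n : R :=
  \sum_(i < n) r ^+ i.+1 * cos (i.+1%:R * phi) / i.+1%:R.

Lemma is_derive_exp (y : R) n :
  is_derive y 1 (fun y : R => y ^+ n) (n%:R * y ^+ n.-1).
Proof.
have -> : (fun y : R => y ^+ n) = id ^+ n by apply/funext => z; rewrite exprfctE.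
by have := is_deriveX n (is_derive_id y 1); rewrite /GRing.scale /= mulr1.
Qed.

Lemma is_derive_sqd (phi y : R) :
  is_derive y 1 (sqd ^~ phi) (2 * (y - cos phi)).
Proof.
have -> : sqd ^~ phi = (fun y : R => (- 2 * cos phi) * y) + (fun y => y ^+ 2) + (fun=> 1).
  by apply/funext => z; rewrite /sqd /= !fctE; ring.
have h1 : is_derive y 1 (fun y : R => (- 2 * cos phi) * y) (- 2 * cos phi).
  have := is_deriveZ (- 2 * cos phi) (is_derive_id y 1).
  by rewrite /GRing.scale /= mulr1.
have h2 := is_derive_exp y 2.
have := is_deriveD (is_deriveD h1 h2) (is_derive_cst (1:R) y 1).
by congr is_derive; rewrite /=; ring.
Qed.

Lemma is_derive_lnser (phi y : R) n :
  is_derive y 1 (lnser ^~ phi ^~ n) (\sum_(i < n) y ^+ i * cos (i.+1%:R * phi)).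
Proof.
elim: n => [|n IH].
  have -> : lnser ^~ phi ^~ 0%N = fun=> 0 by apply/funext => z; rewrite /lnser big_ord0.
  by rewrite big_ord0; exact: is_derive_cst.
have -> : lnser ^~ phi ^~ n.+1 = lnser ^~ phi ^~ n + (fun y => (cos (n.+1%:R * phi) / n.+1%:R) * y ^+ n.+1).
  by apply/funext => z; rewrite /lnser big_ord_recr /= !fctE; congr (_ + _); ring.
have := is_deriveD IH (is_deriveZ (cos (n.+1%:R * phi) / n.+1%:R) (is_derive_exp y n.+1)).
move=> H; apply: (is_derive_eq H); rewrite big_ord_recr /=; congr (_ + _); rewrite /GRing.scale /=.
by rewrite mulrA divfK ?pnatr_eq0 // mulrC.
Qed.

(** Differentiating in [r] turns the logarithm into a geometric series: by [geom_cos_sum] the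
    derivative is its remainder, at most [2 r^n / (1 - r)^2] on [[0, r]]. The function vanishes at
    0, and the mean value inequality gives the last factor [r]. *)
Lemma ln_series_bound (r phi : R) n : 0 <= r < 1 ->
  `|ln (sqd r phi) / 2 + lnser r phi n| <= 2 * r ^+ n.+1 / (1 - r) ^+ 2.
Proof.
move=> /andP[r0 r1].
pose g (y : R) := ln (sqd y phi) / 2 + lnser y phi n.
pose dg (y : R) := - (y ^+ n * cos (n.+1%:R * phi) - y ^+ n.+1 * cos (n%:R * phi)) / sqd y phi.
have g0 : g 0 = 0.
  rewrite /g /sqd /lnser big1 ?addr0; last by move=> i _; rewrite expr0n /= !mul0r.
  by rewrite mulr0 mul0r expr0n subr0 addr0 ln1 mul0r.
rewrite -[X in `|X|]/(g r) -[g r]subr0 -g0.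
have -> : 2 * r ^+ n.+1 / (1 - r) ^+ 2 = (2 * r ^+ n / (1 - r) ^+ 2) * r.
  by rewrite exprS; ring.
apply: (@derive_bound_incr g dg) => // y /andP[y0 yr].
- have D0 : 0 < sqd y phi by rewrite sqd_gt0 // y0 (le_lt_trans yr).
  have h1 := is_derive1_comp (g := sqd ^~ phi) (is_derive1_ln D0) (is_derive_sqd phi y).
  have -> : g = 2^-1 \*: (@ln R \o sqd ^~ phi) + lnser ^~ phi ^~ n.
    by apply/funext => z; rewrite /g /= !fctE mulrC.
  have := is_deriveD (is_deriveZ 2^-1 h1) (is_derive_lnser phi y n).
  congr is_derive; rewrite /dg; apply: (mulIf (lt0r_neq0 D0)).
  rewrite mulrDl geom_cos_sum divfK ?gt_eqF // /GRing.scale /=.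
  move: (sqd y phi) (lt0r_neq0 D0) => D D1.
  by field.
- have D0 := sqd_ge phi y0.
  have r2 : 0 < (1 - r) ^+ 2 by rewrite exprn_gt0 // subr_gt0.
  have rD : (1 - r) ^+ 2 <= sqd y phi.
    by apply: le_trans D0; rewrite lerXn2r ?nnegrE ?subr_ge0 ?lerB ?(le_trans yr) // ltW.
  have D1 : 0 <= sqd y phi by rewrite (le_trans (ltW r2)).
  rewrite /dg normrM normfV normrN (ger0_norm D1).
  apply: ler_pM => //; first by rewrite invr_ge0.
    apply: le_trans (ler_normB _ _) _.
    rewrite !normrM !normrX (ger0_norm y0).
    have yn : y ^+ n <= r ^+ n by rewrite lerXn2r.
    have yn1 : y ^+ n.+1 <= y ^+ n.
      by rewrite exprS ler_piMl ?exprn_ge0 // (le_trans yr) // ltW.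
    have y1 : 0 <= y ^+ n by rewrite exprn_ge0.
    have y2 : 0 <= y ^+ n.+1 by rewrite exprn_ge0.
    have c1 := cos_max (n.+1%:R * phi); have c2 := cos_max (n%:R * phi).
    have := ler_pM y1 (normr_ge0 _) (lexx _) c1.
    have := ler_pM y2 (normr_ge0 _) (lexx _) c2.
    rewrite !mulr1; lra.
  by rewrite lef_pV2 ?posrE // (lt_le_trans r2).
Qed.

Lemma measurable_sqd_ang (x r b : R) : 0 < x ->
  measurable_fun setT (fun t => sqd r (ang x t + b)).
Proof.
move=> x0; apply: continuous_measurable_fun => t.
apply: cvgD; last exact: cvg_cst.
apply: cvgB; first exact: cvg_cst.
apply: cvgM; first exact: cvg_cst.
apply: (@continuous_comp _ _ _ (fun t => ang x t + b) cos); last exact: continuous_cos.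
by apply: cvgD; [exact: continuous_ang|exact: cvg_cst].
Qed.

Lemma measurable_ln_sqd (x r b : R) : 0 < x ->
  measurable_fun setT (fun t => ln (sqd r (ang x t + b)) / 2).
Proof.
move=> x0; apply: measurable_funM => //.
apply: (measurableT_comp (@measurable_ln R)).
exact: measurable_sqd_ang.
Qed.

Lemma integrable_ln_sqd (x r b : R) : 0 < x -> 0 <= r < 1 ->
  mu.-integrable setT (fun t => (ln (sqd r (ang x t + b)) / 2 * pk x t)%:E).
Proof.
move=> x0 r01; apply: (@integrable_bounded_pk _ x (2 * r ^+ 1 / (1 - r) ^+ 2)) => //.
  exact: measurable_ln_sqd.
by move=> t; have := ln_series_bound (ang x t + b) 0 r01; rewrite /lnser big_ord0 addr0.
Qed.

Lemma integral_lnser (x r b : R) n : 0 < x ->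
  mu.-integrable setT (fun t => (lnser r (ang x t + b) n * pk x t)%:E) /\
  Rintegral mu setT (fun t => lnser r (ang x t + b) n * pk x t) = 0.
Proof.
move=> x0; elim: n => [|n [IH1 IH2]].
  rewrite /lnser; under eq_fun do rewrite big_ord0 mul0r.
  by under eq_Rintegral do rewrite big_ord0 mul0r; rewrite Rintegral_cst // mul0r; split => //; exact: integrable0.
have E t : lnser r (ang x t + b) n.+1 * pk x t = lnser r (ang x t + b) n * pk x t +
  r ^+ n.+1 / n.+1%:R * (cos (n.+1%:R * ang x t + n.+1%:R * b) * pk x t).
  by rewrite /lnser big_ord_recr /= mulrDl -mulrDr; ring.
have I := integrable_cos_ang (n.+1%:R * b) n.+1 x0.
have I2 : mu.-integrable setT (fun t => (r ^+ n.+1 / n.+1%:R * (cos (n.+1%:R * ang x t + n.+1%:R * b) * pk x t))%:E).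
  exact: (integrableZl measurableT (r ^+ n.+1 / n.+1%:R) I).
split.
  under eq_fun do rewrite E EFinD.
  exact: integrableD.
under eq_Rintegral do rewrite E.
rewrite RintegralD // IH2 RintegralZl // Rintegral_cos_ang // mulr0 addr0 //.
Qed.

(** Every partial sum [lnser] has mean 0, so the mean is bounded by the remainder of
    [ln_series_bound] for each [n], and this tends to 0. *)
Lemma Rintegral_ln_sqd (x r b : R) : 0 < x -> 0 <= r < 1 ->
  Rintegral mu setT (fun t => ln (sqd r (ang x t + b)) / 2 * pk x t) = 0.
Proof.
move=> x0 r01; have I := integrable_ln_sqd b x0 r01.
set J := Rintegral _ _ _.
have H n : `|J| <= 2 * r ^+ n.+1 / (1 - r) ^+ 2.
  have [I2 E2] := integral_lnser r b n x0.
  have -> : J = Rintegral mu setT (fun t => (ln (sqd r (ang x t + b)) / 2 + lnser r (ang x t + b) n) * pk x t).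
    under [RHS]eq_Rintegral do rewrite mulrDl.
    by rewrite RintegralD // E2 addr0.
  set h := fun t : R => _.
  have Ih : mu.-integrable setT (EFin \o h).
    have := integrableD measurableT I I2; congr (_.-integrable _ _).
    by apply/funext => t; rewrite /h /= mulrDl.
  apply: le_trans (le_normr_Rintegral _ Ih) _ => //.
  set C := 2 * _ / _.
  have -> : C = Rintegral mu setT (fun t => C * pk x t).
    by rewrite RintegralZl //; [rewrite /Rintegral integral_pk //= mulr1|exact: integrable_pk].
  apply: le_Rintegral => //.
  - exact: integrable_norm.
  - exact: (integrableZl measurableT C (integrable_pk x0)).
  - move=> t _; rewrite /h normrM (ger0_norm (pk_ge0 _ x0)).
    by rewrite ler_wpM2r ?pk_ge0 // ln_series_bound.
apply/eqP; rewrite -normr_le0.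
have : (fun n => 2 * r ^+ n.+1 / (1 - r) ^+ 2) @ \oo --> (0 : R).
  have /andP[r0 r1] := r01.
  rewrite -[X in _ --> X](mul0r ((1 - r) ^- 2)); apply: cvgM; last exact: cvg_cst.
  rewrite -[X in _ --> X](mulr0 2); apply: cvgM; first exact: cvg_cst.
  by rewrite (cvg_shiftS (fun n => r ^+ n)); apply: cvg_expr; rewrite ger0_norm.
move=> h; rewrite -(cvg_lim _ h) //; apply: limr_ge; first by apply/cvg_ex; exists 0.
exact: nearW.
Qed.

End LogSeries.

(** * Fatou's lemma with a one-sided limit hypothesis *)

Section Fatou.
Local Open Scope ereal_scope.
Context d (T : measurableType d) (R : realType) (m : {measure set T -> \bar R}).

Lemma limn_einf_ge (u : (\bar R)^nat) (c : \bar R) :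
  (\forall n \near \oo, c <= u n) -> c <= limn_einf u.
Proof.
move=> [N _ uN]; rewrite limn_einf_lim (cvg_lim _ (@cvg_einfs_sup _ u)) //.
apply: (@le_trans _ _ (einfs u N)).
  by apply: le_ereal_inf_tmp => _ [k /= Nk <-]; exact: uN.
by apply: ereal_sup_ubound; exists N.
Qed.

Lemma limn_einf_le (u : (\bar R)^nat) (c : \bar R) :
  (\forall n \near \oo, u n <= c) -> limn_einf u <= c.
Proof.
move=> [N _ uN]; rewrite limn_einf_lim (cvg_lim _ (@cvg_einfs_sup _ u)) //.
apply: ge_ereal_sup => _ [n _ <-].
apply: (@le_trans _ _ (u (maxn n N))); last by apply: uN; rewrite /= leq_maxr.
by apply: ereal_inf_lbound; exists (maxn n N) => //=; rewrite leq_maxl.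
Qed.

(** Pointwise convergence is asked for from below only. In the applications [f_ n] is a majorant
    minus a logarithm, which blows up where the limit function vanishes, while [f] takes a finite
    value there because [ln 0 = 0]. *)
Lemma fatou_real (f_ : nat -> T -> R) (f : T -> R) (C : R) :
  (forall n, measurable_fun setT (f_ n)) -> measurable_fun setT f ->
  (forall n t, (0 <= f_ n t)%R) -> (forall t, (0 <= f t)%R) ->
  (forall t (e : R), (0 < e)%R -> \forall n \near \oo, (f t - e <= f_ n t)%R) ->
  (forall n, m.-integrable setT (EFin \o f_ n)) ->
  (forall e : R, (0 < e)%R ->
    \forall n \near \oo, (Rintegral m setT (f_ n) <= C + e)%R) ->
  m.-integrable setT (EFin \o f) /\ (Rintegral m setT f <= C)%R.
Proof.
move=> mf_ mf f_0 f0 liminf I_ IC.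
have le1 : \int[m]_t (f t)%:E <= C%:E.
  apply: (@le_trans _ _ (\int[m]_t limn_einf (fun n => (f_ n t)%:E))).
    apply: ge0_le_integral => //.
    - by move=> t _; rewrite lee_fin.
    - exact/measurable_EFinP.
    - apply: measurableT_comp => //; apply: measurable_fun_limn_esup => n.
      by apply: measurableT_comp => //; exact/measurable_EFinP.
    - move=> t _; apply/lee_subgt0Pr => e e0; apply: limn_einf_ge.
      by near=> n; rewrite -EFinB lee_fin; near: n; exact: liminf.
  apply: le_trans (fatou _ _ _ _) _ => //.
  - by move=> n; exact/measurable_EFinP.
  - by move=> n t _; rewrite lee_fin.
  apply/lee_addgt0Pr => e e0; apply: limn_einf_le.
  near=> n; rewrite -EFinD.
  have <- : (Rintegral m setT (f_ n))%:E = \int[m]_t (f_ n t)%:E.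
    rewrite /Rintegral fineK //; exact: (integrable_fin_num measurableT (I_ n)).
  by rewrite lee_fin; near: n; exact: IC.
have I : m.-integrable setT (EFin \o f).
  apply/integrableP; split; first exact/measurable_EFinP.
  under eq_integral => t _ do rewrite /= ger0_norm //.
  exact: le_lt_trans le1 (ltry _).
split => //; rewrite -lee_fin /Rintegral fineK //.
exact: integrable_fin_num.
Unshelve. all: by end_near. Qed.

End Fatou.

(** * The logarithmic mean for a root on the unit circle *)

Section UnitCircle.
Variable R : realType.
Notation mu := (@lebesgue_measure R).

(** The series no longer converges uniformly at radius 1. Since [|1 - r exp(i phi)| <= 2], the
    functions [ln 2 - ln |1 - r exp(i phi)|] are nonnegative with mean [ln 2] for [r < 1]; Fatou's
    lemma along radii increasing to 1 bounds the limit mean by [ln 2]. *)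
Lemma ln_sqd1 (x b : R) : 0 < x ->
  mu.-integrable setT (fun t => (ln (sqd 1 (ang x t + b)) / 2 * pk x t)%:E) /\
  0 <= Rintegral mu setT (fun t => ln (sqd 1 (ang x t + b)) / 2 * pk x t).
Proof.
move=> x0.
pose f (r t : R) := (ln 2 - ln (sqd r (ang x t + b)) / 2) * pk x t.
pose r_ (n : nat) : R := 1 - n.+1%:R^-1.
have r01 n : 0 <= r_ n < 1.
  rewrite /r_ subr_ge0 invf_le1 ?ltr0n // ler1n /=.
  by rewrite ltrBlDr ltrDl invr_gt0 ltr0n.
have cr : r_ @ \oo --> (1:R).
  by rewrite -[X in _ --> X]subr0; apply: cvgB; [exact: cvg_cst|exact: cvg_harmonic].
have ln4 : ln 4 / 2 = ln 2 :> R.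
  have -> : 4 = 2 ^+ 2 :> R by ring.
  by rewrite lnXn // mulr2n mulrDl -splitr.
have f0 (r t : R) : 0 <= r <= 1 -> 0 <= f r t.
  move=> r1; rewrite /f mulr_ge0 ?pk_ge0 // subr_ge0 -ln4 ler_wpM2r //.
  have s4 := sqd_le (ang x t + b) r1.
  have [s0|s0] := ltP 0 (sqd r (ang x t + b)).
    by rewrite ler_ln ?posrE.
  by rewrite ln0 // ln_ge0 // ler1n.
have mf r : measurable_fun setT (f r).
  apply: measurable_funM.
    by apply: measurable_funB => //; exact: measurable_ln_sqd.
  by apply: continuous_measurable_fun; exact: continuous_pk.
have If r : 0 <= r < 1 -> mu.-integrable setT (EFin \o f r).
  move=> r1; have := integrableB measurableT
    (integrableZl measurableT (ln 2) (integrable_pk x0)) (integrable_ln_sqd b x0 r1).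
  by congr (_.-integrable _ _); apply/funext => t; rewrite /= -EFinB /f mulrBl.
have Ef r : 0 <= r < 1 -> Rintegral mu setT (f r) = ln 2.
  move=> r1; rewrite /f; under eq_Rintegral do rewrite mulrBl.
  rewrite RintegralB //; last 2 first.
  - exact: (integrableZl measurableT (ln 2) (integrable_pk x0)).
  - exact: integrable_ln_sqd.
  rewrite Rintegral_ln_sqd // subr0 RintegralZl //; last exact: integrable_pk.
  by rewrite /Rintegral integral_pk // mulr1.
have [] := @fatou_real _ _ R mu (fun n => f (r_ n)) (f 1) (ln 2).
- by move=> n; exact: mf.
- exact: mf.
- by move=> n t; apply: f0; have /andP[-> /ltW ->] := r01 n.
- by move=> t; apply: f0; rewrite ler01 lexx.
- move=> t e e0.
  have cs : (fun n => sqd (r_ n) (ang x t + b)) @ \oo --> sqd 1 (ang x t + b).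
    rewrite /sqd; apply: cvgD.
      apply: cvgB; first exact: cvg_cst.
      apply: cvgM; last exact: cvg_cst.
      by apply: cvgM; [exact: cvg_cst|exact: cr].
    by apply: (cvg_comp _ (fun y : R => y ^+ 2) cr); exact: exprn_continuous.
  have [s0|s0] := ltP 0 (sqd 1 (ang x t + b)).
    have H : (fun n => f (r_ n) t) @ \oo --> f 1 t.
      apply: cvgM; last exact: cvg_cst.
      apply: cvgB; first exact: cvg_cst.
      apply: cvgM; last exact: cvg_cst.
      by apply: (cvg_comp _ (@ln R) cs); exact: continuous_ln.
    near=> n; apply: ltW; rewrite ltrBlDr -ltrBlDl.
    apply: le_lt_trans (ler_norm _) _; near: n.
    by move/cvgrPdist_lt : H; apply.
  (* At the root [ln 0 = 0] gives the limit the value [ln 2 * pk x t]. The approximants exceed it as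
     soon as [sqd <= 1], for then their logarithm is nonpositive. *)
  have s1 : sqd 1 (ang x t + b) = 0.
    by apply/eqP; rewrite eq_le s0 (le_trans _ (sqd_ge _ _)) // sqr_ge0.
  near=> n; apply: (@le_trans _ _ (f 1 t)); first by rewrite gerBl ltW.
  rewrite /f ler_wpM2r ?pk_ge0 // lerB // ler_wpM2r // s1 (ln0 (lexx _)).
  apply: ln_le0; near: n.
  move: cs; rewrite s1 => /cvgrPdist_lt /(_ 1 ltr01).
  apply: filterS => n; rewrite sub0r normrN => /ltW; apply: le_trans.
  exact: ler_norm.
- by move=> n; apply: If.
- by move=> e e0; apply: nearW => n; rewrite Ef // lerDl ltW.
move=> I1 I2.
have I3 : mu.-integrable setT (fun t => (ln (sqd 1 (ang x t + b)) / 2 * pk x t)%:E).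
  have := integrableB measurableT (integrableZl measurableT (ln 2) (integrable_pk x0)) I1.
  congr (_.-integrable _ _); apply/funext => t.
  by rewrite /= -EFinB; congr EFin; rewrite /f; ring.
split => //.
have E : Rintegral mu setT (f 1) =
    ln 2 - Rintegral mu setT (fun t => ln (sqd 1 (ang x t + b)) / 2 * pk x t).
  transitivity (Rintegral mu setT
      (fun t => ln 2 * pk x t - ln (sqd 1 (ang x t + b)) / 2 * pk x t)).
    by apply: eq_Rintegral => t _; rewrite /f mulrBl.
  rewrite RintegralB //; last exact: (integrableZl measurableT (ln 2) (integrable_pk x0)).
  rewrite RintegralZl //; last exact: integrable_pk.
  by rewrite {1}/Rintegral integral_pk // mulr1.
move: I2; rewrite E; lra.
Unshelve. all: by end_near. Qed.

End UnitCircle.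

(** * Jensen's formula for a linear factor *)

Section Cabs.
Variable R : realType.
Implicit Types (z w : R[i]) (y : R).

Lemma cabsM z w : cabs (z * w) = cabs z * cabs w.
Proof. exact: Normc.normcM. Qed.

Lemma cabs_ge0 z : 0 <= cabs z.
Proof. by case: z => a b; rewrite /cabs /= sqrtr_ge0. Qed.

Lemma cabs_eq0 z : (cabs z == 0) = (z == 0).
Proof.
apply/eqP/eqP; first exact: Normc.eq0_normc.
by move=> ->; exact: Normc.normc0.
Qed.

Lemma cabs_gt0 z : (0 < cabs z) = (z != 0).
Proof. by rewrite lt0r cabs_eq0 cabs_ge0 andbT. Qed.

Lemma cabs0 : cabs (0 : R[i]) = 0.
Proof. exact: Normc.normc0. Qed.

Lemma cabs1 : cabs (1 : R[i]) = 1.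
Proof. exact: Normc.normc1. Qed.

Lemma cabsD z w : cabs (z + w) <= cabs z + cabs w.
Proof. exact: le_normcD. Qed.

Lemma cabsN z : cabs (- z) = cabs z.
Proof. exact: normcN. Qed.

Lemma cabsC z w : cabs (z - w) = cabs (w - z).
Proof. by rewrite -cabsN opprB. Qed.

Lemma cabsB z w : cabs z - cabs w <= cabs (z - w).
Proof. by rewrite lerBlDr -{1}(subrK w z) cabsD. Qed.

Lemma cabsV z : cabs z^-1 = (cabs z)^-1.
Proof. exact: Normc.normcV. Qed.

Lemma cabsf z w : cabs (z / w) = cabs z / cabs w.
Proof. by rewrite cabsM cabsV. Qed.

Lemma cabsX z n : cabs (z ^+ n) = cabs z ^+ n.
Proof. by elim: n => [|n IH]; rewrite ?expr0 ?cabs1 // !exprS cabsM IH. Qed.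

Lemma cabs_real y : cabs (y%:C) = `|y|.
Proof. by rewrite /cabs /= expr0n /= addr0 sqrtr_sqr. Qed.

Lemma sqr_cabs z : cabs z ^+ 2 = complex.Re z ^+ 2 + complex.Im z ^+ 2.
Proof. by case: z => a b; rewrite /cabs /= sqr_sqrtr // addr_ge0 ?sqr_ge0. Qed.

Lemma Re_le_cabs z : `|complex.Re z| <= cabs z.
Proof.
rewrite -(ler_pXn2r (n := 2)) ?nnegrE ?cabs_ge0 // sqr_cabs real_normK ?num_real //.
by rewrite lerDl sqr_ge0.
Qed.

Lemma Im_le_cabs z : `|complex.Im z| <= cabs z.
Proof.
rewrite -(ler_pXn2r (n := 2)) ?nnegrE ?cabs_ge0 // sqr_cabs real_normK ?num_real //.
by rewrite lerDr sqr_ge0.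
Qed.

Lemma cabs_le_ReIm z : cabs z <= `|complex.Re z| + `|complex.Im z|.
Proof.
have {1}-> : z = (complex.Re z)%:C + 'i * (complex.Im z)%:C.
  by case: z => a b; simpc.
apply: le_trans (cabsD _ _) _; rewrite cabsM !cabs_real.
by rewrite /cabs /= expr0n /= add0r expr1n sqrtr1 mul1r.
Qed.

Lemma cabs_conj z : cabs (conjc z) = cabs z.
Proof. by case: z => a b; rewrite /cabs /= sqrrN. Qed.

Lemma lt_cabs z w : (cabs z < cabs w) = (cabs z ^+ 2 < cabs w ^+ 2).
Proof. by rewrite ltr_pXn2r // nnegrE cabs_ge0. Qed.

Lemma ln_cabs z : ln (cabs z) = ln (cabs z ^+ 2) / 2.
Proof.
have [->|z0] := eqVneq z 0; first by rewrite cabs0 expr0n /= ln0 ?mul0r.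
by rewrite lnXn ?cabs_gt0 // mulr2n mulrDl -splitr.
Qed.

Lemma polar z : exists b, z = (cabs z * cos b) +i* (cabs z * sin b).
Proof.
have [->|z0] := eqVneq z 0; first by exists 0; rewrite cabs0 !mul0r.
have n0 : cabs z != 0 by rewrite cabs_eq0.
have E : (complex.Re z / cabs z) ^+ 2 + (complex.Im z / cabs z) ^+ 2 = 1.
  by rewrite !expr_div_n -mulrDl -sqr_cabs divff // expf_neq0.
have c1 : -1 <= complex.Re z / cabs z <= 1.
  rewrite -ler_norml normrM normfV (ger0_norm (cabs_ge0 z)).
  by rewrite ler_pdivrMr ?mul1r ?Re_le_cabs // cabs_gt0.
have sE : sin (acos (complex.Re z / cabs z)) = `|complex.Im z / cabs z|.
  by rewrite sin_acos // -sqrtr_sqr; congr Num.sqrt; rewrite -E; ring.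
have zE : z = (cabs z * (complex.Re z / cabs z)) +i* (cabs z * (complex.Im z / cabs z)).
  by rewrite ![cabs z * _]mulrC !divfK //; case: (z).
have [i0|i0] := leP 0 (complex.Im z / cabs z).
  exists (acos (complex.Re z / cabs z)).
  by rewrite acosK ?sE ?ger0_norm //; rewrite in_itv.
exists (- acos (complex.Re z / cabs z)).
by rewrite cosN sinN acosK ?sE ?ltr0_norm ?opprK //; rewrite in_itv.
Qed.

End Cabs.

Section LinearFactor.
Variable R : realType.
Notation mu := (@lebesgue_measure R).
Implicit Types (p q z : R[i]).

(* The Cayley transform (x - i t) / (x + i t) of the line. *)
Definition wc (x t : R) : R[i] := cos (ang x t) -i* sin (ang x t).

Lemma cabs_wc x t : cabs (wc x t) = 1.
Proof. by rewrite /cabs /= sqrrN cos2Dsin2 sqrtr1. Qed.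

Lemma wcE (x t : R) : 0 < x -> wc x t * (x +i* t) = x -i* t.
Proof.
move=> x0; have x1 : x != 0 by rewrite gt_eqF.
set a := atan (t / x).
have y0 : 0 < 1 + (t / x) ^+ 2 by rewrite ltr_wpDr ?sqr_ge0.
have c2 : cos a ^+ 2 = (1 + (t / x) ^+ 2)^-1.
  by rewrite cos_atan exprVn sqr_sqrtr // ltW.
have c0 : cos a != 0 by rewrite -sqrf_eq0 c2 invr_eq0 gt_eqF.
have sE : sin a = t / x * cos a.
  by rewrite -[in t / x](atanK (t / x)) /tan -/a divfK.
have C2 : cos (ang x t) = (1 + (t / x) ^+ 2)^-1 *+ 2 - 1.
  by rewrite /ang cos_mulr2n c2.
have S2 : sin (ang x t) = (t / x * (1 + (t / x) ^+ 2)^-1) *+ 2.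
  by rewrite /ang sin_mulr2n -/a sE mulrCA -expr2 c2.
have d0 : x ^+ 2 + t ^+ 2 != 0 by rewrite gt_eqF // pk_den_gt0.
rewrite /wc C2 S2; simpc; congr (_ +i* _); field; rewrite x1 d0 //.
Qed.

Lemma cabs_lin_wc x t z b :
  z = (cabs z * cos b) +i* (cabs z * sin b) ->
  cabs (1 - z * wc x t) ^+ 2 = sqd (cabs z) (ang x t - b).
Proof.
move=> zE; rewrite {1}zE sqr_cabs /sqd /= cosB; move: (ang x t) => a.
have h1 := cos2Dsin2 a; have h2 := cos2Dsin2 b.
have -> : cabs z ^+ 2 = cabs z ^+ 2 * (cos a ^+ 2 + sin a ^+ 2) * (cos b ^+ 2 + sin b ^+ 2).
  by rewrite h1 h2 !mulr1.
ring.
Qed.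

Lemma mean_lin_unit x z : 0 < x -> cabs z <= 1 ->
  [/\ mu.-integrable setT (fun t => (ln (cabs (1 - z * wc x t)) * pk x t)%:E),
   0 <= Rintegral mu setT (fun t => ln (cabs (1 - z * wc x t)) * pk x t) &
   cabs z < 1 ->
   Rintegral mu setT (fun t => ln (cabs (1 - z * wc x t)) * pk x t) = 0].
Proof.
move=> x0 z1; have [b zE] := polar z.
have E t : ln (cabs (1 - z * wc x t)) * pk x t =
    ln (sqd (cabs z) (ang x t + - b)) / 2 * pk x t.
  by rewrite ln_cabs (cabs_lin_wc _ _ zE).
under eq_fun do rewrite E.
under eq_Rintegral do rewrite E.
move: z1; rewrite le_eqVlt => /orP[/eqP z1|z1].
  have [I P] := ln_sqd1 (- b) x0; rewrite z1; split => //.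
  by rewrite ltxx.
have r01 : 0 <= cabs z < 1 by rewrite cabs_ge0.
by split; [exact: integrable_ln_sqd| |]; rewrite Rintegral_ln_sqd.
Qed.

Definition mlin x p q : R :=
  Rintegral mu setT (fun t => ln (cabs (p + q * wc x t)) * pk x t).

(** Multiplied by [x + i t], the equation becomes affine in [i t], so it has at most one solution.
    Hence the logarithm of a product is additive almost everywhere, although [ln 0 = 0] breaks
    additivity at zeros. *)
Lemma lin_wc_eq0 x p q : 0 < x -> (p != 0) || (q != 0) ->
  exists t0, forall t, p + q * wc x t = 0 -> t = t0.
Proof.
move=> x0 pq0.
have xt (t : R) : (x +i* t) != 0.
  by rewrite eq_complex /= negb_and gt_eqF.
have H t : p + q * wc x t = 0 -> (p + q) * x%:C = (q - p) * (0 +i* t).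
  move=> e; have : (p + q * wc x t) * (x +i* t) = 0 by rewrite e mul0r.
  rewrite mulrDl -mulrA wcE //.
  have -> : x +i* t = x%:C + (0 +i* t) by simpc.
  have -> : x -i* t = x%:C - (0 +i* t) by simpc.
  move=> h; apply/eqP; rewrite -subr_eq0 -h; apply/eqP; ring.
have [e|qp] := eqVneq q p.
  exists 0 => t /H; rewrite e subrr mul0r => /eqP; rewrite mulf_eq0.
  rewrite -mulr2n -mulr_natl mulf_eq0 pnatr_eq0 /=.
  have -> : (x%:C == 0 :> R[i]) = false by rewrite eq_complex /= gt_eqF.
  by rewrite orbF => /eqP p0; move: pq0; rewrite e p0 eqxx.
exists (complex.Im ((p + q) * x%:C / (q - p))) => t /H ->.
by rewrite [_ * (0 +i* t)]mulrC mulfK // subr_eq0.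
Qed.

Lemma lin_wc_ae x p q : 0 < x -> (p != 0) || (q != 0) ->
  {ae mu, forall t, p + q * wc x t != 0}.
Proof.
move=> x0 pq; have [t0 H] := lin_wc_eq0 x0 pq.
exists [set t0]; split => //; first exact: lebesgue_measure_set1.
by move=> t /= /negP; rewrite negbK => /eqP /H.
Qed.

(** Continuity by components, which keeps all topology and measurability arguments real-valued. *)
Definition ccont (f : R -> R[i]) :=
  continuous (fun t => complex.Re (f t)) /\ continuous (fun t => complex.Im (f t)).

Lemma ccont_cst z : ccont (fun=> z).
Proof. by split => t; exact: cvg_cst. Qed.

Lemma ccontD f g : ccont f -> ccont g -> ccont (fun t => f t + g t).
Proof.
move=> [f1 f2] [g1 g2]; split => t.
  rewrite (_ : (fun t => _) = (fun t => complex.Re (f t) + complex.Re (g t))).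
    by apply: cvgD; [exact: f1|exact: g1].
  by apply/funext => y; case: (f y) (g y) => [? ?] [? ?].
rewrite (_ : (fun t => _) = (fun t => complex.Im (f t) + complex.Im (g t))).
  by apply: cvgD; [exact: f2|exact: g2].
by apply/funext => y; case: (f y) (g y) => [? ?] [? ?].
Qed.

Lemma ccontM f g : ccont f -> ccont g -> ccont (fun t => f t * g t).
Proof.
move=> [f1 f2] [g1 g2]; split => t.
  rewrite (_ : (fun t => _) = (fun t => complex.Re (f t) * complex.Re (g t)
     - complex.Im (f t) * complex.Im (g t))).
    by apply: cvgB; apply: cvgM; [exact: f1|exact: g1|exact: f2|exact: g2].
  by apply/funext => y; case: (f y) (g y) => [? ?] [? ?].
rewrite (_ : (fun t => _) = (fun t => complex.Re (f t) * complex.Im (g t)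
   + complex.Im (f t) * complex.Re (g t))).
  by apply: cvgD; apply: cvgM; [exact: f1|exact: g2|exact: f2|exact: g1].
by apply/funext => y; case: (f y) (g y) => [? ?] [? ?].
Qed.

Lemma continuous_cabs2 f : ccont f -> continuous (fun t => cabs (f t) ^+ 2).
Proof.
move=> [f1 f2] t.
rewrite (_ : (fun t => _) = (fun t => complex.Re (f t) * complex.Re (f t)
     + complex.Im (f t) * complex.Im (f t))).
  by apply: cvgD; apply: cvgM; [exact: f1|exact: f1|exact: f2|exact: f2].
by apply/funext => y; rewrite sqr_cabs !expr2.
Qed.

Lemma ccontV f : (forall t, f t != 0) -> ccont f -> ccont (fun t => (f t)^-1).
Proof.
move=> f0 cf; have c2 := continuous_cabs2 cf; case: cf => f1 f2.
have n0 t : cabs (f t) ^+ 2 != 0 by rewrite expf_neq0 // cabs_eq0.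
split => t.
  rewrite (_ : (fun t => _) = (fun t => complex.Re (f t) * (cabs (f t) ^+ 2)^-1)).
    by apply: cvgM; [exact: f1|apply: cvgV => //; exact: c2].
  by apply/funext => y; rewrite sqr_cabs; case: (f y) => ? ?.
rewrite (_ : (fun t => _) = (fun t => - complex.Im (f t) * (cabs (f t) ^+ 2)^-1)).
  by apply: cvgM; [apply: cvgN; exact: f2|apply: cvgV => //; exact: c2].
by apply/funext => y; rewrite sqr_cabs; case: (f y) => ? ? /=; rewrite mulNr.
Qed.

Lemma measurable_ln_cabs f : ccont f -> measurable_fun setT (fun t => ln (cabs (f t))).
Proof.
move=> cf; under eq_fun do rewrite ln_cabs.
apply: measurable_funM => //; apply: (measurableT_comp (@measurable_ln R)).
by apply: continuous_measurable_fun; exact: continuous_cabs2.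
Qed.

Lemma measurable_ln_cabs_pk x f : 0 < x -> ccont f ->
  measurable_fun setT (fun t => ln (cabs (f t)) * pk x t).
Proof.
move=> x0 cf; apply: measurable_funM; first exact: measurable_ln_cabs.
by apply: continuous_measurable_fun; exact: continuous_pk.
Qed.

Lemma ccont_wc x : 0 < x -> ccont (wc x).
Proof.
move=> x0; split => t /=.
  apply: (@continuous_comp _ _ _ (ang x) cos); last exact: continuous_cos.
  exact: continuous_ang.
apply: cvgN; apply: (@continuous_comp _ _ _ (ang x) sin); last exact: continuous_sin.
exact: continuous_ang.
Qed.

Lemma ccont_lin_wc x p q : 0 < x -> ccont (fun t => p + q * wc x t).
Proof.
move=> x0; apply: ccontD; first exact: ccont_cst.
by apply: ccontM; [exact: ccont_cst|exact: ccont_wc].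
Qed.

Lemma ae_weak (P Q : R -> Prop) :
  {ae mu, forall t, P t} -> (forall t, P t -> Q t) -> {ae mu, forall t, Q t}.
Proof.
move=> [N [mN N0 sub]] H; exists N; split => // t /= nQ; apply: sub => /= hP.
exact/nQ/H.
Qed.

Lemma ae_Rintegral (f g : R -> R) : measurable_fun setT f ->
  mu.-integrable setT (EFin \o g) -> {ae mu, forall t, f t = g t} ->
  mu.-integrable setT (EFin \o f) /\ Rintegral mu setT f = Rintegral mu setT g.
Proof.
move=> mf ig fg; have mg : measurable_fun setT (EFin \o g) by case/integrableP : ig.
have mf' : measurable_fun setT (EFin \o f) by exact/measurable_EFinP.
split; last first.
  congr fine; apply: ae_eq_integral => //.
  by apply: ae_weak fg _ => t /= ->.
case/integrableP : ig => _ gy; apply/integrableP; split => //.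
rewrite (_ : (\int[mu]_x _)%E = (\int[mu]_x `|(EFin \o g) x|)%E) //.
apply: ae_eq_integral => //; try exact: measurableT_comp.
by apply: ae_weak fg _ => t /= ->.
Qed.

(** The point [x] of the half-plane goes to the centre 0 of the unit disc under the Cayley
    transform, so [ln (cabs p)] is the value at the source. After factoring out [p], the remaining
    root lies outside the disc, or on its boundary when the moduli agree. *)
Lemma mlin_le x p q : 0 < x -> p != 0 -> cabs q <= cabs p ->
  [/\ mu.-integrable setT (fun t => (ln (cabs (p + q * wc x t)) * pk x t)%:E),
   ln (cabs p) <= mlin x p q &
   cabs q < cabs p -> mlin x p q = ln (cabs p)].
Proof.
move=> x0 p1 qp; have p0 : 0 < cabs p by rewrite cabs_gt0.
have zE : cabs (- (q / p)) = cabs q / cabs p by rewrite cabsN cabsf.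
have z1 : cabs (- (q / p)) <= 1 by rewrite zE ler_pdivrMr // mul1r.
have [I J J0] := mean_lin_unit x0 z1.
have I1 : mu.-integrable setT (fun t => (ln (cabs p) * pk x t)%:E).
  exact: (integrableZl measurableT (ln (cabs p)) (integrable_pk x0)).
have [] := @ae_Rintegral (fun t => ln (cabs (p + q * wc x t)) * pk x t)
  (fun t => ln (cabs p) * pk x t + ln (cabs (1 - - (q / p) * wc x t)) * pk x t).
- by apply: measurable_ln_cabs_pk => //; exact: ccont_lin_wc.
- exact: (integrableD measurableT I1 I).
- have pq : (p != 0) || (q != 0) by rewrite p1.
  apply: ae_weak (lin_wc_ae x0 pq) _ => t t0.
  have E : p + q * wc x t = p * (1 - - (q / p) * wc x t).
    by field.
  rewrite E in t0 *.
  move: t0; rewrite mulf_eq0 negb_or => /andP[_ t1].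
  by rewrite cabsM lnM ?posrE ?cabs_gt0 // mulrDl.
move=> I2 E; split => //; rewrite /mlin E RintegralD // RintegralZl //;
  try exact: integrable_pk.
  by rewrite {1}/Rintegral integral_pk // mulr1 lerDl.
move=> qp1; rewrite J0 ?zE ?ltr_pdivrMr ?mul1r // addr0.
by rewrite /Rintegral integral_pk // mulr1.
Qed.

(* Since wc is unimodular, p + q wc and its reflection conj q + conj p wc have
   the same modulus. *)
Lemma cabs_lin_wc_swap x t p q :
  cabs (p + q * wc x t) = cabs (conjc q + conjc p * wc x t).
Proof.
rewrite -[RHS]cabs_conj; rewrite -[RHS]mulr1 -[in RHS](cabs_wc x t) -cabsM.
congr cabs; rewrite rmorphD rmorphM /= !conjcK mulrDl -mulrA.
have -> : conjc (wc x t) * wc x t = 1.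
  rewrite /wc; simpc; have := cos2Dsin2 (ang x t); rewrite !expr2 => ->.
  by rewrite [sin _ * cos _]mulrC addNr.
by rewrite mulr1 addrC.
Qed.

Lemma mlin_gt x p q : 0 < x -> cabs p < cabs q ->
  mu.-integrable setT (fun t => (ln (cabs (p + q * wc x t)) * pk x t)%:E) /\
  mlin x p q = ln (cabs q).
Proof.
move=> x0 pq.
have q0 : conjc q != 0 by rewrite -cabs_gt0 cabs_conj (le_lt_trans (cabs_ge0 p)).
have pq' : cabs (conjc p) < cabs (conjc q) by rewrite !cabs_conj.
have [I _ /(_ pq') E] := mlin_le x0 q0 (ltW pq').
rewrite /mlin; under eq_fun do rewrite cabs_lin_wc_swap.
under eq_Rintegral do rewrite cabs_lin_wc_swap.
by split => //; rewrite -[X in ln X]cabs_conj.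
Qed.

Lemma mlin_integrable x p q : 0 < x -> (p != 0) || (q != 0) ->
  mu.-integrable setT (fun t => (ln (cabs (p + q * wc x t)) * pk x t)%:E).
Proof.
move=> x0 pq; have [qp|qp] := leP (cabs q) (cabs p); last first.
  by case: (mlin_gt x0 qp).
have p0 : p != 0.
  apply: contraTN pq => /eqP p0; move: qp; rewrite p0 cabs0 eqxx /=.
  by rewrite le_eqVlt ltNge cabs_ge0 orbF cabs_eq0 negbK.
by case: (mlin_le x0 p0 qp).
Qed.

End LinearFactor.

(** * Polynomials on a circle tangent to the line *)

Section Circle.
Variable R : realType.
Notation mu := (@lebesgue_measure R).
Implicit Types (z : R[i]) (e b x t : R).

(* s |-> b + s / (1 + e s) maps the half-plane Re s > 0 onto the disc with
   diameter [b, b + 1/e]; psi is its restriction to the imaginary axis and src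
   its restriction to the positive reals. *)
Definition psi e b t : R[i] := b%:C + (0 +i* t) / (1 +i* (e * t)).
Definition src e b x : R := b + x / (1 + e * x).

(** With [w = wc x t] one has [i t = x (1 - w) / (1 + w)]. Substituted into [psi e b t - z], this
    gives the Moebius expression [(pz + qz w) / dz] of [psi_sub]; the source point corresponds to
    [w = 0]. *)
Definition pz e b x z : R[i] := (b%:C - z) * (1 + e * x)%:C + x%:C.
Definition qz e b x z : R[i] := (b%:C - z) * (1 - e * x)%:C - x%:C.
Definition dz e x t : R[i] := (1 + e * x)%:C + (1 - e * x)%:C * wc x t.

Lemma one_ie_neq0 e t : (1 +i* (e * t)) != 0 :> R[i].
Proof. by rewrite eq_complex /= oner_eq0. Qed.

Lemma xt_neq0 x t : 0 < x -> (x +i* t) != 0 :> R[i].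
Proof. by move=> x0; rewrite eq_complex /= gt_eqF. Qed.

Lemma dzE e x t : 0 < x -> dz e x t * (x +i* t) = (2 * x)%:C * (1 +i* (e * t)).
Proof.
by move=> x0; rewrite /dz mulrDl -mulrA wcE //; simpc; congr (_ +i* _); ring.
Qed.

Lemma dz_neq0 e x t : 0 < x -> dz e x t != 0.
Proof.
move=> x0; apply: contra_neq (_ : (2 * x)%:C * (1 +i* (e * t)) != 0 :> R[i]).
  by move=> d0; rewrite -dzE // d0 mul0r.
rewrite mulf_neq0 ?one_ie_neq0 // eq_complex /= negb_and.
by rewrite mulf_neq0 // gt_eqF.
Qed.

Lemma psi_sub e b x t z : 0 < x ->
  psi e b t - z = (pz e b x z + qz e b x z * wc x t) / dz e x t.
Proof.
move=> x0; have d0 := dz_neq0 e t x0; have x1 := xt_neq0 t x0.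
have e1 := one_ie_neq0 e t.
apply: (mulIf d0); rewrite divfK //; apply: (mulIf x1).
rewrite -mulrA dzE // [RHS]mulrDl -(mulrA (qz e b x z)) wcE //.
have -> : (psi e b t - z) * ((2 * x)%:C * (1 +i* (e * t))) =
    (b%:C - z) * ((2 * x)%:C * (1 +i* (e * t))) + (2 * x)%:C * (0 +i* t).
  by rewrite /psi; field.
have -> : x +i* t = x%:C + (0 +i* t) by simpc.
have -> : x -i* t = x%:C - (0 +i* t) by simpc.
have -> : 1 +i* (e * t) = 1 + e%:C * (0 +i* t) by simpc.
rewrite /pz /qz; ring.
Qed.

Lemma src_sub e b x z : 0 < 1 + e * x ->
  (src e b x)%:C - z = pz e b x z / (1 + e * x)%:C.
Proof.
move=> ex0; have d0 : (1 + e * x)%:C != 0 :> R[i] by rewrite eq_complex /= gt_eqF.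
have E : (x / (1 + e * x))%:C * (1 + e * x)%:C = x%:C :> R[i].
  by rewrite -rmorphM /= divfK // gt_eqF.
by apply: (mulIf d0); rewrite divfK // /src rmorphD /= mulrBl mulrDl E /pz; ring.
Qed.

(* Positive exactly inside the disc with diameter [b, b + 1/e]. *)
Definition depth e b z : R := complex.Re z - b - e * cabs (z - b%:C) ^+ 2.

(** The sign of [depth] thus decides whether [mlin_le] or [mlin_gt] computes the mean of a root, and
    its size measures the excess for an interior root. *)
Lemma qz_pz e b x z :
  cabs (qz e b x z) ^+ 2 - cabs (pz e b x z) ^+ 2 = 4 * x * depth e b z.
Proof. by rewrite /depth !sqr_cabs; case: z => u v; rewrite /qz /pz; simpc => /=; ring. Qed.

Lemma psi_depth e b t : depth e b (psi e b t) = 0.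
Proof.
have d0 : 1 + (e * t) ^+ 2 != 0 by rewrite gt_eqF // ltr_wpDr ?sqr_ge0.
have E : (0 +i* t) / (1 +i* (e * t)) =
    (t * (e * t) / (1 + (e * t) ^+ 2)) +i* (t / (1 + (e * t) ^+ 2)) :> R[i].
  apply: (mulIf (one_ie_neq0 e t)); rewrite divfK ?one_ie_neq0 //; simpc.
  by congr (_ +i* _); field.
rewrite /depth sqr_cabs /psi E [b%:C + _]addrC addrK /=.
by field.
Qed.

Lemma src_depth e b x : 0 < x -> 0 < 1 + e * x -> 0 < depth e b (src e b x)%:C.
Proof.
move=> x0 ex0; rewrite /depth /src sqr_cabs; simpc => /=.
have d0 : 1 + e * x != 0 by rewrite gt_eqF.
rewrite (_ : _ - _ = x / (1 + e * x) ^+ 2) ?divr_gt0 ?exprn_gt0 //.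
by field.
Qed.

Lemma pq_neq0 e b x z : 0 < x -> (pz e b x z != 0) || (qz e b x z != 0).
Proof.
move=> x0; rewrite -negb_and; apply/negP => /andP[/eqP p0 /eqP q0].
have : pz e b x z + qz e b x z = 2 * (b%:C - z).
  by rewrite /pz /qz rmorphD rmorphB /= !rmorph1; ring.
rewrite p0 q0 addr0 => /esym /eqP; rewrite mulf_eq0 pnatr_eq0 /= => /eqP bz.
by move: p0; rewrite /pz bz mul0r add0r => /eqP; rewrite eq_complex /= gt_eqF.
Qed.

Lemma ccont_psi e b x z : 0 < x -> ccont (fun t => psi e b t - z).
Proof.
move=> x0; rewrite (funext (fun t => psi_sub e b t z x0)); apply: ccontM.
  exact: ccont_lin_wc.
by apply: ccontV; [move=> t; exact: dz_neq0|exact: ccont_lin_wc].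
Qed.

Definition mroot e b x z : R :=
  Rintegral mu setT (fun t => ln (cabs (psi e b t - z)) * pk x t).

Lemma psi_ae e b x z : 0 < x -> {ae mu, forall t, psi e b t - z != 0}.
Proof.
move=> x0; apply: ae_weak (lin_wc_ae x0 (pq_neq0 e b z x0)) _ => t h.
by rewrite (psi_sub _ _ _ _ x0) mulf_neq0 // invr_eq0 dz_neq0.
Qed.

Lemma mrootE e b x z : 0 < x -> 0 < e ->
  mu.-integrable setT (fun t => (ln (cabs (psi e b t - z)) * pk x t)%:E) /\
  mroot e b x z = mlin x (pz e b x z) (qz e b x z) - ln (1 + e * x).
Proof.
move=> x0 e0; have ex0 : 0 < e * x by rewrite mulr_gt0.
have d1 : cabs (1 - e * x)%:C < cabs (1 + e * x)%:C :> R.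
  have h : 0 <= 1 + e * x by lra.
  by rewrite !cabs_real (ger0_norm h) ltr_norml; apply/andP; split; lra.
have d2 : (1 + e * x)%:C != 0 :> R[i] by rewrite -cabs_gt0 (le_lt_trans (cabs_ge0 _) d1).
have [I2 _ /(_ d1) E2] := mlin_le x0 d2 (ltW d1).
have I1 := mlin_integrable x0 (pq_neq0 e b z x0).
have [] := @ae_Rintegral R (fun t => ln (cabs (psi e b t - z)) * pk x t)
  (fun t => ln (cabs (pz e b x z + qz e b x z * wc x t)) * pk x t - ln (cabs (dz e x t)) * pk x t).
- by apply: measurable_ln_cabs_pk => //; exact: ccont_psi x0.
- exact: (integrableB measurableT I1 I2).
- apply: ae_weak (lin_wc_ae x0 (pq_neq0 e b z x0)) _ => t h.
  rewrite (psi_sub _ _ _ _ x0) cabsf ln_div ?posrE ?cabs_gt0 ?dz_neq0 //.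
  by rewrite mulrBl.
move=> I E; split => //; rewrite /mroot E RintegralB // /mlin.
rewrite -[X in _ - X]/(mlin x (1 + e * x)%:C (1 - e * x)%:C) E2 cabs_real ger0_norm //; lra.
Qed.

(** The excess [ln (|qz| / |pz|)] is the Green function of the disc between the source and the root:
    the root sits at [w = - pz / qz], the source at [w = 0]. *)
Lemma mroot_ge e b x z : 0 < x -> 0 < e -> (src e b x)%:C != z ->
  [/\ ln (cabs ((src e b x)%:C - z)) <= mroot e b x z,
   depth e b z < 0 -> mroot e b x z = ln (cabs ((src e b x)%:C - z)) &
   0 < depth e b z -> mroot e b x z = ln (cabs ((src e b x)%:C - z)) +
    ln (cabs (qz e b x z) / cabs (pz e b x z))].
Proof.
move=> x0 e0 sz; have ex0 : 0 < 1 + e * x by rewrite ltr_wpDr // mulr_ge0 // ltW.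
have p0 : pz e b x z != 0.
  by move: sz; rewrite -subr_eq0 src_sub // mulf_eq0 negb_or => /andP[].
have [_ ->] := mrootE b z x0 e0.
have -> : ln (cabs ((src e b x)%:C - z)) = ln (cabs (pz e b x z)) - ln (1 + e * x).
  rewrite src_sub // cabsf cabs_real ger0_norm ?ltW // ln_div ?posrE ?cabs_gt0 //.
have D := qz_pz e b x z; have p1 : 0 < cabs (pz e b x z) by rewrite cabs_gt0.
split.
- rewrite lerB //; have [qp|qp] := leP (cabs (qz e b x z)) (cabs (pz e b x z)).
    by case: (mlin_le x0 p0 qp).
  have [_ ->] := mlin_gt x0 qp.
  by rewrite ler_ln ?posrE ?(ltW qp) // (lt_trans p1).
- move=> dz0; have qp : cabs (qz e b x z) < cabs (pz e b x z).
    by rewrite lt_cabs -subr_lt0 D pmulr_rlt0 // mulr_gt0.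
  by have [_ _ /(_ qp) ->] := mlin_le x0 p0 (ltW qp).
- move=> dz0; have qp : cabs (pz e b x z) < cabs (qz e b x z).
    by rewrite lt_cabs -subr_gt0 D mulr_gt0 // mulr_gt0.
  have [_ ->] := mlin_gt x0 qp.
  have q1 : 0 < cabs (qz e b x z) := lt_trans p1 qp.
  by rewrite ln_div ?posrE //; ring.
Qed.

Definition mpoly e b x (P : {poly R[i]}) : R :=
  Rintegral mu setT (fun t => ln (cabs P.[psi e b t]) * pk x t).

Lemma ccont_prod e b x (rs : seq R[i]) c : 0 < x ->
  ccont (fun t => c * \prod_(z <- rs) (psi e b t - z)).
Proof.
move=> x0; apply: ccontM; first exact: ccont_cst.
elim: rs => [|z rs IH].
  by under eq_fun do rewrite big_nil; exact: ccont_cst.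
under eq_fun do rewrite big_cons.
by apply: ccontM => //; exact: ccont_psi x0.
Qed.

Lemma mean_prod e b x c (rs : seq R[i]) : 0 < x -> 0 < e -> c != 0 ->
  [/\ {ae mu, forall t, c * \prod_(z <- rs) (psi e b t - z) != 0},
   mu.-integrable setT (fun t => (ln (cabs (c * \prod_(z <- rs) (psi e b t - z))) * pk x t)%:E) &
   Rintegral mu setT (fun t => ln (cabs (c * \prod_(z <- rs) (psi e b t - z))) * pk x t)
     = ln (cabs c) + \sum_(z <- rs) mroot e b x z].
Proof.
move=> x0 e0 c0; elim: rs => [|z rs [A I E]].
  split.
  - by apply: aeW => t; rewrite big_nil mulr1.
  - under eq_fun do rewrite big_nil mulr1.
    exact: (integrableZl measurableT (ln (cabs c)) (integrable_pk x0)).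
  - under eq_Rintegral do rewrite big_nil mulr1.
    rewrite RintegralZl //; last exact: integrable_pk.
    by rewrite /Rintegral integral_pk // mulr1 big_nil addr0.
have [Iz Ez] := mrootE b z x0 e0.
have A2 : {ae mu, forall t, psi e b t - z != 0 /\ c * \prod_(z <- rs) (psi e b t - z) != 0}.
  move: A (psi_ae e b z x0) => [N1 [mN1 N10 s1]] [N2 [mN2 N20 s2]].
  exists (N1 `|` N2); split.
  - exact: measurableU.
  - by apply: null_set_setU.
  - move=> t /= h; apply: contrapT => /not_orP[h1 h2]; apply: h; split.
    + by apply: contrapT => h; exact/h2/s2.
    + by apply: contrapT => h; exact/h1/s1.
have F t : c * \prod_(y <- z :: rs) (psi e b t - y) =
    (psi e b t - z) * (c * \prod_(y <- rs) (psi e b t - y)).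
  by rewrite big_cons mulrCA.
have A3 : {ae mu, forall t, c * \prod_(y <- z :: rs) (psi e b t - y) != 0}.
  by apply: ae_weak A2 _ => t [h1 h2]; rewrite F mulf_neq0.
have [] := @ae_Rintegral R (fun t => ln (cabs (c * \prod_(y <- z :: rs) (psi e b t - y))) * pk x t)
  (fun t => ln (cabs (psi e b t - z)) * pk x t + ln (cabs (c * \prod_(y <- rs) (psi e b t - y))) * pk x t).
- by apply: measurable_ln_cabs_pk => //; exact: ccont_prod x0.
- exact: (integrableD measurableT Iz I).
- apply: ae_weak A2 _ => t [h1 h2]; rewrite F cabsM lnM ?posrE ?cabs_gt0 //.
  by rewrite mulrDl.
move=> I2 E2; split => //; rewrite E2 RintegralD // E big_cons.
by rewrite -/(mroot e b x z) addrCA.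
Qed.

Lemma mean_poly e b x (P : {poly R[i]}) : 0 < x -> 0 < e -> P.[(src e b x)%:C] != 0 ->
  mu.-integrable setT (fun t => (ln (cabs P.[psi e b t]) * pk x t)%:E) /\
  exists2 rs : seq R[i], (forall z, (z \in rs) = root P z) &
   mpoly e b x P = ln (cabs P.[(src e b x)%:C]) +
    \sum_(z <- rs) (mroot e b x z - ln (cabs ((src e b x)%:C - z))).
Proof.
move=> x0 e0 Ps; have [rs Prs] := closed_field_poly_normal P.
have P0 : P != 0 by apply: contraNneq Ps => ->; rewrite horner0.
have c0 : lead_coef P != 0 by rewrite lead_coef_eq0.
have H s : P.[s] = lead_coef P * \prod_(z <- rs) (s - z).
  rewrite {1}Prs hornerZ horner_prod; congr (_ * _).
  by apply: eq_bigr => z _; rewrite hornerXsubC.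
have [_ I E] := mean_prod b rs x0 e0 c0.
split; first by under eq_fun do rewrite H.
exists rs.
  by move=> z; rewrite Prs rootZ // root_prod_XsubC.
rewrite /mpoly; under eq_Rintegral do rewrite H.
rewrite E sumrB addrCA addrC [in RHS]addrC.
have S : \prod_(z <- rs) ((src e b x)%:C - z) != 0.
  by move: Ps; rewrite H mulf_eq0 negb_or => /andP[].
rewrite H cabsM lnM ?posrE ?cabs_gt0 //.
suff -> : ln (cabs (\prod_(z <- rs) ((src e b x)%:C - z))) =
    \sum_(z <- rs) ln (cabs ((src e b x)%:C - z)) by ring.
elim: rs S {Prs H E I} => [|z rs IH]; first by rewrite !big_nil cabs1 ln1.
rewrite !big_cons mulf_eq0 negb_or => /andP[h1 h2].
by rewrite cabsM lnM ?posrE ?cabs_gt0 // IH.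
Qed.

Lemma mpoly_ge e b x (P : {poly R[i]}) : 0 < x -> 0 < e -> P.[(src e b x)%:C] != 0 ->
  ln (cabs P.[(src e b x)%:C]) <= mpoly e b x P.
Proof.
move=> x0 e0 Ps; have [_ [rs rsP ->]] := mean_poly x0 e0 Ps.
rewrite lerDl big_seq; apply: sumr_ge0 => z; rewrite rsP => rz; rewrite subr_ge0.
have sz : (src e b x)%:C != z by apply: contraNneq Ps => ->.
by case: (mroot_ge x0 e0 sz).
Qed.

Lemma mpoly_gain e b x (P : {poly R[i]}) z0 : 0 < x -> 0 < e ->
  P.[(src e b x)%:C] != 0 -> root P z0 -> 0 < depth e b z0 ->
  ln (cabs P.[(src e b x)%:C]) + ln (cabs (qz e b x z0) / cabs (pz e b x z0))
    <= mpoly e b x P.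
Proof.
move=> x0 e0 Ps Pz0 dz0; have [_ [rs rsP ->]] := mean_poly x0 e0 Ps.
have z0rs : z0 \in rs by rewrite rsP.
have sz z : root P z -> (src e b x)%:C != z by move=> rz; apply: contraNneq Ps => ->.
rewrite lerD2l (perm_big _ (perm_to_rem z0rs)) big_cons /= ler_wpDr //.
  rewrite big_seq; apply: sumr_ge0 => z /mem_rem; rewrite rsP => rz.
  by rewrite subr_ge0; case: (mroot_ge x0 e0 (sz _ rz)).
have [_ _ /(_ dz0) ->] := mroot_ge x0 e0 (sz _ Pz0).
by rewrite addrC addKr.
Qed.

(** Roots on the circle are excluded as well, because for [depth = 0] only the inequality of
    [mroot_ge] is available. *)
Lemma mpoly_eq e b x (P : {poly R[i]}) : 0 < x -> 0 < e ->
  (forall z, 0 <= depth e b z -> P.[z] != 0) ->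
  mpoly e b x P = ln (cabs P.[(src e b x)%:C]).
Proof.
move=> x0 e0 Pz; have ex0 : 0 < 1 + e * x by rewrite ltr_wpDr // mulr_ge0 // ltW.
have Ps : P.[(src e b x)%:C] != 0 by apply: Pz; rewrite ltW // src_depth.
have [_ [rs rsP ->]] := mean_poly x0 e0 Ps.
rewrite big_seq big1 ?addr0 // => z; rewrite rsP => rz.
have sz : (src e b x)%:C != z by apply: contraNneq Ps => ->.
have [_ H _] := mroot_ge x0 e0 sz; rewrite H ?subrr //.
by rewrite ltNge; apply: contraL rz; exact: Pz.
Qed.

End Circle.

(** * Taylor expansion of the zeta function *)

Section ComplexExp.
Variable R : realType.
Implicit Types (z w : R[i]).

Definition cexp z : R[i] :=
  (expR (complex.Re z) * cos (complex.Im z)) +i* (expR (complex.Re z) * sin (complex.Im z)).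

Lemma cexpD z w : cexp (z + w) = cexp z * cexp w.
Proof.
case: z => a b; case: w => c d; rewrite /cexp; simpc => /=.
by rewrite expRD cosD sinD; congr (_ +i* _); ring.
Qed.

Lemma cabs_cexp z : cabs (cexp z) = expR (complex.Re z).
Proof.
apply/eqP; rewrite -(eqrXn2 (n := 2)) ?cabs_ge0 ?expR_ge0 // sqr_cabs /cexp /=.
by rewrite !exprMn -mulrDr cos2Dsin2 mulr1.
Qed.

(* Re (w (cexp (y z) - sum_(k < n) (y z)^k / k!)) *)
Definition exp_rem (z : R[i]) (n : nat) (w : R[i]) (y : R) : R :=
  expR (y * complex.Re z) * (complex.Re w * cos (y * complex.Im z) - complex.Im w * sin (y * complex.Im z))
  - \sum_(k < n) y ^+ k * (complex.Re (w * z ^+ k) / k`!%:R).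

Lemma is_derive_lin (a y : R) : is_derive y (1:R) (fun t : R => t * a) a.
Proof.
have -> : (fun t : R => t * a) = a \*: id by apply/funext => t; rewrite mulrC.
by have := is_deriveZ a (is_derive_id y (1 : R)); rewrite /GRing.scale /= mulr1.
Qed.

Lemma is_derive_rem0 z w (y : R) : is_derive y (1:R) (exp_rem z 0 w) (exp_rem z 0 (w * z) y).
Proof.
case: z => a b; case: w => c d.
have E (p q : R) : (fun t => expR (t * a) * (p * cos (t * b) - q * sin (t * b))) =
    (expR \o (fun t => t * a)) * (p \*: (cos \o (fun t => t * b)) - q \*: (sin \o (fun t => t * b))).
  by apply/funext => t.
have -> : exp_rem (a +i* b) 0 (c +i* d) = fun t => expR (t * a) * (c * cos (t * b) - d * sin (t * b)).
  by apply/funext => t; rewrite /exp_rem big_ord0 subr0.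
rewrite E.
have h1 := is_derive1_comp (g := fun t => t * a) (is_derive_expR (y * a)) (is_derive_lin a y).
have h2 := is_derive1_comp (g := fun t => t * b) (is_derive_cos (y * b)) (is_derive_lin b y).
have h3 := is_derive1_comp (g := fun t => t * b) (is_derive_sin (y * b)) (is_derive_lin b y).
have := is_deriveM h1 (is_deriveB (is_deriveZ c h2) (is_deriveZ d h3)).
move=> H; apply: (is_derive_eq H).
rewrite /exp_rem big_ord0 subr0 !fctE /GRing.scale /=.
rewrite -[c *: cos _]/(c * cos _) -[d *: sin _]/(d * sin _); ring.
Qed.

(** Differentiation shortens the Taylor sum by one term and moves a factor [z] into the weight [w].
    The weight is a parameter of [exp_rem] for the sake of this recursion. *)
Lemma is_derive_remS z n w (y : R) : is_derive y (1:R) (exp_rem z n.+1 w) (exp_rem z n (w * z) y).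
Proof.
elim: n => [|n IH].
  have -> : exp_rem z 1 w = exp_rem z 0 w - cst (complex.Re w).
    apply/funext => t; rewrite !fctE /exp_rem big_ord1 big_ord0 subr0 expr0 mul1r.
    by rewrite expr0 mulr1 fact0 divr1.
  have := is_deriveB (is_derive_rem0 z w y) (is_derive_cst (complex.Re w) y 1).
  by rewrite subr0.
have -> : exp_rem z n.+2 w = exp_rem z n.+1 w - (complex.Re (w * z ^+ n.+1) / n.+1`!%:R) \*: (fun t : R => t ^+ n.+1).
  apply/funext => t; rewrite /exp_rem [in LHS]big_ord_recr /= !fctE.
  by rewrite opprD addrA [t ^+ n.+1 * _]mulrC.
have := is_deriveB IH (is_deriveZ (complex.Re (w * z ^+ n.+1) / n.+1`!%:R) (is_derive_exp y n.+1)).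
move=> H; apply: (is_derive_eq H).
rewrite /exp_rem [in RHS]big_ord_recr /= opprD addrA; congr (_ - _).
rewrite /GRing.scale /= factS natrM exprS mulrA.
have f0 : n`!%:R != 0 :> R by rewrite pnatr_eq0 -lt0n fact_gt0.
have n0 : n.+1%:R != 0 :> R by rewrite pnatr_eq0.
by move: (complex.Re _) (n.+1%:R : R) n0 => u v v0; field; rewrite f0 v0.
Qed.

Lemma rem_at0 z n w : exp_rem z n.+1 w 0 = 0.
Proof.
rewrite /exp_rem big_ord_recl !mul0r expR0 mul1r cos0 sin0 mulr0 subr0 mulr1.
rewrite expr0 expr0 mulr1 mul1r fact0 divr1 big1 ?addr0 ?subrr //.
by move=> k _; rewrite expr0n /= mul0r.
Qed.

(** Comparison with the real exponential by induction on [n]: the difference of the two sides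
    vanishes at [y = 0], and its derivative is an instance of the induction hypothesis, hence
    nonnegative. *)
Lemma rem_le z n w y : 0 <= y -> exp_rem z n w y <= exp_rem (cabs z)%:C n (cabs w)%:C y.
Proof.
elim: n w y => [|n IH] w y y0.
  rewrite /exp_rem !big_ord0 !subr0 /= !mulr0 mul0r subr0 cos0 mulr1.
  apply: (@le_trans _ _ (expR (y * complex.Re z) * cabs w)).
    rewrite ler_wpM2l ?expR_ge0 //.
    apply: le_trans (ler_norm _) _.
    have -> : complex.Re w * cos (y * complex.Im z) - complex.Im w * sin (y * complex.Im z)
      = complex.Re (w * (cos (y * complex.Im z) +i* sin (y * complex.Im z))).
      by case: (w) => ? ? /=.
    apply: le_trans (Re_le_cabs _) _; rewrite cabsM [X in _ * X]/cabs /=.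
    by rewrite cos2Dsin2 sqrtr1 mulr1.
  rewrite ler_wpM2r ?cabs_ge0 // ler_expR ler_wpM2l //.
  exact: le_trans (ler_norm _) (Re_le_cabs z).
rewrite -subr_ge0.
pose g t := exp_rem (cabs z)%:C n.+1 (cabs w)%:C t - exp_rem z n.+1 w t.
have : g 0 <= g y; last by rewrite /g !rem_at0 subrr.
apply: (@derive_ge0_incr _ g (fun t => exp_rem (cabs z)%:C n ((cabs w)%:C * (cabs z)%:C) t - exp_rem z n (w * z) t) y y0).
  move=> t _; exact: (is_deriveB (is_derive_remS _ _ _ _) (is_derive_remS _ _ _ _)).
move=> t /andP[t0 _]; rewrite subr_ge0 -rmorphM -cabsM.
exact: IH t0.
Qed.

(** For [k >= n], [y^k <= th^k Y^k <= th^n Y^k]. The larger argument [Y] pays for the geometric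
    factor [th^n], which survives integration in [tail_taylor]. *)
Lemma expR_tail_le (y Y th : R) n : 0 <= y -> 0 <= Y -> 0 <= th <= 1 -> y <= th * Y ->
  expR y - \sum_(k < n) y ^+ k / k`!%:R <= th ^+ n * expR Y.
Proof.
move=> y0 Y0 /andP[t0 t1] yY.
have H N : (n <= N)%N -> series (exp_coeff y) N <= \sum_(k < n) y ^+ k / k`!%:R + th ^+ n * expR Y.
  move=> nN; rewrite /series /= (@big_cat_nat _ _ _ n) //= big_mkord lerD2l.
  apply: (@le_trans _ _ (\sum_(n <= k < N) th ^+ n * exp_coeff Y k)).
    rewrite big_nat_cond [leRHS]big_nat_cond; apply: ler_sum => k /andP[/andP[nk _] _].
    rewrite /exp_coeff /= mulrA ler_wpM2r ?invr_ge0 //.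
    apply: (@le_trans _ _ ((th * Y) ^+ k)); first by rewrite lerXn2r ?nnegrE ?mulr_ge0.
    rewrite exprMn ler_wpM2r ?exprn_ge0 //.
    by rewrite -(subnK nk) exprD ler_piMl ?exprn_ge0 // exprn_ile1.
  rewrite -mulr_sumr ler_wpM2l ?exprn_ge0 //.
  apply: (@le_trans _ _ (series (exp_coeff Y) N)).
    rewrite /series /= [leRHS](@big_cat_nat _ _ _ n) //= lerDr.
    by apply: sumr_ge0 => k _; exact: exp_coeff_ge0.
  apply: nondecreasing_cvgn_le; last exact: is_cvg_series_exp_coeff.
  apply/nondecreasing_seqP => k; rewrite /series /= big_nat_recr //= lerDl.
  exact: exp_coeff_ge0.
rewrite lerBlDl; apply: limr_le; first exact: is_cvg_series_exp_coeff.
by exists n => // N /= nN; exact: H.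
Qed.

Lemma rem1 z n w :
  exp_rem z n w 1 = complex.Re (w * (cexp z - \sum_(k < n) ((k`!%:R)^-1)%:C * z ^+ k)).
Proof.
have ReZ (u v : R[i]) : complex.Re (u + v) = complex.Re u + complex.Re v.
  by case: u v => [? ?] [? ?].
rewrite /exp_rem !mul1r [in RHS]mulrBr ReZ; congr (_ + _).
  by case: w => c d; rewrite /cexp; simpc => /=; ring.
have ReN (u : R[i]) : complex.Re (- u) = - complex.Re u by case: u.
rewrite ReN; congr (- _).
elim: n => [|n IH]; first by rewrite !big_ord0 mulr0.
rewrite !big_ord_recr /= mulrDr ReZ IH; congr (_ + _).
rewrite expr1n mul1r mulrCA.
by case: (w * z ^+ n) => u v; simpc => /=; rewrite mulrC.
Qed.

Lemma cexp_taylor z (Y th : R) n w : 0 <= Y -> 0 <= th <= 1 -> cabs z <= th * Y ->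
  `|complex.Re (w * (cexp z - \sum_(k < n) ((k`!%:R)^-1)%:C * z ^+ k))|
    <= cabs w * (th ^+ n * expR Y).
Proof.
move=> Y0 th01 zY.
have H (v : R[i]) : complex.Re (v * (cexp z - \sum_(k < n) ((k`!%:R)^-1)%:C * z ^+ k))
    <= cabs v * (th ^+ n * expR Y).
  rewrite -rem1; apply: le_trans (rem_le _ _ _ ler01) _.
  apply: le_trans (ler_wpM2l (cabs_ge0 v) (expR_tail_le n (cabs_ge0 z) Y0 th01 zY)).
  rewrite /exp_rem !mul1r /= cos0 sin0 mulr0 subr0 mulr1 mulrC mulrBr lerD2l lerN2.
  rewrite mulr_sumr; apply: ler_sum => k _; rewrite expr1n mul1r -rmorphXn -rmorphM /=.
  by rewrite mulrA.
rewrite ler_norml lerNl H andbT.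
have := H (- w); rewrite cabsN mulNr; apply: le_trans.
by case: (w * _).
Qed.

End ComplexExp.

Section CexpAbs.
Variable R : realType.

Lemma cexp_taylor_abs (z : R[i]) (Y th : R) n : 0 <= Y -> 0 <= th <= 1 -> cabs z <= th * Y ->
  cabs (cexp z - \sum_(k < n) ((k`!%:R)^-1)%:C * z ^+ k) <= th ^+ n * expR Y.
Proof.
move=> Y0 th01 zY; set v := _ - _.
have [->|v0] := eqVneq v 0.
  by rewrite cabs0 mulr_ge0 ?expR_ge0 // exprn_ge0 //; case/andP: th01.
(* With the conjugate of the remainder as weight, the real part is the squared modulus, and one
   factor [cabs v] cancels. *)
have := cexp_taylor n (conjc v) Y0 th01 zY; rewrite -/v cabs_conj.
have -> : complex.Re (conjc v * v) = cabs v ^+ 2.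
  by rewrite sqr_cabs; case: v {v0} => a b; simpc => /=; ring.
by rewrite ger0_norm ?sqr_ge0 // expr2 ler_pM2l // cabs_gt0.
Qed.

Lemma pow_fact_le (y : R) k : 0 <= y -> y ^+ k / k`!%:R <= expR y.
Proof.
move=> y0; case: k => [|k].
  by rewrite expr0 fact0 divr1 -expR0 ler_expR.
by apply: le_trans (expR_ge1Dxn k y0); rewrite lerDr.
Qed.

End CexpAbs.

(** * The tail integral of zeta and its power series *)

Section Tail.
Variable R : realType.
Notation mu := (@lebesgue_measure R).
Implicit Types (z s : R[i]).
Notation D := (`[1%R, +oo[%classic : set R).

Lemma integrableZD (c : R) (f : R -> R) : mu.-integrable D (EFin \o f) ->
  mu.-integrable D (EFin \o (fun x => c * f x)).
Proof.
move=> fi; have mD : measurable (D : set (measurableTypeR R)) by exact: measurable_itv.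
exact: (integrableZl mD c fi).
Qed.

Lemma cvg_powRN (c : R) : 0 < c -> powR x (- c) @[x --> +oo] --> (0 : R).
Proof.
move=> c0; apply/cvgr0Pnorm_lt => e e0.
near=> x.
have x0 : 0 < x by near: x; exact: nbhs_pinfty_gt.
rewrite ger0_norm ?powR_ge0 // /powR gt_eqF //.
rewrite -[ltRHS](@lnK _ e) ?posrE // ltr_expR mulNr ltrNl -ltr_pdivrMl //.
rewrite -[ltLHS]expRK ltr_ln ?posrE ?expR_gt0 //.
Unshelve. all: by end_near. Qed.

Lemma integral_powR (c : R) : 0 < c ->
  (\int[mu]_(x in D) (powR x (- c - 1))%:E = (c^-1)%:E)%E.
Proof.
move=> c0.
have dF (x : R) : 1 <= x -> is_derive x 1 (fun x : R => - c^-1 * powR x (- c)) (powR x (- c - 1)).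
  move=> x1; have x0 : 0 < x := lt_le_trans ltr01 x1.
  have := is_deriveZ (- c^-1) (is_derive1_powR (- c) x0).
  move=> H; apply: (is_derive_eq H); rewrite /GRing.scale /=.
  by rewrite mulrA mulrNN mulVf ?gt_eqF // mul1r.
have cF (x : R) : 1 <= x -> {for x, continuous (fun x : R => - c^-1 * powR x (- c))}.
  by move=> x1; apply/differentiable_continuous/derivable1_diffP; case: (dF _ x1).
rewrite (@ge0_continuous_FTC2y _ _ (fun x => - c^-1 * powR x (- c)) 1 0).
- by rewrite sub0e powR1 mulr1 EFinN oppeK.
- by move=> x _; exact: powR_ge0.
- apply: derivable_within_continuous => x; rewrite in_itv /= andbT => x1.
  have x0 : 0 < x := lt_le_trans ltr01 x1.
  by case: (is_derive1_powR (- c - 1) x0).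
- rewrite -[X in _ --> X](mulr0 (- c^-1)); apply: cvgM; first exact: cvg_cst.
  exact: cvg_powRN.
- by move=> x x1; case: (dF _ (ltW x1)).
- by apply: cvg_at_right_filter; exact: cF.
- move=> x; rewrite in_itv /= andbT => x1; rewrite derive1E.
  by case: (dF _ (ltW x1)).
Qed.

Lemma measurable_powRD (c : R) : measurable_fun (D : set R) (fun x : R => powR x c).
Proof. exact: measurable_funTS (measurable_powR c). Qed.

Lemma integrable_powR (c : R) : 0 < c -> mu.-integrable D (fun x => (powR x (- c - 1))%:E).
Proof.
move=> c0; apply/integrableP; split; first by apply/measurable_EFinP; exact: measurable_powRD.
under eq_integral => x _ do rewrite /= ger0_norm ?powR_ge0 //.
by rewrite integral_powR // ltry.
Qed.

Lemma fracpart_ge0 (x : R) : 0 <= fracpart x.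
Proof. by rewrite /fracpart subr_ge0 floor_le_tmp. Qed.

Lemma fracpart_le1 (x : R) : fracpart x <= 1.
Proof. by rewrite /fracpart lerBlDr addrC ltW // -intrD1 floorD1_gt. Qed.

Lemma measurable_fracpart : measurable_fun setT (@fracpart R).
Proof.
apply: measurable_funB => //; apply: nondecreasing_measurable => // x y xy.
by rewrite ler_int; exact: le_floor.
Qed.

Definition intc (F : R -> R[i]) : R[i] :=
  Rintegral mu D (fun x => complex.Re (F x)) +i* Rintegral mu D (fun x => complex.Im (F x)).

Definition cmeas (F : R -> R[i]) :=
  measurable_fun setT (fun x => complex.Re (F x)) /\ measurable_fun setT (fun x => complex.Im (F x)).

Definition cintegrable (F : R -> R[i]) :=
  mu.-integrable D (fun x => (complex.Re (F x))%:E) /\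
  mu.-integrable D (fun x => (complex.Im (F x))%:E).

Lemma ReD (u v : R[i]) : complex.Re (u + v) = complex.Re u + complex.Re v.
Proof. by case: u v => [? ?] [? ?]. Qed.
Lemma ImD (u v : R[i]) : complex.Im (u + v) = complex.Im u + complex.Im v.
Proof. by case: u v => [? ?] [? ?]. Qed.
Lemma ReM (u v : R[i]) : complex.Re (u * v) = complex.Re u * complex.Re v - complex.Im u * complex.Im v.
Proof. by case: u v => [? ?] [? ?]. Qed.
Lemma ImM (u v : R[i]) : complex.Im (u * v) = complex.Re u * complex.Im v + complex.Im u * complex.Re v.
Proof. by case: u v => [? ?] [? ?]. Qed.

Lemma cmeas_cst z : cmeas (fun=> z).
Proof. by split. Qed.

Lemma cmeasD F G : cmeas F -> cmeas G -> cmeas (fun x => F x + G x).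
Proof.
move=> [F1 F2] [G1 G2]; split.
  by rewrite (_ : (fun x => _) = (fun x => complex.Re (F x) + complex.Re (G x)));
   [exact: measurable_funD|apply/funext => x; exact: ReD].
by rewrite (_ : (fun x => _) = (fun x => complex.Im (F x) + complex.Im (G x)));
   [exact: measurable_funD|apply/funext => x; exact: ImD].
Qed.

Lemma cmeasM F G : cmeas F -> cmeas G -> cmeas (fun x => F x * G x).
Proof.
move=> [F1 F2] [G1 G2]; split.
  rewrite (_ : (fun x => _) = (fun x => complex.Re (F x) * complex.Re (G x)
    - complex.Im (F x) * complex.Im (G x))); last by apply/funext => x; exact: ReM.
  by apply: measurable_funB; exact: measurable_funM.
rewrite (_ : (fun x => _) = (fun x => complex.Re (F x) * complex.Im (G x)
  + complex.Im (F x) * complex.Re (G x))); last by apply/funext => x; exact: ImM.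
by apply: measurable_funD; exact: measurable_funM.
Qed.

Lemma cmeasX F n : cmeas F -> cmeas (fun x => F x ^+ n).
Proof.
move=> mF; elim: n => [|n IH]; first by under eq_fun do rewrite expr0; exact: cmeas_cst.
by under eq_fun do rewrite exprS; exact: cmeasM.
Qed.

Lemma cmeas_real (f : R -> R) : measurable_fun setT f -> cmeas (fun x => (f x)%:C).
Proof. by move=> mf; split. Qed.

Lemma cmeas_cexp F : cmeas F -> cmeas (fun x => cexp (F x)).
Proof.
move=> [F1 F2]; split => /=; apply: measurable_funM.
- exact: measurableT_comp (@measurable_expR R) F1.
- by apply: measurableT_comp F2; apply: continuous_measurable_fun; exact: continuous_cos.
- exact: measurableT_comp (@measurable_expR R) F1.
- by apply: measurableT_comp F2; apply: continuous_measurable_fun; exact: continuous_sin.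
Qed.

Lemma cintegrable_dom F (g : R -> R) : cmeas F -> mu.-integrable D (EFin \o g) ->
  (forall x, 1 <= x -> cabs (F x) <= g x) -> cintegrable F.
Proof.
move=> [F1 F2] ig Fg.
have h x : D x -> 1 <= x by rewrite /= in_itv /= andbT.
have g0 x : 1 <= x -> cabs (F x) <= `|g x|.
  by move=> x1; apply: le_trans (Fg _ x1) (ler_norm _).
split; apply: le_integrable ig => //; try exact: measurable_itv.
- by apply/measurable_EFinP; exact: measurable_funTS.
- by move=> x /h x1 /=; rewrite lee_fin (le_trans (Re_le_cabs _)) // g0.
- by apply/measurable_EFinP; exact: measurable_funTS.
- by move=> x /h x1 /=; rewrite lee_fin (le_trans (Im_le_cabs _)) // g0.
Qed.

(** The factor 2 comes from bounding real and imaginary parts separately. *)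
Lemma intc_le F (g : R -> R) : cmeas F -> mu.-integrable D (EFin \o g) ->
  (forall x, 1 <= x -> cabs (F x) <= g x) -> cabs (intc F) <= 2 * Rintegral mu D g.
Proof.
move=> mF ig Fg; have [I1 I2] := cintegrable_dom mF ig Fg.
have h x : D x -> 1 <= x by rewrite /= in_itv /= andbT.
apply: le_trans (cabs_le_ReIm _) _; rewrite /intc /= mulr2n mulrDl mul1r.
apply: lerD.
  apply: le_trans (le_normr_Rintegral _ I1) _; first exact: measurable_itv.
  apply: le_Rintegral => //.
    exact: integrable_norm.
  by move=> x /h x1; rewrite (le_trans (Re_le_cabs _)) // Fg.
apply: le_trans (le_normr_Rintegral _ I2) _; first exact: measurable_itv.
apply: le_Rintegral => //.
  exact: integrable_norm.
by move=> x /h x1; rewrite (le_trans (Im_le_cabs _)) // Fg.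
Qed.

Lemma cintegrableD F G : cintegrable F -> cintegrable G ->
  cintegrable (fun x => F x + G x) /\ intc (fun x => F x + G x) = intc F + intc G.
Proof.
move=> [F1 F2] [G1 G2].
have E1 : (fun x => complex.Re (F x + G x)) = (fun x => complex.Re (F x) + complex.Re (G x)).
  by apply/funext => x; exact: ReD.
have E2 : (fun x => complex.Im (F x + G x)) = (fun x => complex.Im (F x) + complex.Im (G x)).
  by apply/funext => x; exact: ImD.
split.
  split.
    rewrite (_ : (fun x => _) = (fun x => (complex.Re (F x))%:E + (complex.Re (G x))%:E)%E).
      by apply: integrableD => //; exact: measurable_itv.
    by apply/funext => x; rewrite ReD.
  rewrite (_ : (fun x => _) = (fun x => (complex.Im (F x))%:E + (complex.Im (G x))%:E)%E).
    by apply: integrableD => //; exact: measurable_itv.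
  by apply/funext => x; rewrite ImD.
by rewrite /intc E1 E2 !RintegralD.
Qed.

Lemma cintegrableZ F z : cintegrable F ->
  cintegrable (fun x => F x * z) /\ intc (fun x => F x * z) = intc F * z.
Proof.
move=> [F1 F2]; case: z => a b.
have E1 : (fun x => complex.Re (F x * (a +i* b))) = (fun x => a * complex.Re (F x) - b * complex.Im (F x)).
  by apply/funext => x; rewrite ReM /=; ring.
have E2 : (fun x => complex.Im (F x * (a +i* b))) = (fun x => b * complex.Re (F x) + a * complex.Im (F x)).
  by apply/funext => x; rewrite ImM /=; ring.
have IZ (c : R) (f : R -> R) : mu.-integrable D (EFin \o f) -> mu.-integrable D (EFin \o (fun x => c * f x)).
  exact: integrableZD.
split.
  split.
    rewrite (_ : (fun x => _) = (fun x => (a * complex.Re (F x))%:E - (b * complex.Im (F x))%:E)%E).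
      by apply: integrableB; [exact: measurable_itv|exact: IZ|exact: IZ].
    by apply/funext => x; rewrite -EFinB; congr EFin; exact: (congr1 (fun f => f x) E1).
  rewrite (_ : (fun x => _) = (fun x => (b * complex.Re (F x))%:E + (a * complex.Im (F x))%:E)%E).
    by apply: integrableD; [exact: measurable_itv|exact: IZ|exact: IZ].
  by apply/funext => x; rewrite -EFinD; congr EFin; exact: (congr1 (fun f => f x) E2).
rewrite /intc E1 E2 RintegralB //; try exact: measurable_itv; try exact: IZ.
rewrite RintegralD //; try exact: measurable_itv; try exact: IZ.
rewrite !RintegralZl //; try exact: measurable_itv.
by simpc; congr (_ +i* _); ring.
Qed.

Lemma cintegrable_sum (A : nat -> R -> R[i]) z n : (forall k, cintegrable (A k)) ->
  cintegrable (fun x => \sum_(k < n) A k x * z ^+ k) /\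
  intc (fun x => \sum_(k < n) A k x * z ^+ k) = \sum_(k < n) intc (A k) * z ^+ k.
Proof.
move=> AI; elim: n => [|n [I E]].
  have -> : (fun x => \sum_(k < 0) A k x * z ^+ k) = (fun x : R => 0 : R[i]).
    by apply/funext => x; rewrite big_ord0.
  split; first by split; exact: integrable0.
  by rewrite big_ord0 /intc /= /Rintegral integral0.
have -> : (fun x => \sum_(k < n.+1) A k x * z ^+ k) =
    (fun x => \sum_(k < n) A k x * z ^+ k + A n x * z ^+ n).
  by apply/funext => x; rewrite big_ord_recr.
have [I2 E2] := cintegrableZ (z ^+ n) (AI n).
have [I3 E3] := cintegrableD I I2.
by split => //; rewrite E3 E E2 big_ord_recr.
Qed.

(** The integrand [{x} x^(-s-1)] in exponential form, so that passing from [s] to [s + z] multiplies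
    it by [cexp (- z ln x)], whose Taylor expansion in [z] gives [tcoef]. *)
Definition om s (x : R) : R[i] := (fracpart x)%:C * cexp (- (s + 1) * (ln x)%:C).

Definition tail s : R[i] := zeta_tail_re s +i* zeta_tail_im s.

Lemma cmeas_om s : cmeas (om s).
Proof.
apply: cmeasM; first by apply: cmeas_real; exact: measurable_fracpart.
apply: cmeas_cexp; apply: cmeasM; first exact: cmeas_cst.
by apply: cmeas_real; exact: measurable_ln.
Qed.

Lemma om_le s x : 1 <= x -> cabs (om s x) <= powR x (- complex.Re s - 1).
Proof.
move=> x1; have x0 : 0 < x := lt_le_trans ltr01 x1.
rewrite /om cabsM cabs_real ger0_norm ?fracpart_ge0 // cabs_cexp.
have -> : complex.Re (- (s + 1) * (ln x)%:C) = (- complex.Re s - 1) * ln x.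
  by case: (s) => a b; simpc => /=; ring.
rewrite /powR gt_eqF // -[leRHS]mul1r ler_wpM2r ?expR_ge0 //.
exact: fracpart_le1.
Qed.

Lemma tailE s : tail s = intc (om s).
Proof.
have x0 x : D x -> 0 < x by rewrite /= in_itv /= andbT; exact: lt_le_trans.
rewrite /tail /intc; congr (_ +i* _); apply: eq_Rintegral => x; rewrite inE => /x0 xp.
  rewrite /om /powR gt_eqF //; case: s => a b; simpc => /=.
  rewrite -mulrA cosN; congr (_ * (expR _ * _)); ring.
rewrite /om /powR gt_eqF //; case: s => a b; simpc => /=.
by rewrite sinN -mulrA mulrN mulrN; congr (- (_ * (expR _ * _))); ring.
Qed.

Lemma cintegrable_om s : 0 < complex.Re s -> cintegrable (om s).
Proof.
move=> s0; apply: cintegrable_dom (cmeas_om s) (integrable_powR s0) _.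
exact: om_le.
Qed.

Lemma cabs_tail_le s : 0 < complex.Re s -> cabs (tail s) <= 2 / complex.Re s.
Proof.
move=> s0; rewrite tailE.
apply: le_trans (intc_le (cmeas_om s) (integrable_powR s0) (om_le s)) _.
by rewrite /Rintegral integral_powR.
Qed.

Definition tcoef s k x : R[i] := om s x * ((k`!%:R^-1)%:C * (- (ln x)%:C) ^+ k).

(** Expand [x^(-z)] under the integral and apply [cexp_taylor_abs] with [Y = r ln x] and
    [th = |z| / r]. The remainder is at most [th^n x^r], and [x^r x^(- Re s - 1)] is integrable with
    integral [1 / (Re s - r)]. *)
Lemma tail_taylor s (r : R) : 0 < r -> r < complex.Re s ->
  forall n z, cabs z <= r ->
   cabs (tail (s + z) - \sum_(k < n) intc (tcoef s k) * z ^+ k)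
     <= 2 / (complex.Re s - r) * (cabs z / r) ^+ n.
Proof.
move=> r0 rs n z zr.
have c0 : 0 < complex.Re s - r by rewrite subr_gt0.
have s0 : 0 < complex.Re s := lt_trans r0 rs.
pose g (x : R) := powR x (- (complex.Re s - r) - 1).
have gE x : 1 <= x -> powR x (- complex.Re s - 1) * expR (r * ln x) = g x.
  move=> x1; have x0 : 0 < x := lt_le_trans ltr01 x1.
  by rewrite /g /powR gt_eqF // -expRD; congr expR; ring.
have ln0' x : 1 <= x -> 0 <= ln x :> R by exact: ln_ge0.
have cl x : 1 <= x -> cabs (- (ln x)%:C) = ln x :> R.
  by move=> /ln0' x1; rewrite cabsN cabs_real ger0_norm.
have mT k : cmeas (tcoef s k).
  apply: cmeasM; first exact: cmeas_om.
  apply: cmeasM; first exact: cmeas_cst.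
  apply: cmeasX; rewrite (_ : (fun x => _) = (fun x => (-1) * (ln x)%:C)).
    apply: cmeasM; first exact: cmeas_cst.
    by apply: cmeas_real; exact: measurable_ln.
  by apply/funext => x; rewrite mulN1r.
have IT k : cintegrable (tcoef s k).
  have ig : mu.-integrable D (EFin \o (fun x => r ^- k * g x)).
    exact: integrableZD (integrable_powR c0).
  apply: cintegrable_dom (mT k) ig _ => x x1.
  rewrite /tcoef cabsM [X in _ * X]cabsM cabsX cl // cabs_real ger0_norm ?invr_ge0 //.
  rewrite -gE // [leRHS]mulrCA; apply: ler_pM; rewrite ?cabs_ge0 //.
  - by rewrite mulr_ge0 ?invr_ge0 ?exprn_ge0 ?ln0'.
  - exact: om_le.
  - have rx : 0 <= r * ln x by rewrite mulr_ge0 ?ln0' // ltW.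
    have := pow_fact_le k rx; rewrite exprMn => H.
    rewrite ler_pdivlMl ?exprn_gt0 //; apply: le_trans H.
    by rewrite mulrCA mulrC.
have [Is Es] := cintegrable_sum z n IT.
have sz : 0 < complex.Re (s + z).
  rewrite ReD; have := le_trans (Re_le_cabs z) zr; rewrite ler_norml => /andP[h _].
  by lra.
have [In En] := cintegrableZ (-1) Is.
have [_ Ed] := cintegrableD (cintegrable_om sz) In.
rewrite tailE -Es -[- intc _]mulrN1 -En -Ed.
pose th := cabs z / r.
have th01 : 0 <= th <= 1.
  by rewrite /th divr_ge0 ?cabs_ge0 ?(ltW r0) //= ler_pdivrMr // mul1r.
apply: le_trans (intc_le (g := fun x => th ^+ n * g x) _ _ _) _.
- apply: cmeasD; first exact: cmeas_om.
  apply: cmeasM; last exact: cmeas_cst.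
  elim: n {Is Es In En Ed} => [|n IH].
    by under eq_fun do rewrite big_ord0; exact: cmeas_cst.
  under eq_fun do rewrite big_ord_recr /=.
  by apply: cmeasD => //; apply: cmeasM => //; exact: cmeas_cst.
- exact: integrableZD (integrable_powR c0).
- move=> x x1; have lx := ln0' _ x1.
  have -> : om (s + z) x + (\sum_(k < n) tcoef s k x * z ^+ k) * (-1) =
     om s x * (cexp (- z * (ln x)%:C) - \sum_(k < n) (k`!%:R^-1)%:C * (- z * (ln x)%:C) ^+ k).
    rewrite mulrBr mulrN1; congr (_ - _).
      by rewrite /om -mulrA -cexpD; congr (_ * cexp _); ring.
    rewrite mulr_sumr; apply: eq_bigr => k _.
    have -> : - z * (ln x)%:C = - (ln x)%:C * z by ring.
    by rewrite exprMn /tcoef !mulrA.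
  rewrite cabsM -gE // [leRHS]mulrCA; apply: ler_pM; rewrite ?cabs_ge0 //; first exact: om_le.
  apply: cexp_taylor_abs => //; first by rewrite mulr_ge0 // ltW.
  rewrite mulNr cabsN cabsM cabs_real ger0_norm // /th mulrA divfK // gt_eqF //.
- rewrite RintegralZl //; last exact: integrable_powR.
  by rewrite /Rintegral integral_powR //= mulrCA mulrC mulrAC.
Qed.

End Tail.

(** * Analyticity as a geometric remainder bound; the function xi *)

Section Taylor.
Variable R : realType.
Implicit Types (z s : R[i]) (g : R[i] -> R[i]).

(** One constant [C] serves all [n]. The strict [r < rho] gives uniform convergence on the closed
    disc of radius [r], and the power of [cabs z] in the remainder gives Lipschitz bounds and orders
    of vanishing, all without derivatives. *)
Definition taylor g s0 (r : R) := exists (a : nat -> R[i]) (C rho : R),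
  [/\ r < rho, 0 <= C & forall n z, cabs z <= r ->
    cabs (g (s0 + z) - \sum_(k < n) a k * z ^+ k) <= C * (cabs z / rho) ^+ n].

Lemma taylor_tail s0 (r : R) : 0 < r -> r < complex.Re s0 -> taylor (@tail R) s0 r.
Proof.
move=> r0 rs; pose rho := (r + complex.Re s0) / 2.
have h1 : r < rho by rewrite /rho midf_lt.
have h2 : rho < complex.Re s0 by rewrite /rho midf_lt.
exists (fun k => intc (tcoef s0 k)), (2 / (complex.Re s0 - rho)), rho; split => //.
  by rewrite divr_ge0 // subr_ge0 ltW.
move=> n z zr; apply: tail_taylor => //; first exact: lt_trans h1.
exact: le_trans zr (ltW h1).
Qed.

(** Closure under this one operation is enough for xi, which is [s (1 - (s - 1) tail s)], two nested
    instances. The coefficients [a'] come from multiplying the series by [(s0 - be) + z]. *)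
Lemma taylor_affine g s0 (r : R) al ga be : 0 <= r -> taylor g s0 r ->
  taylor (fun s => al + ga * (s - be) * g s) s0 r.
Proof.
move=> r0 [a [C [rho [rr C0 H]]]].
have rho0 : 0 < rho := le_lt_trans r0 rr.
pose a' k := if k is k'.+1 then ga * ((s0 - be) * a k + a k') else al + ga * (s0 - be) * a 0.
have S n z : \sum_(k < n.+1) a' k * z ^+ k =
    al + ga * ((s0 - be) * (\sum_(k < n.+1) a k * z ^+ k) + z * (\sum_(k < n) a k * z ^+ k)).
  elim: n => [|n IH].
    by rewrite !big_ord1 big_ord0 /= !expr0; ring.
  rewrite big_ord_recr {}IH [in RHS](big_ord_recr n.+1) /=.
  rewrite [X in _ = _ + ga * (_ + z * X)]big_ord_recr /= exprS; ring.
pose K := cabs ga * (cabs (s0 - be) + rho).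
have K0 : 0 <= K by rewrite mulr_ge0 ?addr_ge0 ?cabs_ge0 // ltW.
exists a', (cabs al + K * C), rho; split => //.
  by rewrite addr_ge0 ?cabs_ge0 // mulr_ge0.
move=> n z zr; have zrho : cabs z <= rho := le_trans zr (ltW rr).
have th0 : 0 <= cabs z / rho by rewrite divr_ge0 ?cabs_ge0 // ltW.
case: n => [|n].
  rewrite big_ord0 subr0 expr0 mulr1; apply: le_trans (cabsD _ _) _; rewrite lerD2l.
  have := H 0%N z zr; rewrite big_ord0 subr0 expr0 mulr1 => H0.
  rewrite !cabsM; apply: ler_pM; rewrite ?mulr_ge0 ?cabs_ge0 //.
  rewrite ler_wpM2l ?cabs_ge0 // -addrA [z - be]addrC addrA.
  by apply: le_trans (cabsD _ _) _; rewrite lerD2l.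
rewrite S.
have -> : al + ga * (s0 + z - be) * g (s0 + z) -
   (al + ga * ((s0 - be) * (\sum_(k < n.+1) a k * z ^+ k) + z * (\sum_(k < n) a k * z ^+ k))) =
  ga * ((s0 - be) * (g (s0 + z) - \sum_(k < n.+1) a k * z ^+ k) +
    z * (g (s0 + z) - \sum_(k < n) a k * z ^+ k)) by ring.
apply: (@le_trans _ _ (K * C * (cabs z / rho) ^+ n.+1)); last first.
  by rewrite ler_wpM2r ?exprn_ge0 // lerDr cabs_ge0.
rewrite cabsM /K -!mulrA ler_wpM2l ?cabs_ge0 // [leRHS]mulrDl.
apply: le_trans (cabsD _ _) _; rewrite !cabsM; apply: lerD.
  by rewrite ler_wpM2l ?cabs_ge0 // H.
apply: le_trans (ler_wpM2l (cabs_ge0 z) (H n z zr)) _.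
rewrite exprS [leRHS](_ : _ = cabs z * (C * (cabs z / rho) ^+ n)) //.
by field; rewrite gt_eqF.
Qed.

(** The pole of zeta is cancelled algebraically, so that at [s = 1] the value is 1, whereas the
    product [zeta s * (s - 1)] gives 0 there. *)
Definition xi s : R[i] := s - s * (s - 1) * tail s.

Lemma xi_zeta s : s != 1 -> zeta s * (s - 1) = xi s.
Proof.
move=> s1; have h : s - 1 != 0 by rewrite subr_eq0.
by rewrite /zeta -/(tail s) /xi mulrBl divfK //; ring.
Qed.

Lemma taylor_xi s0 (r : R) : 0 < r -> r < complex.Re s0 -> taylor xi s0 r.
Proof.
move=> r0 rs; have := taylor_affine 0 1 0 (ltW r0)
  (taylor_affine 1 (-1) 1 (ltW r0) (taylor_tail r0 rs)).
by congr taylor; apply/funext => s; rewrite /xi; ring.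
Qed.

Lemma taylor_poly g s0 (r d : R) : 0 < d -> 0 <= r -> taylor g s0 r ->
  exists P : {poly R[i]}, forall s, cabs (s - s0) <= r -> cabs (g s - P.[s]) <= d.
Proof.
move=> d0 r0 [a [C [rho [rr C0 H]]]].
have rho0 : 0 < rho := le_lt_trans r0 rr.
have q1 : `|r / rho| < 1.
  by rewrite ger0_norm ?divr_ge0 // ?(ltW rho0) // ltr_pdivrMr // mul1r.
have : (fun n => C * (r / rho) ^+ n) @ \oo --> 0.
  rewrite -[X in _ --> X](mulr0 C); apply: cvgM; first exact: cvg_cst.
  exact: cvg_expr.
move=> /cvgrPdist_le /(_ d d0) [n _ Hn].
exists (\sum_(k < n) a k *: ('X - s0%:P) ^+ k) => s sr.
have -> : (\sum_(k < n) a k *: ('X - s0%:P) ^+ k).[s] = \sum_(k < n) a k * (s - s0) ^+ k.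
  by rewrite horner_sum; apply: eq_bigr => k _; rewrite hornerZ horner_exp hornerXsubC.
have := H n (s - s0) sr; rewrite [s0 + _]addrC subrK => h; apply: le_trans h _.
apply: (@le_trans _ _ (C * (r / rho) ^+ n)).
  rewrite ler_wpM2l // lerXn2r ?nnegrE ?divr_ge0 ?cabs_ge0 // ?(ltW rho0) //.
  by rewrite ler_wpM2r // invr_ge0 ltW.
by have := Hn n (leqnn n); rewrite sub0r normrN; apply: le_trans; exact: ler_norm.
Qed.

Lemma taylor_lip g s0 (r : R) : 0 <= r -> taylor g s0 r ->
  exists2 K, 0 <= K & forall z, cabs z <= r -> cabs (g (s0 + z) - g s0) <= K * cabs z.
Proof.
move=> r0 [a [C [rho [rr C0 H]]]].
have rho0 : 0 < rho := le_lt_trans r0 rr.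
have E : g s0 = a 0%N.
  have := H 1%N 0; rewrite cabs0 => /(_ r0).
  rewrite mul0r expr1 mulr0 addr0 big_ord1 expr0 mulr1 => h.
  apply/eqP; rewrite -subr_eq0 -cabs_eq0 eq_le h cabs_ge0 //.
exists (C / rho); first by rewrite divr_ge0 // ltW.
move=> z zr; have := H 1%N z zr; rewrite big_ord1 expr0 mulr1 expr1 E.
by rewrite mulrA mulrAC.
Qed.

(** The first nonzero coefficient dominates near [s0]. One exists, for otherwise the remainder bound
    would force [g] to vanish on the whole disc. *)
Lemma taylor_order g s0 (r : R) : 0 < r -> taylor g s0 r ->
  (exists2 z, cabs z <= r & g (s0 + z) != 0) ->
  exists (m : nat) (c r' : R), [/\ 0 < c, 0 < r' &
    forall z, cabs z <= r' -> c * cabs z ^+ m <= cabs (g (s0 + z)) <= 4 * c * cabs z ^+ m].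
Proof.
move=> r0 [a [C [rho [rr C0 H]]]] [z0 z0r gz0].
have rho0 : 0 < rho := lt_trans r0 rr.
have [m am amin] : exists2 m, a m != 0 & forall k, (k < m)%N -> a k = 0.
  have [[m am]|na] := pselect (exists m, a m != 0).
    have ex : exists m, a m != 0 by exists m.
    have := find_ex_minn ex => -[k ak kmin]; exists k => // j jk.
    by apply/eqP; apply: contraTT jk => /kmin; rewrite -leqNgt.
  have a0 k : a k = 0 by apply/eqP; apply: contrapT => /negP ak; apply: na; exists k.
  suff : cabs (g (s0 + z0)) <= 0 by rewrite leNgt cabs_gt0 gz0.
  have : (fun n => C * (cabs z0 / rho) ^+ n) @ \oo --> 0.
    rewrite -[X in _ --> X](mulr0 C); apply: cvgM; first exact: cvg_cst.
    apply: cvg_expr; rewrite ger0_norm ?divr_ge0 ?cabs_ge0 // ?(ltW rho0) //.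
    by rewrite ltr_pdivrMr // mul1r (le_lt_trans z0r).
  move=> h; rewrite -(cvg_lim _ h) //; apply: limr_ge; first by apply/cvg_ex; exists 0.
  apply: nearW => n; have := H n z0 z0r.
  by rewrite big1 ?subr0 // => k _; rewrite a0 mul0r.
pose A := cabs (a m); have A0 : 0 < A by rewrite cabs_gt0.
pose K := C / rho ^+ m.+1; have K0 : 0 <= K by rewrite divr_ge0 ?exprn_ge0 // ltW.
(* The radius makes the remainder [K |z|^(m+1)] at most half of the leading term [A |z|^m], so the
   modulus lies between [A / 2] and [3 A / 2] times [|z|^m]. Using [K + 1] avoids dividing by
   zero. *)
exists m, (A / 2), (Num.min r (A / (2 * (K + 1)))); split.
- by rewrite divr_gt0.
- by rewrite lt_min r0 divr_gt0 // mulr_gt0 // ltr_wpDl.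
move=> z; rewrite le_min => /andP[zr zA].
have := H m.+1 z zr; rewrite big_ord_recr /= big1 ?add0r; last first.
  by move=> k _; rewrite amin ?mul0r.
have -> : C * (cabs z / rho) ^+ m.+1 = K * cabs z * cabs z ^+ m.
  by rewrite /K expr_div_n [cabs z ^+ m.+1]exprS; ring.
have zz : 0 <= cabs z ^+ m by rewrite exprn_ge0 // cabs_ge0.
have Kz : K * cabs z <= A / 2.
  apply: (@le_trans _ _ ((K + 1) * cabs z)).
    by rewrite ler_wpM2r ?cabs_ge0 // lerDl.
  rewrite -ler_pdivlMl ?ltr_wpDl //; apply: le_trans zA _.
  by rewrite invfM [leRHS]mulrC mulrA.
move=> Hz; have {}Hz : cabs (g (s0 + z) - a m * z ^+ m) <= A / 2 * cabs z ^+ m.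
  by apply: le_trans Hz _; rewrite ler_wpM2r.
have amz : cabs (a m * z ^+ m) = A * cabs z ^+ m by rewrite cabsM cabsX.
apply/andP; split.
  have := cabsB (a m * z ^+ m) (g (s0 + z)); move: (cabsC (a m * z ^+ m) (g (s0 + z))).
  move: Hz; rewrite amz; lra.
have := cabsB (g (s0 + z)) (a m * z ^+ m); move: Hz; rewrite amz.
have : 0 <= A * cabs z ^+ m by rewrite mulr_ge0 // ltW.
lra.
Qed.

End Taylor.

(** * Growth of xi, and its lower bound on the real axis *)

Section XiBounds.
Variable R : realType.
Notation mu := (@lebesgue_measure R).
Implicit Types (z s : R[i]).

Lemma cabs_xi_le s : 1 / 2 <= complex.Re s -> cabs (xi s) <= 4 * (1 + cabs s) ^+ 2.
Proof.
move=> s2; have s0 : 0 < complex.Re s by lra.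
have T4 : cabs (tail s) <= 4.
  apply: le_trans (cabs_tail_le s0) _; rewrite ler_pdivrMr //; lra.
have n0 := cabs_ge0 s.
rewrite /xi; apply: le_trans (cabsD _ _) _; rewrite cabsN !cabsM.
have h1 : cabs (s - 1) <= cabs s + 1.
  by apply: le_trans (cabsD _ _) _; rewrite cabsN cabs1.
have h2 : cabs s * cabs (s - 1) * cabs (tail s) <= cabs s * (cabs s + 1) * 4.
  by apply: ler_pM; rewrite ?mulr_ge0 ?cabs_ge0 // ler_wpM2l.
have : 0 <= cabs s ^+ 2 by rewrite sqr_ge0.
move: h2; rewrite sqrrD expr1n; lra.
Qed.

(** On the real axis the tail lies between 0 and [1 / y]. Therefore xi is at least [y] for [y <= 1]
    and at least 1 for [y > 1]. *)
Lemma xi_real (y : R) : 1 / 2 <= y -> exists2 v : R, xi y%:C = v%:C & 1 / 2 <= v.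
Proof.
move=> y2; have y0 : 0 < y by lra.
have i0 : zeta_tail_im y%:C = 0.
  rewrite /zeta_tail_im /=; under eq_Rintegral do rewrite mul0r sin0 mulr0 oppr0.
  by rewrite /Rintegral integral0.
pose tau := zeta_tail_re y%:C.
have E : tau = Rintegral mu `[1, +oo[ (fun x => fracpart x * powR x (- y - 1)).
  by rewrite /tau /zeta_tail_re /=; apply: eq_Rintegral => x _; rewrite mul0r cos0 mulr1.
have t0 : 0 <= tau.
  by rewrite E; apply: Rintegral_ge0 => x _; rewrite mulr_ge0 ?fracpart_ge0 ?powR_ge0.
have t1 : tau <= y^-1.
  have -> : y^-1 = Rintegral mu `[1, +oo[ (fun x => powR x (- y - 1)).
    by rewrite /Rintegral integral_powR.
  have I := integrable_powR y0.
  rewrite E; apply: le_Rintegral => //.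
    apply: le_integrable I; first exact: measurable_itv.
      apply/measurable_EFinP; apply: measurable_funM; last exact: measurable_powRD.
      apply: measurable_funTS; exact: measurable_fracpart.
    move=> x _; rewrite /= lee_fin normrM ler_piMl // ger0_norm ?fracpart_ge0 //.
    exact: fracpart_le1.
  by move=> x _; rewrite ler_piMl ?powR_ge0 // fracpart_le1.
exists (y - y * (y - 1) * tau).
  by rewrite /xi /tail i0 -/tau; simpc; congr (_ +i* _); ring.
have [y1|y1] := leP y 1.
  have : 0 <= y * (1 - y) * tau by rewrite !mulr_ge0 // ?subr_ge0 // ltW.
  lra.
have h : y * (y - 1) * tau <= y * (y - 1) * y^-1.
  by rewrite ler_wpM2l // mulr_ge0 ?subr_ge0 // ltW.
have : y * (y - 1) * y^-1 = y - 1 by rewrite mulrAC divff ?mul1r // gt_eqF.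
lra.
Qed.

Lemma cabs_xi_real (y : R) : 1 / 2 <= y -> 1 / 2 <= cabs (xi y%:C).
Proof.
move=> /xi_real[v -> v2]; rewrite cabs_real; apply: le_trans v2 _; exact: ler_norm.
Qed.

End XiBounds.

(** * The sub-mean value inequality *)

Section SubMean.
Variable R : realType.
Notation mu := (@lebesgue_measure R).
Implicit Types (z s : R[i]) (e b x t a : R).

(** A common majorant of [ln |xi|] on the line and of the logarithms of all approximants on their
    circles. [xi_psi_le] gives the constant 32, and 50 leaves room for the approximation error. *)
Definition maj (t : R) : R := ln (50 * (1 + t ^+ 2)).

Lemma maj_arg_ge1 t : 1 <= 50 * (1 + t ^+ 2).
Proof. by have := sqr_ge0 t; lra. Qed.

Lemma maj_ge0 t : 0 <= maj t.
Proof. by rewrite ln_ge0 // maj_arg_ge1. Qed.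

Lemma continuous_maj : continuous maj.
Proof.
move=> t; apply: (@continuous_comp _ _ _ (fun t => 50 * (1 + t ^+ 2)) (@ln R)).
  apply: cvgM; first exact: cvg_cst.
  apply: cvgD; first exact: cvg_cst.
  exact: exprn_continuous.
by apply: continuous_ln; apply: lt_le_trans ltr01 (maj_arg_ge1 t).
Qed.

Lemma pk_le1 x t : 0 < x -> pk x t <= (x + x^-1) * pk 1 t.
Proof.
move=> x0; have p0 := pi_gt0 R.
have d1 := pk_den_gt0 t x0; have d2 := pk_den_gt0 t (@ltr01 R).
have -> : (x + x^-1) * pk 1 t = (x + x^-1) / (pi * (1 ^+ 2 + t ^+ 2)).
  by rewrite /pk mul1r.
rewrite /pk ler_pdivrMr ?mulr_gt0 // mulrAC ler_pdivlMr ?mulr_gt0 //.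
have -> : (x + x^-1) * (pi * (x ^+ 2 + t ^+ 2)) =
   pi * (x ^+ 3 + x + (x + x^-1) * t ^+ 2) by field; rewrite gt_eqF.
rewrite mulrCA ler_wpM2l ?(ltW p0) // expr1n mulrDr mulr1.
have h1 : 0 <= x ^+ 3 by rewrite exprn_ge0 // ltW.
have h2 : 0 <= x^-1 * t ^+ 2 by rewrite mulr_ge0 ?sqr_ge0 // invr_ge0 ltW.
by rewrite mulrDl; lra.
Qed.

(** For [x = 1], [1 + t^2 = 4 / |1 + wc 1 t|^2], so this is integrability for a linear factor with
    its root on the unit circle, at the image of infinity. Other kernels are compared with
    [pk 1]. *)
Lemma integrable_maj x : 0 < x -> mu.-integrable setT (EFin \o (fun t => maj t * pk x t)).
Proof.
move=> x0.
have i1 : mu.-integrable setT (EFin \o (fun t => maj t * pk 1 t)).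
  have n1 : (1 : R[i]) != 0 := oner_neq0 _.
  have pq : ((1 : R[i]) != 0) || ((1 : R[i]) != 0) by rewrite n1.
  have I := mlin_integrable (@ltr01 R) pq.
  have E t : maj t = (ln 50 + 2 * ln 2) - 2 * ln (cabs (1 + 1 * wc 1 t)).
    have h : cabs (1 + 1 * wc 1 t) ^+ 2 = 4 / (1 + t ^+ 2).
      have d : (1 +i* t) != 0 :> R[i] by exact: xt_neq0.
      have -> : 1 + 1 * wc 1 t = 2%:C / (1 +i* t).
        apply: (mulIf d); rewrite divfK // mul1r mulrDl wcE // mul1r.
        by simpc; congr (_ +i* _); ring.
      rewrite cabsf expr_div_n cabs_real sqr_cabs /= expr1n ger0_norm //.
      by congr (_ / _); ring.
    have d2 : 0 < 1 + t ^+ 2 by rewrite ltr_wpDr ?sqr_ge0.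
    rewrite ln_cabs h ln_div ?posrE // /maj lnM ?posrE //.
    have -> : 4 = 2 ^+ 2 :> R by ring.
    by rewrite lnXn //; lra.
  have I0 := integrableZl measurableT (ln 50 + 2 * ln 2) (integrable_pk (@ltr01 R)).
  have := integrableB measurableT I0 (integrableZl measurableT 2 I).
  congr (_.-integrable _ _); apply/funext => t.
  by rewrite /= -EFinB; congr EFin; rewrite E; ring.
have := integrableZl measurableT (x + x^-1) i1.
apply: le_integrable => //.
  apply/measurable_EFinP; apply: measurable_funM; apply: continuous_measurable_fun.
    exact: continuous_maj.
  exact: continuous_pk.
move=> t _ /=; rewrite lee_fin !ger0_norm.
- by rewrite [leRHS]mulrCA ler_wpM2l ?maj_ge0 // pk_le1.
- have h1 : 0 <= maj t * pk 1 t by rewrite mulr_ge0 ?maj_ge0 ?pk_ge0.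
  apply: mulr_ge0 h1; apply: addr_ge0; first exact: ltW.
  by rewrite invr_ge0; exact: ltW.
- by rewrite mulr_ge0 ?maj_ge0 ?pk_ge0.
Qed.

Lemma cabs_1ie_ge1 e t : 1 <= cabs (1 +i* (e * t) : R[i]).
Proof. by apply: le_trans (ler_norm _) (Re_le_cabs (1 +i* (e * t))). Qed.

Lemma psi_tail_le e t : cabs ((0 +i* t) / (1 +i* (e * t)) : R[i]) <= `|t|.
Proof.
rewrite cabsf ler_pdivrMr ?cabs_gt0 ?one_ie_neq0 //.
have -> : cabs (0 +i* t : R[i]) = `|t| by rewrite /cabs /= expr0n add0r sqrtr_sqr.
by rewrite ler_peMr // cabs_1ie_ge1.
Qed.

Lemma cabs_psi_le e b t : 0 <= b -> cabs (psi e b t) <= b + `|t|.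
Proof.
move=> b0; apply: le_trans (cabsD _ _) _; apply: lerD; last exact: psi_tail_le.
by rewrite cabs_real ger0_norm.
Qed.

Lemma depth_Re e b z : 0 <= e -> 0 <= depth e b z -> b <= complex.Re z.
Proof.
rewrite /depth => e0; rewrite subr_ge0 => h; rewrite -subr_ge0; apply: le_trans h.
by rewrite mulr_ge0 ?sqr_ge0.
Qed.

Lemma xi_psi_le e b t : 0 <= e -> 1 / 2 <= b -> b <= 1 ->
  cabs (xi (psi e b t)) <= 32 * (1 + t ^+ 2).
Proof.
move=> e0 b2 b1; have b0 : 0 <= b by lra.
have h : 1 / 2 <= complex.Re (psi e b t).
  by apply: le_trans b2 _; apply: (depth_Re e0); rewrite psi_depth.
apply: le_trans (cabs_xi_le h) _.
have h2 := cabs_psi_le e t b0; have h3 := cabs_ge0 (psi e b t).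
have h4 : (1 + cabs (psi e b t)) ^+ 2 <= (2 + `|t|) ^+ 2.
  by rewrite ler_pXn2r ?nnegrE ?addr_ge0 //; have := normr_ge0 t; lra.
have h5 : 0 <= (`|t| - 2) ^+ 2 by rewrite sqr_ge0.
have h6 : `|t| ^+ 2 = t ^+ 2 by rewrite real_normK // num_real.
move: h4 h5; rewrite -h6 !sqrrD sqrrN mulrN; have := sqr_ge0 `|t|; lra.
Qed.

Lemma psi_line e b t : 0 <= e -> cabs (psi e b t - (b +i* t)) <= e * t ^+ 2.
Proof.
move=> e0; have d0 := one_ie_neq0 e t.
have -> : psi e b t - (b +i* t) = (e * t ^+ 2)%:C / (1 +i* (e * t)).
  apply: (mulIf d0); rewrite divfK //.
  have -> : b +i* t = b%:C + (0 +i* t) by simpc.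
  have -> : (psi e b t - (b%:C + (0 +i* t))) * (1 +i* (e * t)) =
      (0 +i* t) - (0 +i* t) * (1 +i* (e * t)).
    by rewrite /psi opprD addrACA subrr add0r mulrBl divfK.
  by simpc; congr (_ +i* _); ring.
have h := mulr_ge0 e0 (sqr_ge0 t).
rewrite cabsf cabs_real (ger0_norm h).
by rewrite ler_pdivrMr ?cabs_gt0 // ler_peMr ?cabs_1ie_ge1.
Qed.

Lemma src_lim e b x : 0 <= e -> 0 < x -> `|src e b x - (b + x)| <= e * x ^+ 2.
Proof.
move=> e0 x0; have ex : 0 < 1 + e * x by rewrite ltr_wpDr // mulr_ge0 // ltW.
have -> : src e b x - (b + x) = - (e * x ^+ 2 / (1 + e * x)).
  by rewrite /src; field; rewrite gt_eqF.
have h := mulr_ge0 e0 (sqr_ge0 x).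
rewrite normrN (ger0_norm (divr_ge0 h (ltW ex))).
by rewrite ler_pdivrMr // ler_peMr // lerDl mulr_ge0 // ltW.
Qed.

Lemma xi_cont (u : nat -> R[i]) s : 0 < complex.Re s ->
  cabs (u n - s) @[n --> \oo] --> (0 : R) ->
  cabs (xi (u n) - xi s) @[n --> \oo] --> (0 : R).
Proof.
move=> s0 us; pose r := complex.Re s / 2.
have r0 : 0 < r by rewrite divr_gt0.
have rs : r < complex.Re s by rewrite /r; lra.
have [K K0 H] := taylor_lip (ltW r0) (taylor_xi r0 rs).
apply/cvgr0Pnorm_lt => d d0.
have K1 : 0 < K + 1 by rewrite ltr_wpDl.
move/cvgr0Pnorm_lt : us => us.
near=> n.
have h1 : `|cabs (u n - s)| < r by near: n; exact: us.
have h2 : `|cabs (u n - s)| < d / (K + 1) by near: n; apply: us; rewrite divr_gt0.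
rewrite !ger0_norm ?cabs_ge0 // in h1 h2 *.
have := H (u n - s) (ltW h1); rewrite [s + _]addrC subrK => h; apply: le_lt_trans h _.
apply: (@le_lt_trans _ _ ((K + 1) * cabs (u n - s))).
  by rewrite ler_wpM2r ?cabs_ge0 // lerDl.
by rewrite mulrC -ltr_pdivlMr.
Unshelve. all: by end_near. Qed.

Lemma cvg_cabs (u : nat -> R[i]) s :
  cabs (u n - s) @[n --> \oo] --> (0 : R) -> cabs (u n) @[n --> \oo] --> cabs s.
Proof.
move=> /cvgr0Pnorm_lt us; apply/cvgrPdist_lt => d d0.
near=> n.
have h : `|cabs (u n - s)| < d by near: n; exact: us.
rewrite ger0_norm ?cabs_ge0 // in h; apply: le_lt_trans h.
by rewrite distrC ler_norml cabsB andbT lerNl opprB cabsC cabsB.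
Unshelve. all: by end_near. Qed.

Definition en (n : nat) : R := n.+1%:R^-1.

Lemma en_gt0 n : 0 < en n.
Proof. by rewrite invr_gt0 ltr0n. Qed.

Lemma en_le1 n : en n <= 1.
Proof. by rewrite invf_le1 ?ltr0n // ler1n. Qed.

Lemma en_cvgM (K : R) : en n * K @[n --> \oo] --> (0 : R).
Proof.
by rewrite -[X in _ --> X](mul0r K); apply: cvgM; [exact: cvg_harmonic|exact: cvg_cst].
Qed.

Lemma squeeze0 (u : nat -> R) (K : R) :
  (forall n, 0 <= u n <= en n * K) -> u n @[n --> \oo] --> (0 : R).
Proof.
move=> h; apply: (squeeze_cvgr (nearW _ h)); first exact: cvg_cst.
exact: en_cvgM.
Qed.

Lemma xi_psi_cvg b t (Q : nat -> {poly R[i]}) : 1 / 2 <= b ->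
  (forall n s, 0 <= depth (en n) b s -> cabs (xi s - (Q n).[s]) <= en n / 4) ->
  cabs ((Q n).[psi (en n) b t]) @[n --> \oo] --> cabs (xi (b +i* t)).
Proof.
move=> b2 HQ; apply: cvg_cabs.
have h1 : cabs (xi (psi (en n) b t) - xi (b +i* t)) @[n --> \oo] --> (0 : R).
  apply: xi_cont; first by rewrite /=; lra.
  apply: (@squeeze0 _ (t ^+ 2)) => n; rewrite cabs_ge0 /=.
  exact: psi_line (ltW (en_gt0 n)).
have h2 : en n * 4^-1 + cabs (xi (psi (en n) b t) - xi (b +i* t)) @[n --> \oo] --> (0 : R).
  by rewrite -[X in _ --> X](addr0 0); apply: cvgD => //; exact: en_cvgM.
apply: (squeeze_cvgr _ (cvg_cst 0) h2); apply: nearW => n; rewrite cabs_ge0 /=.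
rewrite -(subrKA (xi (psi (en n) b t))); apply: le_trans (cabsD _ _) _; rewrite lerD2r cabsC.
by apply: HQ; rewrite psi_depth.
Qed.

Lemma xi_src_cvg b x (Q : nat -> {poly R[i]}) : 1 / 2 <= b -> 0 < x ->
  (forall n s, 0 <= depth (en n) b s -> cabs (xi s - (Q n).[s]) <= en n / 4) ->
  cabs ((Q n).[(src (en n) b x)%:C]) @[n --> \oo] --> cabs (xi (b + x)%:C).
Proof.
move=> b2 x0 HQ; apply: cvg_cabs.
have h1 : cabs (xi (src (en n) b x)%:C - xi (b + x)%:C) @[n --> \oo] --> (0 : R).
  apply: xi_cont; first by rewrite /=; lra.
  apply: (@squeeze0 _ (x ^+ 2)) => n; rewrite cabs_ge0.
  have -> : (src (en n) b x)%:C - (b + x)%:C = (src (en n) b x - (b + x))%:C by simpc.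
  rewrite cabs_real.
  exact: src_lim (ltW (en_gt0 n)) x0.
have h2 : en n * 4^-1 + cabs (xi (src (en n) b x)%:C - xi (b + x)%:C) @[n --> \oo] --> (0 : R).
  by rewrite -[X in _ --> X](addr0 0); apply: cvgD => //; exact: en_cvgM.
apply: (squeeze_cvgr _ (cvg_cst 0) h2); apply: nearW => n; rewrite cabs_ge0 /=.
rewrite -(subrKA (xi (src (en n) b x)%:C)); apply: le_trans (cabsD _ _) _; rewrite lerD2r cabsC.
apply: HQ; rewrite ltW // src_depth // ltr_wpDr // mulr_ge0 // ltW ?en_gt0 //.
Qed.

Lemma src_ge b e x : 0 <= e -> 0 < x -> 1 / 2 <= b -> 1 / 2 <= src e b x.
Proof.
move=> e0 x0 b2; apply: le_trans b2 _; rewrite lerDl divr_ge0 ?(ltW x0) //.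
by rewrite addr_ge0 // mulr_ge0 // ltW.
Qed.

(** The bound depends neither on [n] nor on [x], which allows the source to be moved far to the
    right later on. *)
Lemma Q_src_ge b x (P : {poly R[i]}) n : 1 / 2 <= b -> 0 < x ->
  (forall s, 0 <= depth (en n) b s -> cabs (xi s - P.[s]) <= en n / 4) ->
  1 / 4 <= cabs P.[(src (en n) b x)%:C].
Proof.
move=> b2 x0 HP.
have e0 := en_gt0 n; have e1 := en_le1 n.
have h1 : cabs (xi (src (en n) b x)%:C - P.[(src (en n) b x)%:C]) <= en n / 4.
  by apply: HP; rewrite ltW // src_depth // ltr_wpDr // mulr_ge0 // ltW.
have h2 := cabs_xi_real (src_ge (ltW e0) x0 b2).
have h3 := cabsB (xi (src (en n) b x)%:C) (xi (src (en n) b x)%:C - P.[(src (en n) b x)%:C]).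
rewrite opprB addrCA subrr addr0 in h3.
lra.
Qed.

Lemma ccont_horner e b x (P : {poly R[i]}) : 0 < x -> ccont (fun t => P.[psi e b t]).
Proof.
move=> x0; have cpsi : ccont (psi e b).
  by have := ccont_psi e b 0 x0; under eq_fun do rewrite subr0.
elim/poly_ind : P => [|P c IH].
  by under eq_fun do rewrite horner0; exact: ccont_cst.
under eq_fun do rewrite hornerMXaddC.
by apply: ccontD; [exact: ccontM|exact: ccont_cst].
Qed.

Lemma ccont_xi b : 1 / 2 <= b -> ccont (fun t => xi (b +i* t)).
Proof.
move=> b2.
suff H t (d : R) : 0 < d -> \forall y \near t, cabs (xi (b +i* y) - xi (b +i* t)) < d.
  split => t; apply/cvgrPdist_lt => d d0; have := H t d d0; apply: filterS => y; apply: le_lt_trans.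
    rewrite -normrN opprB; apply: le_trans (Re_le_cabs _).
    by rewrite ReD; case: (xi (b +i* t)).
  rewrite -normrN opprB; apply: le_trans (Im_le_cabs _).
  by rewrite ImD; case: (xi (b +i* t)).
move=> d0; pose r : R := 1 / 4.
have r0 : 0 < r by rewrite /r; lra.
have rs : r < complex.Re (b +i* t) by rewrite /= /r; lra.
have [K K0 Hl] := taylor_lip (ltW r0) (taylor_xi r0 rs).
have K1 : 0 < K + 1 by rewrite ltr_wpDl.
near=> y.
have E : (b +i* y) - (b +i* t) = 0 +i* (y - t) by simpc.
have hE : cabs ((b +i* y) - (b +i* t)) = `|y - t|.
  by rewrite E /cabs /= expr0n add0r sqrtr_sqr.
have h1 : `|y - t| < r.
  by rewrite -normrN opprB; near: y; apply: cvgr_dist_lt.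
have h2 : `|y - t| < d / (K + 1).
  by rewrite -normrN opprB; near: y; apply: cvgr_dist_lt => //; rewrite divr_gt0.
have := Hl ((b +i* y) - (b +i* t)); rewrite hE => /(_ (ltW h1)).
rewrite [(b +i* t) + _]addrC subrK => h; apply: le_lt_trans h _.
apply: (@le_lt_trans _ _ ((K + 1) * `|y - t|)).
  by rewrite ler_wpM2r // lerDl.
by rewrite mulrC -ltr_pdivlMr.
Unshelve. all: by end_near. Qed.

Lemma ln_cabs_le_maj (v : R[i]) t : cabs v <= 50 * (1 + t ^+ 2) -> ln (cabs v) <= maj t.
Proof.
move=> h; have [v0|v0] := ltP 0 (cabs v); last by rewrite (ln0 v0) maj_ge0.
by rewrite ler_ln ?posrE // (lt_le_trans v0).
Qed.

Lemma ln_xi_le_maj b t : 1 / 2 <= b -> b <= 1 -> ln (cabs (xi (b +i* t))) <= maj t.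
Proof.
move=> b2 b1; apply: ln_cabs_le_maj; have := xi_psi_le t (lexx 0) b2 b1.
have -> : psi 0 b t = b +i* t by rewrite /psi mul0r divr1; simpc.
by have := sqr_ge0 t; lra.
Qed.

Lemma ln_Q_le_maj b t n (P : {poly R[i]}) : 1 / 2 <= b -> b <= 1 ->
  (forall s, 0 <= depth (en n) b s -> cabs (xi s - P.[s]) <= en n / 4) ->
  ln (cabs P.[psi (en n) b t]) <= maj t.
Proof.
move=> b2 b1 HP; apply: ln_cabs_le_maj.
have h1 := xi_psi_le t (ltW (en_gt0 n)) b2 b1.
have h2 : cabs (xi (psi (en n) b t) - P.[psi (en n) b t]) <= en n / 4.
  by apply: HP; rewrite psi_depth.
have h3 := cabsB P.[psi (en n) b t] (xi (psi (en n) b t)).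
rewrite cabsC in h3; have := en_le1 n; have := sqr_ge0 t; lra.
Qed.

(** The gain [g] stands for the excess due to an interior zero. It is one constant for all large
    [n], so it survives the limit and can make the inequality strict. *)
Lemma submean b x (g : R) (Q : nat -> {poly R[i]}) (N : nat) :
  1 / 2 <= b -> b <= 1 -> 0 < x ->
  (forall n s, 0 <= depth (en n) b s -> cabs (xi s - (Q n).[s]) <= en n / 4) ->
  (forall n, (N <= n)%N -> ln (cabs (Q n).[(src (en n) b x)%:C]) + g <= mpoly (en n) b x (Q n)) ->
  mu.-integrable setT (EFin \o (fun t => ln (cabs (xi (b +i* t))) * pk x t)) /\
  ln (cabs (xi (b + x)%:C)) + g <=
    Rintegral mu setT (fun t => ln (cabs (xi (b +i* t))) * pk x t).
Proof.
move=> b2 b1 x0 HQ Hg.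
pose F (n : nat) t := (maj t - ln (cabs (Q n).[psi (en n) b t])) * pk x t.
pose G t := (maj t - ln (cabs (xi (b +i* t)))) * pk x t.
pose IM := Rintegral mu setT (fun t => maj t * pk x t).
have Qs n : (Q n).[(src (en n) b x)%:C] != 0.
  by rewrite -cabs_gt0; apply: lt_le_trans (Q_src_ge b2 x0 (HQ n)); lra.
have IQ n : mu.-integrable setT (EFin \o (fun t => ln (cabs (Q n).[psi (en n) b t]) * pk x t)).
  by case: (mean_poly x0 (en_gt0 n) (Qs n)).
have IF n : mu.-integrable setT (EFin \o F n).
  have := integrableB measurableT (integrable_maj x0) (IQ n).
  by congr (_.-integrable _ _); apply/funext => t; rewrite /= -EFinB /F mulrBl.
have EF n : Rintegral mu setT (F n) = IM - mpoly (en n) b x (Q n).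
  rewrite /F; under eq_Rintegral do rewrite mulrBl.
  by rewrite RintegralB //; exact: integrable_maj.
have [] := @fatou_real _ _ R mu F G (IM - ln (cabs (xi (b + x)%:C)) - g).
- move=> n; apply: measurable_funM; last by apply: continuous_measurable_fun; exact: continuous_pk.
  apply: measurable_funB; first by apply: continuous_measurable_fun; exact: continuous_maj.
  by apply: measurable_ln_cabs; exact: ccont_horner x0.
- apply: measurable_funM; last by apply: continuous_measurable_fun; exact: continuous_pk.
  apply: measurable_funB; first by apply: continuous_measurable_fun; exact: continuous_maj.
  by apply: measurable_ln_cabs; exact: ccont_xi.
- by move=> n t; rewrite mulr_ge0 ?pk_ge0 // subr_ge0 (ln_Q_le_maj t b2 b1 (HQ n)).
- by move=> t; rewrite mulr_ge0 ?pk_ge0 // subr_ge0 ln_xi_le_maj.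
- move=> t d d0.
  have cQ := @xi_psi_cvg b t Q b2 HQ.
  (* At a zero on the line [G t] is [maj t * pk x t], since [ln 0 = 0]. The approximants are
     eventually of modulus at most 1, so [F n t] is at least that. *)
  have [v0|v0] := eqVneq (xi (b +i* t)) 0.
    rewrite v0 cabs0 in cQ.
    near=> n; apply: (@le_trans _ _ (G t)); first by rewrite gerBl ltW.
    rewrite /G /F ler_wpM2r ?pk_ge0 // lerB // v0 cabs0 (ln0 (lexx _)).
    apply: ln_le0; near: n.
    move/cvgrPdist_lt : cQ => /(_ 1 ltr01); apply: filterS => n.
    by rewrite sub0r normrN => /ltW; apply: le_trans; exact: ler_norm.
  have H : (fun n => F n t) @ \oo --> G t.
    apply: cvgM; last exact: cvg_cst.
    apply: cvgB; first exact: cvg_cst.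
    by apply: (cvg_comp _ (@ln R) cQ); apply: continuous_ln; rewrite cabs_gt0.
  near=> n; apply: ltW; rewrite ltrBlDr -ltrBlDl.
  apply: le_lt_trans (ler_norm _) _; near: n.
  by move/cvgrPdist_lt : H; apply.
- exact: IF.
- move=> d d0.
  have cS := @xi_src_cvg b x Q b2 x0 HQ.
  have l0 : 0 < cabs (xi (b + x)%:C).
    by apply: lt_le_trans (cabs_xi_real _); lra.
  have cL : (fun n => ln (cabs (Q n).[(src (en n) b x)%:C])) @ \oo --> ln (cabs (xi (b + x)%:C)).
    by apply: (cvg_comp _ (@ln R) cS); exact: continuous_ln.
  near=> n; rewrite EF.
  have h1 : ln (cabs (Q n).[(src (en n) b x)%:C]) + g <= mpoly (en n) b x (Q n).
    by apply: Hg; near: n; exact: nbhs_infty_ge.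
  have h2 : `|ln (cabs (xi (b + x)%:C)) - ln (cabs (Q n).[(src (en n) b x)%:C])| < d.
    by near: n; move/cvgrPdist_lt : cL; apply.
  by move: h2; rewrite ltr_norml => /andP[_ h2]; lra.
move=> IG HG.
have IX : mu.-integrable setT (EFin \o (fun t => ln (cabs (xi (b +i* t))) * pk x t)).
  have := integrableB measurableT (integrable_maj x0) IG.
  congr (_.-integrable _ _); apply/funext => t.
  by rewrite /= -EFinB; congr EFin; rewrite /G; ring.
split => //; move: HG; rewrite /G.
have -> : Rintegral mu setT (fun t => (maj t - ln (cabs (xi (b +i* t)))) * pk x t) =
    IM - Rintegral mu setT (fun t => ln (cabs (xi (b +i* t))) * pk x t).
  under eq_Rintegral do rewrite mulrBl.
  by rewrite RintegralB //; exact: integrable_maj.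
lra.
Unshelve. all: by end_near. Qed.

End SubMean.

(** * Approximating polynomials and the zeros of xi *)

Section Approx.
Variable R : realType.
Notation mu := (@lebesgue_measure R).
Implicit Types (z s : R[i]) (e b x t a : R).

(** The disc has centre [b + r] and radius [r = 1 / (2 e)]. As [b > 0], it stays away from
    [Re s = 0], and a single Taylor expansion at the centre converges uniformly on it. *)
Lemma xi_poly b e (d : R) : 1 / 2 <= b -> 0 < e -> 0 < d ->
  exists P : {poly R[i]}, forall s, 0 <= depth e b s -> cabs (xi s - P.[s]) <= d.
Proof.
move=> b2 e0 d0; pose r := (2 * e)^-1.
have r0 : 0 < r by rewrite invr_gt0 mulr_gt0.
have rs : r < complex.Re (b + r)%:C by rewrite /= ltrDr; lra.
have [P HP] := taylor_poly d0 (ltW r0) (taylor_xi r0 rs).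
exists P => s hs; apply: HP.
rewrite -(ler_pXn2r (n := 2)) ?nnegrE ?cabs_ge0 ?(ltW r0) //.
move: hs; rewrite /depth !sqr_cabs; case: s => u v; simpc => /= hs.
have er : 2 * e * r = 1 by rewrite divff // mulf_neq0 // gt_eqF.
have hs2 : 0 <= 2 * r * (u - b - e * ((u - b) ^+ 2 + v ^+ 2)).
  by rewrite mulr_ge0 // mulr_ge0 // ltW.
have E : 2 * r * (u - b - e * ((u - b) ^+ 2 + v ^+ 2)) =
   2 * r * (u - b) - (2 * e * r) * ((u - b) ^+ 2 + v ^+ 2) by ring.
rewrite E er mul1r in hs2.
rewrite -subr_ge0; apply: le_trans hs2 _; rewrite le_eqVlt; apply/orP; left; apply/eqP; ring.
Qed.

Lemma zero_gain b x rho : 1 / 2 <= b -> b <= 1 -> 0 < x -> b < complex.Re rho -> xi rho = 0 ->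
  mu.-integrable setT (EFin \o (fun t => ln (cabs (xi (b +i* t))) * pk x t)) /\
  ln (cabs (xi (b + x)%:C)) < Rintegral mu setT (fun t => ln (cabs (xi (b +i* t))) * pk x t).
Proof.
move=> b2 b1 x0 brho rho0.
pose h := complex.Re rho - b; have h0 : 0 < h by rewrite subr_gt0.
pose A := cabs (rho - b%:C) ^+ 2.
(* [P0] bounds [|pz|] for every [e <= 1]. By [qz_pz], [|qz|^2 / |pz|^2 = 1 + 4 x depth / |pz|^2];
   once [depth >= h / 2], half the logarithm of this is at least [g], uniformly in [n]. *)
pose P0 := cabs (b%:C - rho) * (1 + x) + x.
have P00 : 0 < P0 by rewrite ltr_wpDl // mulr_ge0 ?cabs_ge0 // addr_ge0 // ltW.
pose g := ln (1 + 2 * x * h / P0 ^+ 2) / 2.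
have arg1 : 1 < 1 + 2 * x * h / P0 ^+ 2.
  by rewrite ltrDl divr_gt0 ?exprn_gt0 // !mulr_gt0.
have g0 : 0 < g by rewrite divr_gt0 // ln_gt0.
have [N HN] : exists N, forall n, (N <= n)%N -> h / 2 <= depth (en R n) b rho.
  have : (fun n => en R n * A) @ \oo --> (0 : R) by exact: en_cvgM.
  move=> /cvgr0Pnorm_le /(_ (h / 2)); rewrite divr_gt0 // => /(_ isT) [N _ HN].
  exists N => n Nn; have := HN n Nn; rewrite /depth -/h -/A => /(le_trans (ler_norm _)).
  by lra.
have ex n : exists Q : {poly R[i]}, (forall s, 0 <= depth (en R n) b s -> cabs (xi s - Q.[s]) <= en R n / 4) /\
   ((N <= n)%N -> root Q rho).
  have e0 := en_gt0 R n.
  (* Subtracting the constant [P.[rho]] creates a root exactly at [rho]. As [xi rho = 0], it costs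
     at most another [en / 8], within the tolerance [en / 4]. *)
  have [P HP] := @xi_poly b (en R n) (en R n / 8) b2 e0 (divr_gt0 e0 (ltr0Sn _ 7)).
  have [Nn|nN] := leqP N n; last first.
    exists P; split => // s /HP; lra.
  exists (P - (P.[rho])%:P); split; last by move=> _; rewrite rootE !hornerE subrr.
  move=> s hs; rewrite !hornerE opprB addrCA addrC.
  have dr : 0 <= depth (en R n) b rho by apply: le_trans (HN _ Nn); rewrite ltW // divr_gt0.
  have h1 := HP _ hs; have h2 := HP _ dr; rewrite rho0 sub0r cabsN in h2.
  by apply: le_trans (cabsD _ _) _; lra.
have [Q HQ] := choice ex.
have HQ1 n s : 0 <= depth (en R n) b s -> cabs (xi s - (Q n).[s]) <= en R n / 4.
  by case: (HQ n) => H _; exact: H.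
have [|I L] := @submean R b x g Q N b2 b1 x0 HQ1; last first.
  by split => //; apply: lt_le_trans L; rewrite ltrDl.
move=> n Nn; have rQ : root (Q n) rho by case: (HQ n) => _; exact.
have e0 := en_gt0 R n; have e1 := en_le1 R n.
have Qs : (Q n).[(src (en R n) b x)%:C] != 0.
  by rewrite -cabs_gt0; apply: lt_le_trans (Q_src_ge b2 x0 (HQ1 n)); lra.
have dn := HN n Nn.
have d0 : 0 < depth (en R n) b rho by apply: lt_le_trans dn; rewrite divr_gt0.
apply: le_trans (mpoly_gain x0 e0 Qs rQ d0); rewrite lerD2l.
have D := qz_pz (en R n) b x rho.
set q := cabs (qz _ _ _ _) in D *; set p := cabs (pz _ _ _ _) in D *.
have p0 : 0 < p.
  rewrite cabs_gt0; apply: contraNneq Qs => p0.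
  have ex0 : 0 < 1 + en R n * x by rewrite ltr_wpDr // mulr_ge0 // ltW.
  have := src_sub b rho ex0; rewrite p0 mul0r => /eqP; rewrite subr_eq0 => /eqP ->.
  exact/eqP/rootP.
have q0 : 0 < q ^+ 2.
  rewrite -[q ^+ 2](subrK (p ^+ 2)) D addr_gt0 ?exprn_gt0 //.
  by rewrite mulr_gt0 // mulr_gt0.
have qq : 0 < q by rewrite lt0r cabs_ge0 andbT; apply: contraTneq q0 => ->; rewrite expr0n ltxx.
have pP : p <= P0.
  rewrite /p /pz; apply: le_trans (cabsD _ _) _; rewrite cabs_real (ger0_norm (ltW x0)).
  rewrite lerD2r cabsM ler_wpM2l ?cabs_ge0 // cabs_real ger0_norm.
    by rewrite lerD2l ler_piMl // ltW.
  by rewrite addr_ge0 // mulr_ge0 // ltW.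
have -> : ln (q / p) = ln ((q / p) ^+ 2) / 2.
  by rewrite lnXn ?divr_gt0 // mulr2n mulrDl -splitr.
have a1 : 0 < 1 + 2 * x * h / P0 ^+ 2 := lt_trans ltr01 arg1.
have a2 : 0 < (q / p) ^+ 2 by rewrite exprn_gt0 // divr_gt0.
rewrite /g ler_wpM2r // ler_ln ?posrE //.
rewrite expr_div_n ler_pdivlMr ?exprn_gt0 // mulrDl mul1r.
rewrite -lerBrDl D.
apply: (@le_trans _ _ (2 * x * h)); last by have := ler_wpM2l (ltW x0) dn; lra.
rewrite [leLHS](_ : _ = 2 * x * h * (p ^+ 2 / P0 ^+ 2)); last by ring.
rewrite ger_pMr ?mulr_gt0 // ler_pdivrMr ?exprn_gt0 // mul1r.
by rewrite lerXn2r ?nnegrE // ltW.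
Qed.

Lemma submean0 b x : 1 / 2 <= b -> b <= 1 -> 0 < x ->
  mu.-integrable setT (EFin \o (fun t => ln (cabs (xi (b +i* t))) * pk x t)) /\
  ln (cabs (xi (b + x)%:C)) <= Rintegral mu setT (fun t => ln (cabs (xi (b +i* t))) * pk x t).
Proof.
move=> b2 b1 x0.
have ex n : exists Q : {poly R[i]}, forall s, 0 <= depth (en R n) b s -> cabs (xi s - Q.[s]) <= en R n / 4.
  by apply: xi_poly => //; rewrite ?divr_gt0 ?en_gt0.
have [Q HQ] := choice ex.
rewrite -[ln _]addr0; apply: (@submean R b x 0 Q 0%N) => // n _; rewrite addr0.
apply: mpoly_ge => //; first exact: en_gt0.
by rewrite -cabs_gt0; apply: lt_le_trans (Q_src_ge b2 x0 (HQ n)); lra.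
Qed.

Lemma xi_lower_local s0 : 0 < complex.Re s0 -> xi s0 != 0 ->
  exists d c : R, [/\ 0 < d, 0 < c & forall s, cabs (s - s0) < d -> c <= cabs (xi s)].
Proof.
move=> s00 x0; pose r := complex.Re s0 / 2.
have r0 : 0 < r by rewrite divr_gt0.
have rs : r < complex.Re s0 by rewrite /r; lra.
have [K K0 H] := taylor_lip (ltW r0) (taylor_xi r0 rs).
have v0 : 0 < cabs (xi s0) by rewrite cabs_gt0.
have K1 : 0 < 2 * (K + 1) by rewrite mulr_gt0 // ltr_wpDl.
exists (Num.min r (cabs (xi s0) / (2 * (K + 1)))), (cabs (xi s0) / 2); split.
- by rewrite lt_min r0 divr_gt0.
- by rewrite divr_gt0.
move=> s; rewrite lt_min => /andP[h1 h2].
have := H (s - s0) (ltW h1); rewrite [s0 + _]addrC subrK => h3.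
have h4 : K * cabs (s - s0) <= cabs (xi s0) / 2.
  apply: (@le_trans _ _ ((K + 1) * cabs (s - s0))).
    by rewrite ler_wpM2r ?cabs_ge0 // lerDl.
  move: h2; rewrite ltr_pdivlMr // => h2; lra.
have := cabsB (xi s0) (xi s); rewrite cabsC => h5; lra.
Qed.

Lemma cabs_pair_le (u v u' v' : R) : cabs ((u' +i* v') - (u +i* v) : R[i]) <= `|u' - u| + `|v' - v|.
Proof. exact: cabs_le_ReIm. Qed.

(** A point of the closed disc with real part [b] is [b] itself, where xi is at least 1/2; all other
    points lie in the zero-free region. Compactness of the disc then gives a minimum. *)
Lemma xi_min b e : 1 / 2 <= b -> 0 < e -> (forall s, b < complex.Re s -> xi s != 0) ->
  exists2 m : R, 0 < m & forall s, 0 <= depth e b s -> m <= cabs (xi s).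
Proof.
move=> b2 e0 nz.
have e1 : 0 < e^-1 by rewrite invr_gt0.
have nz' s : 0 <= depth e b s -> xi s != 0.
  move=> ds; have := depth_Re (ltW e0) ds; rewrite le_eqVlt => /orP[/eqP bs|]; last exact: nz.
  have : cabs (s - b%:C) ^+ 2 <= 0.
    by move: ds; rewrite /depth -bs subrr sub0r oppr_ge0 pmulr_rle0.
  rewrite real_exprn_even_le0 ?ger0_real ?cabs_ge0 //= cabs_eq0 subr_eq0 => /eqP ->.
  rewrite -cabs_gt0; apply: lt_le_trans (cabs_xi_real b2); lra.
pose A : set (R * R) := `[b, b + e^-1] `*` `[- e^-1, e^-1].
have cA : compact A by apply: compact_setX; exact: segment_compact.
pose f (p : R * R) : R[i] := p.1 +i* p.2.
have fd (p q : R * R) : cabs (f p - f q) <= `|p.1 - q.1| + `|p.2 - q.2|.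
  exact: cabs_pair_le.
have nf (p : R * R) (d : R) : 0 < d -> \forall q \near p, cabs (f q - f p) < d.
  move=> d0; have d20 : 0 < d / 2 by rewrite divr_gt0.
  near=> q; apply: le_lt_trans (fd q p) _.
  rewrite [d]splitr; apply: ltrD; rewrite distrC; near: q.
    by apply: (@cvgr_dist_lt _ _ _ _ _ (fun q : R * R => q.1) p.1) => //; exact: cvg_fst.
  by apply: (@cvgr_dist_lt _ _ _ _ _ (fun q : R * R => q.2) p.2) => //; exact: cvg_snd.
have cd : continuous (fun p => depth e b (f p)).
  move=> p; rewrite (_ : (fun p => _) = fun p : R * R => p.1 - b - e * ((p.1 - b) ^+ 2 + p.2 ^+ 2)).
    have c1 : (fun q : R * R => q.1 - b) @ p --> p.1 - b.
      by apply: cvgB; [exact: cvg_fst|exact: cvg_cst].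
    have c2 : (fun q : R * R => q.2) @ p --> p.2 by exact: cvg_snd.
    apply: cvgB => //; apply: cvgM; first exact: cvg_cst.
    apply: cvgD; rewrite /GRing.exp /=; apply: cvgM => //.
  by apply/funext => q; rewrite /depth sqr_cabs /f; simpc.
(* The candidate lower bound [i] tends to 0 from the right, and compactness makes the local lower
   bounds uniform. *)
have H : \forall i \near 0^'+, A `<=` (fun p => 0 <= depth e b (f p) -> i <= cabs (xi (f p))).
  apply: ((compact_near_coveringP A).1 cA R (0^'+)
    (fun i p => 0 <= depth e b (f p) -> i <= cabs (xi (f p)))) => p Ap.
  have [dp|dp] := leP 0 (depth e b (f p)); last first.
    exists ([set q | depth e b (f q) < 0], setT).
      by split; [exact: (cvgr_lt _ (cd p))|exact: filterT].
    by move=> [q i] [hq _] /=; rewrite leNgt hq.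
  have p1 : b <= p.1 by case: Ap => /=; rewrite in_itv /= => /andP[].
  have fp0 : 0 < complex.Re (f p) by rewrite /=; lra.
  have [d [c [d0 c0 H]]] := xi_lower_local fp0 (nz' _ dp).
  exists ([set q | cabs (f q - f p) < d], [set i : R | i < c]).
    by split; [exact: nf|exact: nbhs_right_lt].
  by move=> [q i] [hq ic] _; apply: le_trans (H _ hq); exact: ltW.
have [m [m0 Hm]] := filter_ex (filterI (nbhs_right_gt (0 : R)) H).
exists m => // s ds.
have E : s = f (complex.Re s, complex.Im s) by rewrite /f; case: (s).
rewrite E; apply: Hm; last by rewrite -E.
have bs := depth_Re (ltW e0) ds.
have d1 : cabs (s - b%:C) <= e^-1.
  have [->|n0] := eqVneq (cabs (s - b%:C)) 0; first exact: ltW.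
  have n1 : 0 < cabs (s - b%:C) by rewrite lt0r n0 cabs_ge0.
  have h : complex.Re s - b <= cabs (s - b%:C).
    apply: le_trans (Re_le_cabs _); apply: le_trans (ler_norm _).
    by rewrite ReD.
  have h2 : e * cabs (s - b%:C) ^+ 2 <= cabs (s - b%:C).
    by apply: le_trans h; move: ds; rewrite /depth subr_ge0.
  by rewrite -(ler_pM2l e0) divff ?gt_eqF // -(ler_pM2r n1) mul1r -mulrA -expr2.
have h1 := le_trans (Re_le_cabs _) d1; have h2 := le_trans (Im_le_cabs _) d1.
rewrite ReD ler_norml in h1; rewrite ImD ler_norml in h2.
move: h1 h2 => /= /andP[_ h1] /andP[h2 h3]; rewrite oppr0 addr0 in h2 h3.
by split; rewrite /= in_itv /= ?bs ?h2 ?h3 //= -lerBlDl.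
Unshelve. all: by end_near. Qed.

(** Moving from the line to the circle hardly approaches a point [b + i ga]: multiplied by
    [1 + i e t], the difference has imaginary part exactly [t - ga]. *)
Lemma psi_dist e b t ga : `|t - ga| <= cabs (psi e b t - (b +i* ga)) * (1 + `|e * t|).
Proof.
have d0 := one_ie_neq0 e t.
have E : (psi e b t - (b +i* ga)) * (1 +i* (e * t)) = (e * t * ga) +i* (t - ga).
  have -> : b +i* ga = b%:C + (0 +i* ga) by simpc.
  have -> : (psi e b t - (b%:C + (0 +i* ga))) * (1 +i* (e * t)) =
      (0 +i* t) - (0 +i* ga) * (1 +i* (e * t)).
    by rewrite /psi opprD addrACA subrr add0r mulrBl divfK.
  by simpc; congr (_ +i* _); ring.
apply: (@le_trans _ _ (cabs ((e * t * ga) +i* (t - ga)))).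
  exact: (Im_le_cabs ((e * t * ga) +i* (t - ga))).
rewrite -E cabsM ler_wpM2l ?cabs_ge0 //.
apply: le_trans (cabs_le_ReIm _) _; rewrite /= normr1 lexx //.
Qed.

Lemma xi_line_order b ga : 1 / 2 <= b -> (forall s, b < complex.Re s -> xi s != 0) ->
  exists (m : nat) (c r' : R), [/\ 0 < c, 0 < r' &
    forall z, cabs z <= r' ->
      c * cabs z ^+ m <= cabs (xi ((b +i* ga) + z)) <= 4 * c * cabs z ^+ m].
Proof.
move=> b2 nz; have r0 : 0 < 1 / 4 :> R by lra.
have rs : 1 / 4 < complex.Re (b +i* ga) by rewrite /=; lra.
apply: (taylor_order r0 (taylor_xi r0 rs)).
exists (1 / 4)%:C; first by rewrite cabs_real ger0_norm // ltW.
by apply: nz; rewrite /= ltrDl.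
Qed.

Lemma near_dist (ga d : R) : 0 < d -> \forall t \near ga, `|t - ga| < d.
Proof.
by move=> d0; near=> t; rewrite distrC; near: t; exact: cvgr_dist_lt.
Unshelve. all: by end_near. Qed.

(** Near [b + i ga], where xi has order [m], both moduli compare with [m]-th powers of distances to
    that point, and by [psi_dist] the point on the circle is at least half as far away as the one on
    the line. The same [c] bounds both the ratio and [e], so that one filter at [0^'+] serves for
    compactness. *)
Lemma xi_line_ratio b (T : R) : 1 / 2 <= b -> (forall s, b < complex.Re s -> xi s != 0) ->
  exists2 c : R, 0 < c & forall t e, - T <= t <= T -> 0 < e <= c ->
    c * cabs (xi (b +i* t)) <= cabs (xi (psi e b t)).
Proof.
move=> b2 nz.
pose P (c t : R) := forall e, 0 < e <= c -> c * cabs (xi (b +i* t)) <= cabs (xi (psi e b t)).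
have H : \forall c \near 0^'+, `[- T, T] `<=` P c.
  apply: ((compact_near_coveringP _).1 (@segment_compact R (- T) T) R (0^'+) P) => ga _.
  have [m [c0 [r' [c00 r0 Hm]]]] := xi_line_order ga b2 nz.
  pose M0 := `|ga| + 1; have M00 : 0 < M0 by rewrite ltr_wpDl.
  (* The first entry is the ratio of the bounds in [Hm] with distances halved; the second ensures
     [|e t| <= 1]; the third keeps [psi] within [r' / 2] of the line point, hence within [r'] of
     [b + i ga]. *)
  pose c1 := Num.min (2^-1 ^+ m / 4) (Num.min M0^-1 (r' / 2 / M0 ^+ 2)).
  have c10 : 0 < c1.
    by rewrite !lt_min divr_gt0 ?exprn_gt0 //= invr_gt0 M00 !divr_gt0 ?exprn_gt0.
  pose d := Num.min 1 (r' / 2).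
  have d0 : 0 < d by rewrite lt_min ltr01 divr_gt0.
  exists ([set t : R | `|t - ga| < d], [set c : R | 0 < c < c1]).
    split; first exact: near_dist.
    by near=> c; apply/andP; split; near: c; [exact: nbhs_right_gt|exact: nbhs_right_lt].
  move=> [t c] [td /andP[cp cc]] e /andP[e0 ec].
  move: td => /=; rewrite lt_min => /andP[t1 tr].
  have tM : `|t| <= M0.
    rewrite /M0 -[t](subrK ga) addrC; apply: le_trans (ler_normD _ _) _.
    by rewrite lerD2l ltW.
  have ec1 : e <= c1 by apply: le_trans ec (ltW cc).
  move: (ec1) (ltW cc); rewrite !le_min => /and3P[_ e2 e3] /and3P[c2 _ _].
  have et : `|e * t| <= 1.
    rewrite normrM (ger0_norm (ltW e0)).
    apply: le_trans (ler_wpM2l (ltW e0) tM) _.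
    by rewrite -ler_pdivlMr // div1r.
  have et2 : e * t ^+ 2 <= r' / 2.
    have h : t ^+ 2 <= M0 ^+ 2 by rewrite -(real_normK (num_real t)) lerXn2r ?nnegrE // ltW.
    apply: le_trans (ler_wpM2l (ltW e0) h) _.
    by rewrite -ler_pdivlMr // exprn_gt0.
  have E (s : R[i]) : (b +i* ga) + (s - (b +i* ga)) = s by rewrite addrC subrK.
  have n1 : cabs ((b +i* t) - (b +i* ga)) = `|t - ga|.
    have -> : (b +i* t) - (b +i* ga) = 0 +i* (t - ga) by simpc.
    by rewrite /cabs /= expr0n add0r sqrtr_sqr.
  have h1 : cabs (xi (b +i* t)) <= 4 * c0 * `|t - ga| ^+ m.
    have := Hm ((b +i* t) - (b +i* ga)); rewrite E n1.
    have tr' : `|t - ga| <= r' by apply: le_trans (ltW tr) _; rewrite ler_pdivrMr // ler_peMr ?ler1n // ltW.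
    by move=> /(_ tr') /andP[].
  have h2 : c0 * cabs (psi e b t - (b +i* ga)) ^+ m <= cabs (xi (psi e b t)).
    have := Hm (psi e b t - (b +i* ga)); rewrite E.
    have hr : cabs (psi e b t - (b +i* ga)) <= r'.
      rewrite -(subrKA (b +i* t)); apply: le_trans (cabsD _ _) _.
      rewrite [r']splitr; apply: lerD; last by rewrite n1 ltW.
      exact: le_trans (psi_line b t (ltW e0)) et2.
    by move=> /(_ hr) /andP[].
  have h3 : 2^-1 * `|t - ga| <= cabs (psi e b t - (b +i* ga)).
    rewrite ler_pdivrMl // mulrC; apply: le_trans (psi_dist e b t ga) _.
    by rewrite ler_wpM2l ?cabs_ge0 // -[leRHS]/(1 + 1) lerD2l.
  apply: le_trans h2; apply: (@le_trans _ _ (c0 * (2^-1 * `|t - ga|) ^+ m)); last first.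
    apply: ler_wpM2l; first exact: ltW.
    apply: lerXn2r => //; rewrite nnegrE ?cabs_ge0 //.
  apply: le_trans (ler_wpM2l (ltW cp) h1) _.
  have zz : 0 <= c0 * `|t - ga| ^+ m by rewrite mulr_ge0 ?exprn_ge0 // ltW.
  have := ler_wpM2r zz c2.
  by rewrite exprMn; lra.
have [c [c0 Hc]] := filter_ex (filterI (nbhs_right_gt (0 : R)) H).
exists c => // t e tT; apply: Hc; by rewrite /= in_itv.
Unshelve. all: by end_near. Qed.

(** By [xi_line_order] zeros on the line are isolated, so each bounded segment contains finitely
    many and the whole line countably many. *)
Lemma xi_line_null b : 1 / 2 <= b -> (forall s, b < complex.Re s -> xi s != 0) ->
  {ae mu, forall t, xi (b +i* t) != 0}.
Proof.
move=> b2 nz.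
have fin (T : R) : exists s : seq R, forall t, - T <= t <= T -> xi (b +i* t) = 0 -> t \in s.
  (* The filter of all sufficiently large finite lists: along it, compactness collects the local
     zeros into one list. *)
  pose F : set_system (seq R) := [set S | exists s0 : seq R, forall s : seq R, {subset s0 <= s} -> S s].
  have FF : Filter F.
    split.
    - by exists [::].
    - move=> A B [s0 H0] [s1 H1]; exists (s0 ++ s1) => s ss; split.
        by apply: H0 => x xs; apply: ss; rewrite mem_cat xs.
      by apply: H1 => x xs; apply: ss; rewrite mem_cat xs orbT.
    - by move=> A B AB [s0 H0]; exists s0 => s ss; exact/AB/H0.
  have [s0 H0] : F (fun s : seq R => `[- T, T] `<=` (fun t => xi (b +i* t) = 0 -> t \in s)).
    apply: ((compact_near_coveringP _).1 (@segment_compact R (- T) T) (seq R) F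
      (fun (s : seq R) t => xi (b +i* t) = 0 -> t \in s)) => ga _.
    have [m [c0 [r' [c00 r0 Hm]]]] := xi_line_order ga b2 nz.
    exists ([set t : R | `|t - ga| < r'], [set s : seq R | ga \in s]).
      split; first exact: near_dist.
      by exists [:: ga] => s ss; apply: ss; rewrite inE.
    move=> [t s] [td gs] t0.
    have := Hm ((b +i* t) - (b +i* ga)).
    have -> : (b +i* t) - (b +i* ga) = 0 +i* (t - ga) by simpc.
    have -> : cabs (0 +i* (t - ga) : R[i]) = `|t - ga| by rewrite /cabs /= expr0n add0r sqrtr_sqr.
    have -> : (b +i* ga) + (0 +i* (t - ga)) = b +i* t by simpc; congr (_ +i* _); ring.
    move=> /(_ (ltW td)) /andP[+ _]; rewrite t0 cabs0 => h.
    have [->//|tg] := eqVneq t ga.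
    have : 0 < c0 * `|t - ga| ^+ m by rewrite mulr_gt0 // exprn_gt0 // normr_gt0 subr_eq0.
    by rewrite ltNge h.
  by exists s0 => t tT; apply: (H0 s0) => //=; rewrite in_itv.
have : mu.-negligible (\bigcup_n [set t : R | - n%:R <= t <= n%:R /\ xi (b +i* t) = 0]).
  apply: negligible_bigcup => n.
  have [s Hs] := fin n%:R.
  apply: (@negligibleS _ _ _ mu [set` s]).
    by move=> t [tn t0]; exact: Hs.
  have fs : countable [set` s] by apply: finite_set_countable; exact: finite_seq.
  apply/negligibleP; last exact: countable_lebesgue_measure0.
  exact: countable_measurable.
apply: negligibleS => t /= /negP; rewrite negbK => /eqP t0.
exists (Num.truncn `|t|).+1 => //; split => //.
by rewrite -ler_norml ltW // truncnS_gt.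
Unshelve. all: by end_near. Qed.

End Approx.

(** * The zero-free case *)

Section ZeroFree.
Variable R : realType.
Notation mu := (@lebesgue_measure R).
Implicit Types (z s : R[i]) (e b x t a : R).

Lemma pk_tail x (T : R) t : 0 < x -> 0 < T -> T <= `|t| -> pk x t <= 2 * x / T * pk T t.
Proof.
move=> x0 T0 Tt; have p0 := pi_gt0 R.
have d1 := pk_den_gt0 t x0; have d2 := pk_den_gt0 t T0.
have -> : 2 * x / T * pk T t = 2 * x / (pi * (T ^+ 2 + t ^+ 2)).
  by rewrite /pk mulrA divfK // gt_eqF.
rewrite /pk ler_pdivrMr ?mulr_gt0 // mulrAC ler_pdivlMr ?mulr_gt0 //.
rewrite [2 * x]mulrC -mulrA ler_wpM2l ?(ltW x0) // mulrCA ler_wpM2l ?(ltW p0) //.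
have h : T ^+ 2 <= t ^+ 2 by rewrite -(real_normK (num_real t)) lerXn2r ?nnegrE // ltW.
by have := sqr_ge0 x; lra.
Qed.

(** Replace [1 + t^2] by the larger [T^2 + t^2 = 4 T^2 / |1 + wc T t|^2]. The mean of
    [ln |1 + wc T|] is nonnegative by [mlin_le], which leaves [ln (50 * 4 * T^2)]. *)
Lemma Rintegral_maj_le (T : R) : 1 <= T ->
  Rintegral mu setT (fun t => maj t * pk T t) <= ln (200 * T ^+ 2).
Proof.
move=> T1; have T0 : 0 < T := lt_le_trans ltr01 T1.
have [I J _] := mlin_le T0 (oner_neq0 R[i]) (lexx _).
rewrite cabs1 ln1 in J.
have E t : ln (50 * (T ^+ 2 + t ^+ 2)) = ln (200 * T ^+ 2) - 2 * ln (cabs (1 + 1 * wc T t)).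
  have h : cabs (1 + 1 * wc T t) ^+ 2 = 4 * T ^+ 2 / (T ^+ 2 + t ^+ 2).
    have d : (T +i* t) != 0 :> R[i] by exact: xt_neq0.
    have -> : 1 + 1 * wc T t = (2 * T)%:C / (T +i* t).
      apply: (mulIf d); rewrite divfK // mul1r mulrDl wcE // mul1r.
      by simpc; congr (_ +i* _); ring.
    rewrite cabsf expr_div_n cabs_real sqr_cabs /= ger0_norm ?mulr_ge0 // ?(ltW T0) //.
    by congr (_ / _); ring.
  have d2 : 0 < T ^+ 2 + t ^+ 2 by rewrite ltr_wpDr ?sqr_ge0 // exprn_gt0.
  have T2 : 0 < T ^+ 2 by rewrite exprn_gt0.
  rewrite ln_cabs h ln_div ?posrE ?mulr_gt0 // !lnM ?posrE //.
  have -> : 200 = 50 * 4 :> R by ring.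
  by rewrite lnM ?posrE //; lra.
have I1 := integrableZl measurableT (ln (200 * T ^+ 2)) (integrable_pk T0).
have I2 := integrableZl measurableT 2 I.
have E2 : Rintegral mu setT (fun t => ln (200 * T ^+ 2) * pk T t - 2 * (ln (cabs (1 + 1 * wc T t)) * pk T t))
   = ln (200 * T ^+ 2) - 2 * mlin T 1 1.
  rewrite RintegralB //.
  rewrite (@RintegralZl _ _ R mu setT (pk T) _ measurableT (integrable_pk T0)).
  rewrite (@RintegralZl _ _ R mu setT _ _ measurableT I).
  by rewrite {1}/Rintegral integral_pk // mulr1.
apply: (@le_trans _ _ (ln (200 * T ^+ 2) - 2 * mlin T 1 1)); last by lra.
rewrite -E2; apply: le_Rintegral => //; first exact: integrable_maj.
  have := integrableB measurableT I1 I2.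
  by congr (_.-integrable _ _); apply/funext => t; rewrite /= -EFinM -EFinB.
move=> t _; rewrite mulrA -mulrBl -E ler_wpM2r ?pk_ge0 // /maj.
have d2 : 0 < 1 + t ^+ 2 by rewrite ltr_wpDr ?sqr_ge0.
have h : 1 <= T ^+ 2 by rewrite exprn_ege1.
by rewrite ler_ln ?posrE ?mulr_gt0 ?ler_pM2l ?lerD2r // (lt_le_trans d2) // lerD2r.
Qed.

Lemma tail_small a (d : R) : 0 < a -> 0 < d ->
  exists2 T : R, 1 <= T & 2 * a / T * (Rintegral mu setT (fun t => maj t * pk T t) + ln 4) <= d.
Proof.
(* With [T = S^2] the logarithm is [ln 200 + 4 ln S], and [ln S < S] bounds the bracket by [c S].
   The product is then at most [2 c a / S], and [S] is chosen to make this at most [d]. *)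
move=> a0 d0; pose c : R := ln 200 + ln 4 + 4; pose S := 1 + 2 * c * a / d.
have l1 : 0 <= ln 200 :> R by rewrite ln_ge0 // ler1n.
have l2 : 0 <= ln 4 :> R by rewrite ln_ge0 // ler1n.
have c0 : 0 < c by rewrite ltr_wpDl ?addr_ge0 // ltr0n.
have p : 0 < 2 * c * a / d by rewrite divr_gt0 // !mulr_gt0.
have S1 : 1 <= S by rewrite lerDl ltW.
have S0 : 0 < S := lt_le_trans ltr01 S1.
exists (S ^+ 2); first by rewrite exprn_ege1.
have h : Rintegral mu setT (fun t => maj t * pk (S ^+ 2) t) + ln 4 <= c * S.
  apply: (@le_trans _ _ (ln (200 * (S ^+ 2) ^+ 2) + ln 4)).
    by rewrite lerD2r Rintegral_maj_le // exprn_ege1.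
  have c1 : 0 < 200 :> R by rewrite ltr0n.
  rewrite -exprM lnM ?posrE ?exprn_gt0 // lnXn //.
  have h1 := ltW (ln_sublinear S0).
  have h2 := ler_wpM2l l1 S1; have h3 := ler_wpM2l l2 S1.
  have -> : c * S = ln 200 * S + ln 4 * S + 4 * S by rewrite -!mulrDl.
  by rewrite !mulr1 in h2 h3; rewrite addrAC; apply: lerD; [exact: lerD|by rewrite mulr_natl ler_wMn2r].
clearbody c.
apply: le_trans (ler_wpM2l _ h) _; first by rewrite divr_ge0 ?mulr_ge0 ?exprn_ge0 // ltW.
have -> : 2 * a / S ^+ 2 * (c * S) = 2 * c * a / S by field; rewrite gt_eqF.
rewrite ler_pdivrMr // /S mulrDr mulr1 [d * (_ / _)]mulrC divfK ?gt_eqF //.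
by rewrite lerDr ltW.
Qed.

(** An error of at most half the minimum from [xi_min] leaves at least half of [|xi|] everywhere on
    the disc. *)
Lemma zero_free_poly b e (d : R) : 1 / 2 <= b -> 0 < e -> 0 < d ->
  (forall s, b < complex.Re s -> xi s != 0) ->
  exists P : {poly R[i]}, [/\ forall s, 0 <= depth e b s -> cabs (xi s - P.[s]) <= d,
    forall s, 0 <= depth e b s -> cabs (xi s) / 2 <= cabs P.[s] &
    forall s, 0 <= depth e b s -> P.[s] != 0].
Proof.
move=> b2 e0 d0 nz; have [m m0 Hm] := xi_min b2 e0 nz.
have dm : 0 < Num.min d (m / 2) by rewrite lt_min d0 divr_gt0.
have [P HP] := xi_poly b2 e0 dm.
have h s : 0 <= depth e b s -> cabs (xi s) / 2 <= cabs P.[s].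
  move=> ds; have := HP s; rewrite le_min => /(_ ds) /andP[_ h].
  have := Hm s ds; have := cabsB (xi s) (xi s - P.[s]).
  by rewrite subKr; lra.
exists P; split => //.
  by move=> s /HP; rewrite le_min => /andP[].
move=> s ds; rewrite -cabs_gt0; apply: lt_le_trans (h s ds).
by rewrite divr_gt0 // (lt_le_trans m0) // Hm.
Qed.

(** The nonnegative function [maj - ln |Q n|] is split at [|t| = T]. The inner part converges by
    domination. The outer part is at most [2 a / T] times the whole integral against [pk T], which
    [mpoly_eq] evaluates through the value of [Q n] at a real source, and [Q_src_ge] bounds that
    value below by 1/4. *)
Lemma zero_free_tail b a (T : R) : 1 / 2 <= b -> b <= 1 -> 0 < a -> 1 <= T ->
  (forall s, b < complex.Re s -> xi s != 0) ->
  Rintegral mu setT (fun t => ln (cabs (xi (b +i* t))) * pk a t) <=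
  ln (cabs (xi (b + a)%:C)) +
    2 * a / T * (Rintegral mu setT (fun t => maj t * pk T t) + ln 4).
Proof.
move=> b2 b1 a0 T1 nz; have T0 : 0 < T := lt_le_trans ltr01 T1.
have l0 : 0 < cabs (xi (b + a)%:C) by apply: lt_le_trans (cabs_xi_real _); lra.
have aux (x y l k z : R) : y - l <= z + k -> z <= y - x -> x <= l + k by lra.
have [Q HQ] := choice (fun n => zero_free_poly b2 (en_gt0 R n) (divr_gt0 (en_gt0 R n) (ltr0Sn _ 3)) nz).
have Q1 n s : 0 <= depth (en R n) b s -> cabs (xi s - (Q n).[s]) <= en R n / 4 by case: (HQ n) => + _ _; apply.
have Q2 n s : 0 <= depth (en R n) b s -> cabs (xi s) / 2 <= cabs (Q n).[s] by case: (HQ n) => _ + _; apply.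
have Q3 n s : 0 <= depth (en R n) b s -> (Q n).[s] != 0 by case: (HQ n) => _ _; apply.
have [c c0 Hc] := xi_line_ratio T b2 nz.
have [N HN] : exists N, forall n, (N <= n)%N -> en R n <= c.
  have /cvgr0Pnorm_le /(_ c c0) [N _ HN] := @en_cvgM R 1.
  by exists N => n /HN /=; rewrite mulr1; apply: le_trans; exact: ler_norm.
pose U n t := maj t - ln (cabs (Q n).[psi (en R n) b t]).
pose V t := maj t - ln (cabs (xi (b +i* t))).
pose IM x := Rintegral mu setT (fun t => maj t * pk x t).
have U0 n t : 0 <= U n t by rewrite subr_ge0 (ln_Q_le_maj t b2 b1 (Q1 n)).
have V0 t : 0 <= V t by rewrite subr_ge0 ln_xi_le_maj.
have mmaj : measurable_fun setT (@maj R) by apply: continuous_measurable_fun; exact: continuous_maj.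
have mpk x : 0 < x -> measurable_fun setT (@pk R x).
  by move=> x0; apply: continuous_measurable_fun; exact: continuous_pk.
have mU n : measurable_fun setT (U n).
  by apply: measurable_funB => //; apply: measurable_ln_cabs; exact: ccont_horner a0.
have mV : measurable_fun setT V.
  by apply: measurable_funB => //; apply: measurable_ln_cabs; exact: ccont_xi.
have Qs n x : 0 < x -> 0 <= depth (en R n) b (src (en R n) b x)%:C.
  by move=> x0; rewrite ltW // src_depth // ltr_wpDr // mulr_ge0 // ltW // en_gt0.
have IQ n x : 0 < x -> mu.-integrable setT (EFin \o (fun t => ln (cabs (Q n).[psi (en R n) b t]) * pk x t)).
  by move=> x0; case: (mean_poly x0 (en_gt0 R n) (Q3 n _ (Qs n x x0))).
have IU n x : 0 < x -> mu.-integrable setT (EFin \o (fun t => U n t * pk x t)).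
  move=> x0; have := integrableB measurableT (integrable_maj x0) (IQ n x x0).
  by congr (_.-integrable _ _); apply/funext => t; rewrite /= -EFinB -mulrBl.
have EU n x : 0 < x -> Rintegral mu setT (fun t => U n t * pk x t) =
    IM x - ln (cabs (Q n).[(src (en R n) b x)%:C]).
  move=> x0; rewrite -(mpoly_eq x0 (en_gt0 R n) (Q3 n)).
  under eq_Rintegral do rewrite mulrBl.
  by rewrite RintegralB //; [exact: integrable_maj|exact: IQ].
have [IX _] := submean0 b2 b1 a0.
have IV : mu.-integrable setT (EFin \o (fun t => V t * pk a t)).
  have := integrableB measurableT (integrable_maj a0) IX.
  by congr (_.-integrable _ _); apply/funext => t; rewrite /= -EFinB -mulrBl.
have EV : Rintegral mu setT (fun t => V t * pk a t) =
    IM a - Rintegral mu setT (fun t => ln (cabs (xi (b +i* t))) * pk a t).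
  under eq_Rintegral do rewrite mulrBl.
  by rewrite RintegralB //; exact: integrable_maj.
pose D : set R := [set` `[- T, T]].
(* The shift by [N] makes [en <= c] for every term, as the domination must hold for all [n]. *)
pose f n t := U (n + N)%N t * pk a t * \1_D t.
pose g t := V t * pk a t * \1_D t.
have mD : measurable_fun setT (\1_D : R -> R) by apply: measurable_indic; exact: measurable_itv.
have mf n : measurable_fun setT (f n).
  by apply: measurable_funM => //; apply: measurable_funM => //; exact: mpk.
have mg : measurable_fun setT g.
  by apply: measurable_funM => //; apply: measurable_funM => //; exact: mpk.
have D01 t : 0 <= (\1_D t : R) <= 1 by rewrite indicE; case: (t \in D); rewrite ?lexx ?ler01.
have If n : mu.-integrable setT (EFin \o f n).
  have := IU (n + N)%N a a0; apply: le_integrable => //; first by apply/measurable_EFinP; exact: mf.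
  move=> t _ /=; have [d0 d1] := andP (D01 t).
  have w0 : 0 <= U (n + N)%N t * pk a t by rewrite mulr_ge0 ?pk_ge0.
  by rewrite lee_fin /f [`|_ * \1_D t|]normrM (ger0_norm w0) (ger0_norm d0) ler_piMr.
have nul := xi_line_null b2 nz.
(* On [D] the approximant is at least half of [|xi|] on the circle, hence at least [c / 2] times
   [|xi|] on the line, so [U <= V - ln (c / 2)]. *)
pose h t := (V t + `|ln (c / 2)|) * pk a t.
have Ih : mu.-integrable setT (EFin \o h).
  have := integrableD measurableT IV (integrableZl measurableT `|ln (c / 2)| (integrable_pk a0)).
  by congr (_.-integrable _ _); apply/funext => t; rewrite /= -EFinD -mulrDl.
have [Ig _ L] : [/\ mu.-integrable setT (EFin \o g),
    [sequence (\int[mu]_t `|(EFin \o f n) t - (EFin \o g) t|)%E]_n @ \oo --> (0 : \bar R) &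
    [sequence (\int[mu]_t (EFin \o f n) t)%E]_n @ \oo --> (\int[mu]_t (EFin \o g) t)%E].
  apply: (@dominated_convergence _ _ R mu setT measurableT _ _ (EFin \o h)) => //.
  - by move=> n; apply/measurable_EFinP; exact: mf.
  - by apply/measurable_EFinP; exact: mg.
  (* Zeros on the line are left out, since [ln 0 = 0] breaks pointwise convergence there. *)
  - apply: ae_weak nul _ => t t0 _; apply: cvg_EFin; first exact: nearW.
    apply: cvgMl; apply: cvgMl; apply: cvgB; first exact: cvg_cst.
    have cQ := @xi_psi_cvg R b t Q b2 Q1; rewrite -(cvg_shiftn N) in cQ.
    by apply: (cvg_comp _ (@ln R) cQ); apply: continuous_ln; rewrite cabs_gt0.
  - apply: ae_weak nul _ => t t0 n _ /=; rewrite lee_fin.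
    have [d0 d1] := andP (D01 t).
    have w0 : 0 <= U (n + N)%N t * pk a t by rewrite mulr_ge0 ?pk_ge0.
    rewrite ger0_norm; last exact: mulr_ge0.
    have [tD|tD] := boolP (t \in D); last first.
      by rewrite /f indicE (negbTE tD) mulr0; apply: mulr_ge0; [exact: addr_ge0|exact: pk_ge0].
    rewrite /f indicE tD mulr1 /h ler_wpM2r ?pk_ge0 //.
    move: tD; rewrite inE /D /= in_itv /= => tD.
    have e0 := en_gt0 R (n + N); have eN : en R (n + N) <= c by apply: HN; exact: leq_addl.
    have k1 : c * cabs (xi (b +i* t)) <= cabs (xi (psi (en R (n + N)) b t)).
      by apply: Hc => //; rewrite e0.
    have k2 : cabs (xi (psi (en R (n + N)) b t)) / 2 <= cabs (Q (n + N)%N).[psi (en R (n + N)) b t].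
      by apply: Q2; rewrite psi_depth.
    have x0 : 0 < cabs (xi (b +i* t)) by rewrite cabs_gt0.
    have k3 : c / 2 * cabs (xi (b +i* t)) <= cabs (Q (n + N)%N).[psi (en R (n + N)) b t].
      by apply: le_trans k2; rewrite mulrAC ler_wpM2r.
    have c2 : 0 < c / 2 by rewrite divr_gt0.
    have k4 : ln (c / 2) + ln (cabs (xi (b +i* t))) <= ln (cabs (Q (n + N)%N).[psi (en R (n + N)) b t]).
      by rewrite -lnM ?posrE // ler_ln ?posrE ?(lt_le_trans _ k3) ?mulr_gt0.
    have := ler_norm (- ln (c / 2)); rewrite normrN /U /V; lra.
have Lf : (fun n => Rintegral mu setT (f n)) @ \oo --> Rintegral mu setT g.
  apply: fine_cvg; rewrite fineK; first exact: L.
  exact: integrable_fin_num.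
have gV : Rintegral mu setT g <= Rintegral mu setT (fun t => V t * pk a t).
  apply: le_Rintegral => // t _.
  have w0 : 0 <= V t * pk a t by apply: mulr_ge0; [exact: V0|exact: pk_ge0].
  by rewrite /g ler_piMr //; case/andP: (D01 t).
pose K := 2 * a / T * (IM T + ln 4).
have aT : 0 <= 2 * a / T by rewrite divr_ge0 ?mulr_ge0 // ltW.
have key n : IM a - ln (cabs (Q (n + N)%N).[(src (en R (n + N)%N) b a)%:C]) <=
    Rintegral mu setT (f n) + K.
  rewrite -EU //; apply: (@le_trans _ _ (Rintegral mu setT (f n) +
    2 * a / T * Rintegral mu setT (fun t => U (n + N)%N t * pk T t))); last first.
    rewrite lerD2l ler_wpM2l // EU // lerD2l lerNl -lnV ?posrE //.
    have q := @Q_src_ge R b T _ _ b2 T0 (Q1 (n + N)%N); rewrite div1r in q.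
    by rewrite ler_ln ?posrE ?invr_gt0 // (lt_le_trans _ q) ?invr_gt0.
  rewrite -RintegralZl //; last exact: IU.
  have IZ : mu.-integrable setT (EFin \o (fun t => 2 * a / T * (U (n + N)%N t * pk T t))).
    exact: (integrableZl measurableT (2 * a / T) (IU (n + N)%N T T0)).
  rewrite -(@RintegralD _ _ R mu setT (f n) _ measurableT (If n) IZ).
  apply: le_Rintegral => //; first exact: IU.
    exact: (integrableD measurableT (If n) IZ).
  move=> t _; have [tD|tD] := boolP (t \in D).
    rewrite /f indicE tD mulr1 lerDl; apply: mulr_ge0 => //.
    by rewrite mulr_ge0 ?pk_ge0.
  rewrite /f indicE (negbTE tD) mulr0 add0r [leRHS]mulrCA ler_wpM2l //.
  apply: pk_tail => //; move: tD; rewrite notin_setE /D /= in_itv /= => /negP.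
  by rewrite -ler_norml -ltNge => /ltW.
have cS := @xi_src_cvg R b a Q b2 a0 Q1.
have cL : (fun n => ln (cabs (Q n).[(src (en R n) b a)%:C])) @ \oo --> ln (cabs (xi (b + a)%:C)).
  by apply: (cvg_comp _ (@ln R) cS); exact: continuous_ln.
rewrite -(cvg_shiftn N) in cL.
have : IM a - ln (cabs (xi (b + a)%:C)) <= Rintegral mu setT g + K.
  apply: ler_cvg_to (cvgB (cvg_cst (IM a)) cL) (cvgD Lf (cvg_cst K)) _.
  exact: nearW key.
by move=> /aux; apply; rewrite -EV.
Qed.

Lemma zero_free b a : 1 / 2 <= b -> b <= 1 -> 0 < a ->
  (forall s, b < complex.Re s -> xi s != 0) ->
  Rintegral mu setT (fun t => ln (cabs (xi (b +i* t))) * pk a t) <= ln (cabs (xi (b + a)%:C)).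
Proof.
move=> b2 b1 a0 nz; apply/ler_addgt0Pr => d d0.
have [T T1 HT] := tail_small a0 d0.
by apply: le_trans (zero_free_tail b2 b1 a0 T1 nz) _; rewrite lerD2l.
Qed.

End ZeroFree.

(** * From xi back to zeta *)

Section Main.
Variable R : realType.
Notation mu := (@lebesgue_measure R).
Implicit Types (s : R[i]) (a b t : R).

Lemma xi_neq0 s : s != 1 -> (xi s != 0) = (zeta s != 0).
Proof. by move=> s1; rewrite -(xi_zeta s1) mulf_eq0 [s - 1 == 0]subr_eq0 (negbTE s1) orbF. Qed.

Lemma mean_ln_zetaE a b : 0 < a -> 1 / 2 <= b -> b < 1 ->
  ((a / pi)%:E * \int[mu]_(t in [set: R])
     ((ln (cabs (zeta (b +i* t) * ((b - 1) +i* t)))) / (a ^+ 2 + t ^+ 2))%:E)%E =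
  (Rintegral mu setT (fun t => ln (cabs (xi (b +i* t))) * pk a t))%:E.
Proof.
move=> a0 b2 b1; have p0 := pi_gt0 R.
(* Integrability allows the constant to be taken out of the extended-real integral and makes the
   left side a real number. *)
have [I _] := submean0 b2 (ltW b1) a0.
have E t : ln (cabs (zeta (b +i* t) * ((b - 1) +i* t))) / (a ^+ 2 + t ^+ 2) =
    pi / a * (ln (cabs (xi (b +i* t))) * pk a t).
  have d := pk_den_gt0 t a0.
  have s1 : b +i* t != 1 by rewrite eq_complex /= negb_and lt_eqF.
  have -> : (b - 1) +i* t = (b +i* t) - 1 by simpc.
  by rewrite xi_zeta // /pk; move: (pi : R) p0 => p p0; field; rewrite !gt_eqF.
under eq_integral => t _ do rewrite E EFinM.
rewrite integralZl // muleA -EFinM.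
have -> : a / pi * (pi / a) = 1 by move: (pi : R) p0 => p p0; field; rewrite !gt_eqF.
by rewrite mul1e fineK // integrable_fin_num.
Qed.

End Main.

Theorem theorem3 (R : realType) (a b : R) :
  0 < a -> 1 / 2 <= b -> b < 1 -> a + b != 1 ->
  (((a / pi)%:E *
      \int[@lebesgue_measure R]_(t in [set: R])
        ((ln (cabs (zeta (b +i* t) * ((b - 1) +i* t)))) / (a ^+ 2 + t ^+ 2))%:E)%E
    = (ln (cabs (zeta ((a + b)%:C) * ((a + b - 1)%:C))))%:E)
  <-> (forall s : R[i], b < complex.Re s -> s != 1 -> zeta s != 0).
Proof.
move=> a0 b2 b1 ab1; rewrite mean_ln_zetaE //.
have -> : zeta (a + b)%:C * (a + b - 1)%:C = xi (b + a)%:C.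
  have -> : (a + b - 1)%:C = (a + b)%:C - 1 by simpc.
  by rewrite xi_zeta ?[b + a]addrC // eq_complex /= negb_and ab1.
split => [[] E s bs s1|nz].
  rewrite -xi_neq0 //; apply/eqP => s0.
  by have [_] := zero_gain b2 (ltW b1) a0 bs s0; rewrite E ltxx.
congr EFin; apply/eqP; rewrite eq_le (submean0 b2 (ltW b1) a0).2 andbT.
apply: zero_free => //; first exact: ltW.
(* The hypothesis says nothing about zeta at its pole; there xi is nonzero by the real lower
   bound. *)
move=> s bs; have [->|s1] := eqVneq s 1; last by rewrite xi_neq0 // nz.
by rewrite -cabs_gt0 (lt_le_trans _ (@cabs_xi_real R 1 _)) //; lra.
Qed.
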